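(* Let $n\geq 3$ be a natural number and $(R,\Delta)$ a Hermitian form ring where $R$ is commutative. Let $H$ be a subgroup of $U_{2n+1}(R,\Delta)$. Then $H$ is normalized by $EU_{2n+1}(R,\Delta)$ if and only if $$EU_{2n+1}((R,\Delta),(I,\Omega))\subseteq H\subseteq CU_{2n+1}((R,\Delta),(I,\Omega))$$ for some odd form ideal $(I,\Omega)$ of $(R,\Delta)$.
   Context: Rings are associative with $1\neq0$. For group elements, $[g,h]:=ghg^{-1}h^{-1}$. Hermitian rings: a Hermitian ring is a quadruple $(R,\bar{\ },\lambda,\mu)$ where $R$ is a ring, $\bar{\ }:R\to R$ is an anti-isomorphism (bijective, additive, $\overline{xy}=\bar y\bar x$, $\bar 1=1$), $\lambda\in R$ satisfies $\bar{\bar x}=\lambda x\bar\lambda$ for all $x\in R$ (then $\bar\lambda=\lambda^{-1}$), and $\mu\in R$ satisfies $\mu=\bar\mu\lambda$. A subset $A\subseteq R$ is involution invariant if $\bar x\in A$ for all $x\in A$. Heisenberg group: $\mathfrak{H}$ is the set $R\times R$ with group operation $(x_1,y_1)\overset{.}{+}(x_2,y_2):=(x_1+x_2,\,y_1+y_2-\bar x_1\mu x_2)$, equipped with the right action of the multiplicative monoid of $R$ given by $(x,y)\circ a:=(xa,\bar a y a)$. Inverses are denoted using $\overset{.}{-}$. An $R^{\bullet}$-submodule of $\mathfrak{H}$ is a subgroup stable under all $\circ a$, $a\in R$. For $A\subseteq\mathfrak{H}$ and $B\subseteq R$, $A\circ B$ denotes the subgroup generated by $\{\alpha\circ b\mid\alpha\in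 A,b\in B\}$. The trace map is $tr:\mathfrak{H}\to R$, $tr(x,y)=\bar x\mu x+y+\bar y\lambda$. Set $\Delta_{min}:=\{(0,x-\bar x\lambda)\mid x\in R\}$ and $\Delta_{max}:=\ker(tr)$. An odd form parameter is an $R^{\bullet}$-submodule $\Delta$ of $\mathfrak{H}$ with $\Delta_{min}\subseteq\Delta\subseteq\Delta_{max}$. A Hermitian form ring is a pair $((R,\bar{\ },\lambda,\mu),\Delta)$ with $\Delta$ an odd form parameter; it is abbreviated $(R,\Delta)$. Set $J(\Delta):=\{y\in R\mid\exists z\in R:(y,z)\in\Delta\}$. Odd form ideals: let $I$ be an involution invariant ideal of $R$. Set $\tilde I:=\{x\in R\mid\overline{J(\Delta)}\mu x\subseteq I\}$, $\Omega^I_{min}:=\{(0,x-\bar x\lambda)\mid x\in I\}\overset{.}{+}\Delta\circ I$ and $\Omega^I_{max}:=\Delta\cap(\tilde I\times I)$. A relative odd form parameter of level $I$ is an $R^{\bullet}$-submodule $\Omega$ of $\mathfrak{H}$ with $\Omega^I_{min}\subseteq\Omega\subseteq\Omega^I_{max}$; then $(I,\Omega)$ is called an odd form ideal of $(R,\Delta)$. Set $\Delta^{1}:=\Delta$, $\Delta^{-1}:=\{(x,y)\in R\times R\mid(x,\bar y)\in\Delta\}$, $\Omega^{1}:=\Omega$, $\Omega^{-1}:=\{(x,y)\in R\times R\mid(x,\bar y)\in\Omega\}$. Index set: $\Theta:=\{1,\dots,n,0,-n,\dots,-1\}$, $\Theta_{hb}:=\Theta\setminus\{0\}$; for $i\in\Theta_{hb}$,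 $\epsilon(i)=1$ if $i>0$ and $\epsilon(i)=-1$ if $i<0$. The rows and columns of $(2n+1)\times(2n+1)$ matrices and the coordinates of column vectors $u\in M:=R^{2n+1}$ are indexed by $\Theta$ in the order $1,\dots,n,0,-n,\dots,-1$; $\sigma_{ij}$ is the entry of $\sigma$ at position $(i,j)$. Unitary group: define $b:M\times M\to R$ by $b(u,v)=\sum_{i=1}^n\bar u_iv_{-i}+\bar u_0\mu v_0+\sum_{i=-n}^{-1}\bar u_i\lambda v_{-i}$ and $q:M\to\mathfrak{H}$ by $q(u):=(u_0,\sum_{i=1}^n\bar u_iu_{-i})$. Then $$U_{2n+1}(R,\Delta):=\{\sigma\in GL_{2n+1}(R)\mid b(\sigma u,\sigma v)=b(u,v)\ \forall u,v\in M\text{ and }q(\sigma u)\equiv q(u)\bmod\Delta\ \forall u\in M\}.$$ Here and below, $\alpha\equiv\beta$ modulo a subgroup of $\mathfrak{H}$ means that $\alpha\overset{.}{-}\beta$ lies in that subgroup. Elementary matrices: let $e$ be the identity matrix and $e^{ij}$ the matrix with $1$ at position $(i,j)$ and $0$ elsewhere. For $i,j\in\Theta_{hb}$, $i\neq\pm j$, $x\in R$ set $$T_{ij}(x):=e+xe^{ij}-\lambda^{(\epsilon(j)-1)/2}\bar x\lambda^{(1-\epsilon(i))/2}e^{-j,-i}.$$ For $i\in\Theta_{hb}$ and $(x,y)\in\Delta^{-\epsilon(i)}$ set $$T_i(x,y):=e+xe^{0,-i}-\lambda^{-(1+\epsilon(i))/2}\bar x\mu e^{i0}+ye^{i,-i}.$$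 These matrices lie in $U_{2n+1}(R,\Delta)$, and $EU_{2n+1}(R,\Delta)$ is the subgroup of $U_{2n+1}(R,\Delta)$ generated by all of them. Let $(I,\Omega)$ be an odd form ideal of $(R,\Delta)$. - $EU_{2n+1}(I,\Omega)$ is the subgroup of $EU_{2n+1}(R,\Delta)$ generated by all $T_{ij}(x)$ with $i,j\in\Theta_{hb}$, $i\neq\pm j$, $x\in I$, and all $T_i(x,y)$ with $i\in\Theta_{hb}$, $(x,y)\in\Omega^{-\epsilon(i)}$. $EU_{2n+1}((R,\Delta),(I,\Omega))$ is the normal closure of $EU_{2n+1}(I,\Omega)$ in $EU_{2n+1}(R,\Delta)$. - Let $M(R,\Delta):=\{u\in M\mid u_0\in J(\Delta)\}$ and, for a matrix $\sigma$, let $\sigma_{hb}:=(\sigma_{ij})_{i,j\in\Theta_{hb}}$. The principal congruence subgroup is $$U_{2n+1}((R,\Delta),(I,\Omega)):=\{\sigma\in U_{2n+1}(R,\Delta)\mid\sigma_{hb}\equiv e_{hb}\bmod I\text{ and }q(\sigma u)\equiv q(u)\bmod\Omega\ \forall u\in M(R,\Delta)\},$$ which is a subgroup of $U_{2n+1}(R,\Delta)$. - $NU_{2n+1}((R,\Delta),(I,\Omega))$ is the normalizer of $U_{2n+1}((R,\Delta),(I,\Omega))$ in $U_{2n+1}(R,\Delta)$. - $CU_{2n+1}((R,\Delta),(I,\Omega)):=\{\sigma\in NU_{2n+1}((R,\Delta),(I,\Omega))\mid[\sigma,EU_{2n+1}(R,\Delta)]\subseteq U_{2n+1}((R,\Delta),(I,\Omega))\}$.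 *)

(* Defs.v *)
From HB Require Import structures.
From mathcomp Require Import all_boot all_order all_algebra.
From mathcomp Require Import monoid classical_sets.

Set Implicit Arguments.
Unset Strict Implicit.
Unset Printing Implicit Defensive.

Import GRing.Theory.
Local Open Scope classical_set_scope.
Local Open Scope ring_scope.

Section GroupSets.
Variable G : groupType.
Implicit Types (A B E X : set G) (g h : G).
Local Open Scope group_scope.

Definition is_subgroup A : Prop :=
  [/\ A 1, (forall g h, A g -> A h -> A (g * h)) & (forall g, A g -> A g^-1)].

Definition generated A : set G := smallest is_subgroup A.

Definition conj_set g X : set G := [set g * x * g^-1 | x in X].

Definition normalizer_in E X : set G := [set g | E g /\ conj_set g X = X].

Definition normalized_by E X : Prop := forall g, E g -> conj_set g X = X.

(* For X contained in the subgroup E. *)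
Definition normal_closure E X : set G :=
  generated [set g * x * g^-1 | g in E & x in X].

(* This is not the library's [~ g, h], which is g^-1 * h^-1 * g * h. *)
Definition commutator g h : G := g * h * g^-1 * h^-1.

Definition prod_set A B : set G := [set a * b | a in A & b in B].

Definition congr_mod A g h : Prop := A (g * h^-1).

End GroupSets.

Section GeneralLinear.
Variables (R : nzRingType) (m : nat).

(* An invertible matrix is stored together with its two-sided inverse. *)
Record GL := MkGL {
  gl_pair : 'M[R]_m * 'M[R]_m;
  gl_pairP : (gl_pair.1 *m gl_pair.2 == 1%:M)
             && (gl_pair.2 *m gl_pair.1 == 1%:M) }.

HB.instance Definition _ := [isSub for gl_pair].
HB.instance Definition _ := [Choice of GL by <:].

Definition gl_mx (g : GL) : 'M[R]_m := (gl_pair g).1.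

Lemma gl_mx_inj : injective gl_mx.
Proof.
move=> [[a a'] p] [[b b'] q]; rewrite /gl_mx /= => eab; subst b.
apply: val_inj => /=; congr pair.
case/andP: p q => /= /eqP aa' /eqP a'a /andP[/eqP ab' /eqP b'a].
by rewrite -[a']mulmx1 -ab' mulmxA a'a mul1mx.
Qed.

Lemma gl_one_subproof :
  ((1%:M : 'M[R]_m) *m 1%:M == 1%:M) && ((1%:M : 'M[R]_m) *m 1%:M == 1%:M).
Proof. by rewrite mulmx1 eqxx. Qed.

Definition gl_one : GL := @MkGL (1%:M, 1%:M) gl_one_subproof.

Lemma gl_inv_subproof (g : GL) :
  ((gl_pair g).2 *m (gl_pair g).1 == 1%:M)
  && ((gl_pair g).1 *m (gl_pair g).2 == 1%:M).
Proof. by rewrite andbC gl_pairP. Qed.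

Definition gl_inv (g : GL) : GL :=
  @MkGL ((gl_pair g).2, (gl_pair g).1) (gl_inv_subproof g).

Lemma gl_mul_subproof (g h : GL) :
  (((gl_pair g).1 *m (gl_pair h).1) *m ((gl_pair h).2 *m (gl_pair g).2) == 1%:M)
  && (((gl_pair h).2 *m (gl_pair g).2) *m ((gl_pair g).1 *m (gl_pair h).1)
      == 1%:M).
Proof.
case/andP: (gl_pairP g) (gl_pairP h) => /eqP g1 /eqP g2 /andP[/eqP h1 /eqP h2].
rewrite mulmxA -[X in X *m _]mulmxA h1 mulmx1 g1 eqxx /=.
by rewrite mulmxA -[X in X *m _]mulmxA g2 mulmx1 h2.
Qed.

Definition gl_mul (g h : GL) : GL :=
  @MkGL ((gl_pair g).1 *m (gl_pair h).1, (gl_pair h).2 *m (gl_pair g).2)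
        (gl_mul_subproof g h).

Lemma gl_mulA : associative gl_mul.
Proof. by move=> a b c; apply: gl_mx_inj; rewrite /gl_mx /= mulmxA. Qed.

Lemma gl_mul1 : left_id gl_one gl_mul.
Proof. by move=> a; apply: gl_mx_inj; rewrite /gl_mx /= mul1mx. Qed.

Lemma gl_1mul : right_id gl_one gl_mul.
Proof. by move=> a; apply: gl_mx_inj; rewrite /gl_mx /= mulmx1. Qed.

Lemma gl_mulV : left_inverse gl_one gl_inv gl_mul.
Proof.
by move=> a; apply: gl_mx_inj; rewrite /gl_mx /=; case/andP: (gl_pairP a) => _ /eqP.
Qed.

Lemma gl_Vmul : right_inverse gl_one gl_inv gl_mul.
Proof.
by move=> a; apply: gl_mx_inj; rewrite /gl_mx /=; case/andP: (gl_pairP a) => /eqP.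
Qed.

HB.instance Definition _ :=
  isGroup.Build GL gl_mulA gl_mul1 gl_1mul gl_mulV gl_Vmul.

End GeneralLinear.

Record hermRing (R : nzRingType) := HermRing {
  bar : R -> R;
  lam : R;
  mu : R;
  bar_bij : bijective bar;
  barD : forall x y, bar (x + y) = bar x + bar y;
  barM : forall x y, bar (x * y) = bar y * bar x;
  bar1 : bar 1 = 1;
  bar_bar : forall x, bar (bar x) = lam * x * bar lam;
  mu_bar : mu = bar mu * lam }.

Section HermRingTheory.
Variables (R : nzRingType) (A : hermRing R).

Lemma bar0 : bar A 0 = 0.
Proof. by apply: (addrI (bar A 0)); rewrite -barD !addr0. Qed.

Lemma barN x : bar A (- x) = - bar A x.
Proof. by apply: (addrI (bar A x)); rewrite -barD !subrr bar0. Qed.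

Lemma lam_bar : lam A * bar A (lam A) = 1.
Proof. by have := bar_bar A 1; rewrite !bar1 mulr1. Qed.

Lemma bar_lam : bar A (lam A) * lam A = 1.
Proof.
apply: (bij_inj (bar_bij A)); apply: (bij_inj (bar_bij A)).
by rewrite bar_bar mulrA lam_bar mul1r lam_bar !bar1.
Qed.

(* lam ^ k for an integer k, where lam ^ (-1) = bar lam (see lam_bar, bar_lam) *)
Definition lam_exp (k : int) : R :=
  match k with
  | Posz p => lam A ^+ p
  | Negz p => bar A (lam A) ^+ p.+1
  end.

End HermRingTheory.

(* The Heisenberg group; its operation is written multiplicatively, so that
   alpha .+ beta is (alpha * beta)%g and alpha .- beta is (alpha * beta^-1)%g. *)
Definition heis (R : nzRingType) (A : hermRing R) : Type := (R * R)%type.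

Section Heisenberg.
Variables (R : nzRingType) (A : hermRing R).

HB.instance Definition _ := Choice.copy (heis A) (R * R)%type.

Definition heis_add (a b : heis A) : heis A :=
  (a.1 + b.1, a.2 + b.2 - bar A a.1 * mu A * b.1).

Definition heis_zero : heis A := (0, 0).

Definition heis_opp (a : heis A) : heis A :=
  (- a.1, - a.2 - bar A a.1 * mu A * a.1).

Lemma heis_addA : associative heis_add.
Proof.
move=> [x1 y1] [x2 y2] [x3 y3]; rewrite /heis_add /=; congr pair.
  by rewrite addrA.
rewrite barD !mulrDl mulrDr !opprD !addrA.
set p12 := _ * x2; set p13 := bar A x1 * _ * x3; set p23 := _ * x3.
rewrite [RHS]addrAC [y1 + y2 - p12 + y3]addrAC.
by rewrite [y1 + y2 + y3 - p12 - p23]addrAC.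
Qed.

Lemma heis_add0 : left_id heis_zero heis_add.
Proof. by move=> [x y]; rewrite /heis_add /= bar0 !mul0r subr0 !add0r. Qed.

Lemma heis_0add : right_id heis_zero heis_add.
Proof. by move=> [x y]; rewrite /heis_add /= mulr0 subr0 !addr0. Qed.

Lemma heis_addN : left_inverse heis_zero heis_opp heis_add.
Proof.
move=> [x y]; rewrite /heis_add /=; congr pair; rewrite ?addNr //.
by rewrite barN !mulNr opprK addrAC subrK addNr.
Qed.

Lemma heis_Nadd : right_inverse heis_zero heis_opp heis_add.
Proof.
move=> [x y]; rewrite /heis_add /=; congr pair; rewrite ?subrr //.
by rewrite mulrN opprK addrA subrr add0r addNr.
Qed.

HB.instance Definition _ :=
  isGroup.Build (heis A) heis_addA heis_add0 heis_0add heis_addN heis_Nadd.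

Definition heis_act (a : heis A) (r : R) : heis A :=
  (a.1 * r, bar A r * a.2 * r).

Definition is_heis_submodule (S : set (heis A)) : Prop :=
  is_subgroup S /\ forall a r, S a -> S (heis_act a r).

Definition heis_act_set (S : set (heis A)) (B : set R) : set (heis A) :=
  generated [set heis_act a r | a in S & r in B].

Definition heis_tr (a : heis A) : R :=
  bar A a.1 * mu A * a.1 + a.2 + bar A a.2 * lam A.

Definition min_part (B : set R) : set (heis A) :=
  [set ((0, x - bar A x * lam A) : heis A) | x in B].

Definition Delta_min : set (heis A) := min_part setT.
Definition Delta_max : set (heis A) := [set a | heis_tr a = 0].

Definition is_odd_form_parameter (D : set (heis A)) : Prop :=
  [/\ is_heis_submodule D, Delta_min `<=` D & D `<=` Delta_max].

Definition heis_J (D : set (heis A)) : set R :=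
  [set y | exists z, D ((y, z) : heis A)].

(* S^k for k = 1 or k = -1 *)
Definition heis_sgn (S : set (heis A)) (k : int) : set (heis A) :=
  if k == -1 then [set a : heis A | S ((a.1, bar A a.2) : heis A)] else S.

End Heisenberg.

Arguments min_part {R} A B _.
Arguments Delta_min {R} A _.
Arguments Delta_max {R} A _.

Record hermFormRing (R : nzRingType) := HermFormRing {
  herm :> hermRing R;
  Delta : set (heis herm);
  DeltaP : is_odd_form_parameter Delta }.

Arguments Delta {R} h _.

Section OddFormIdeals.
Variables (R : nzRingType) (F : hermFormRing R).

Definition is_ideal (I : set R) : Prop :=
  [/\ I 0, (forall x y, I x -> I y -> I (x + y)),
      (forall r x, I x -> I (r * x)) & (forall r x, I x -> I (x * r))].

Definition bar_invariant (B : set R) : Prop := forall x, B x -> B (bar F x).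

Definition ideal_tilde (I : set R) : set R :=
  [set x | forall y, heis_J (Delta F) y -> I (bar F y * mu F * x)].

Definition Omega_min (I : set R) : set (heis F) :=
  prod_set (min_part F I) (heis_act_set (Delta F) I).

Definition Omega_max (I : set R) : set (heis F) :=
  [set a : heis F | [/\ Delta F a, ideal_tilde I a.1 & I a.2]].

Definition is_odd_form_ideal (I : set R) (Om : set (heis F)) : Prop :=
  [/\ is_ideal I, bar_invariant I, is_heis_submodule Om,
      Omega_min I `<=` Om & Om `<=` Omega_max I].

End OddFormIdeals.

Arguments is_odd_form_ideal {R} F I Om.

(* The element of {1,..,n,0,-n,..,-1} at position p of this list (0 <= p <= 2n)
   is represented by p : 'I_(n.*2.+1): thus i > 0 is represented by i - 1, the
   index 0 by n, and the sign change i |-> -i by p |-> 2n - p, i.e. rev_ord. *)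

Section IndexSet.
Variable n : nat.
Implicit Types i j : 'I_(n.*2.+1).

Lemma th_zero_subproof : (n < n.*2.+1)%N.
Proof. by rewrite ltnS -addnn leq_addr. Qed.

Definition th_zero : 'I_(n.*2.+1) := Ordinal th_zero_subproof.
Definition th_opp i : 'I_(n.*2.+1) := rev_ord i.
Definition th_pos i : bool := (i < n)%N.
Definition th_neg i : bool := (n < i)%N.
Definition th_hb i : bool := i != th_zero.

(* only meaningful for i != 0 *)
Definition th_eps i : int := if th_pos i then 1 else -1.

End IndexSet.

Section Unitary.
Variables (R : nzRingType) (F : hermFormRing R) (n : nat).

Notation vec := 'cV[R]_(n.*2.+1).
Notation idx := 'I_(n.*2.+1).
Notation GLn := (GL R n.*2.+1).
Notation o := (th_zero n).

Definition form_b (u v : vec) : R :=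
  \sum_(i : idx | th_pos i) bar F (u i 0) * v (th_opp i) 0
  + bar F (u o 0) * mu F * v o 0
  + \sum_(i : idx | th_neg i) bar F (u i 0) * lam F * v (th_opp i) 0.

Definition form_q (u : vec) : heis F :=
  (u o 0, \sum_(i : idx | th_pos i) bar F (u i 0) * u (th_opp i) 0).

Definition Ugroup : set GLn :=
  [set s : GLn |
     (forall u v : vec, form_b (gl_mx s *m u) (gl_mx s *m v) = form_b u v) /\
     (forall u : vec,
        congr_mod (Delta F) (form_q (gl_mx s *m u)) (form_q u))].

Definition Tshort (i j : idx) (x : R) : 'M[R]_(n.*2.+1) :=
  1%:M + x *: delta_mx i j
  - (lam_exp F ((th_eps j - 1) %/ 2)%Z * bar F x
     * lam_exp F ((1 - th_eps i) %/ 2)%Z) *: delta_mx (th_opp j) (th_opp i).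

Definition Textra (i : idx) (a : heis F) : 'M[R]_(n.*2.+1) :=
  1%:M + a.1 *: delta_mx o (th_opp i)
  - (lam_exp F (- ((1 + th_eps i) %/ 2)%Z) * bar F a.1 * mu F) *: delta_mx i o
  + a.2 *: delta_mx i (th_opp i).

(* The elementary generators with parameters in I and S; for I = R and
   S = Delta they are all the elementary matrices. *)
Definition elementary (I : set R) (S : set (heis F)) : set GLn :=
  [set s : GLn |
     (exists i j x, [/\ th_hb i, th_hb j, i != j, i != th_opp j & I x]
                    /\ gl_mx s = Tshort i j x) \/
     (exists i a, [/\ th_hb i, heis_sgn S (- th_eps i) a
                    & gl_mx s = Textra i a])].

Definition EUgroup : set GLn := generated (elementary setT (Delta F)).

Section Relative.
Variables (I : set R) (Om : set (heis F)).

Definition EUideal : set GLn := generated (elementary I Om).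

Definition EUrel : set GLn := normal_closure EUgroup EUideal.

Definition M_Delta : set vec := [set u : vec | heis_J (Delta F) (u o 0)].

Definition Urel : set GLn :=
  [set s : GLn |
     [/\ Ugroup s,
         (forall i j, th_hb i -> th_hb j ->
            I (gl_mx s i j - (1%:M : 'M[R]_(n.*2.+1)) i j))
       & (forall u : vec, M_Delta u ->
            congr_mod Om (form_q (gl_mx s *m u)) (form_q u))]].

Definition NUrel : set GLn := normalizer_in Ugroup Urel.

Definition CUrel : set GLn :=
  [set s : GLn | NUrel s /\ (forall t, EUgroup t -> Urel (commutator s t))].

End Relative.

End Unitary.

Arguments Ugroup {R} F n _.
Arguments EUgroup {R} F n _.
Arguments EUrel {R} F n I Om _.
Arguments Urel {R} F n I Om _.
Arguments NUrel {R} F n I Om _.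
Arguments CUrel {R} F n I Om _.

(* Main.v *)
Require Import Defs.
From mathcomp Require Import all_boot all_order all_algebra.
From mathcomp Require Import monoid classical_sets.
From mathcomp Require Import zify ring.

(** Over a commutative ring the anti-isomorphism is an involution, and the elementary
matrices are transvections
   T(u; v, y) w = w + b(u,w) v - conj(b(w,v)) u + y b(u,w) u
along basis vectors u = e_i, the index i being nonzero (Tshort_Tv, Textra_Tv).
Everything is deduced from two facts about general transvections.

- P_avoid: T(f; v, y) is elementary when f is singular and f_l = f_-l = 0 for some l.
  Indeed T(e_-l; v, y), conjugated by an elementary matrix, becomes T(e_-l + f; v, y),
  and this splits into T(f; v, y) and elementary factors.
- P_unimodular: T(u; x w, 0) is elementary when u, w are singular and orthogonal and
  b(u,w') = 1 for some w'. The s such that T(u; s x w, 0) is elementary for all x form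
  an ideal. By P_avoid, applied to the vectors b(u,e_-k) f - b(u,f) e_-k orthogonal to u,
  it contains (u_k conj(u_k))^3. The radical of the ideal does not change when an
  elementary matrix is applied to u and w; so it contains the products
  u_j conj(u_k), then every u_k, and finally 1 = b(u,w').

Both facts hold over any frame: a commutative ring with involution, a subring of scalars,
and a form parameter over it. Besides (R, Delta) itself, they are applied to R * R with the
pairs of scalars congruent modulo I and the pairs in Delta congruent modulo Omega, the
role of the elementary group being played by the pairs (g, s) with s in EU and g s^-1 in
EU((R,Delta),(I,Omega)). Thus one statement about pairs contains the relative results:
EU is normal, congruent data give elementary matrices congruent modulo the relative
group, [U((R,Delta),(I,Omega)), EU] is contained in it (Urel_comm), and an isometry that
respects the congruence normalizes it (respects_normalizes).

If H lies between the two groups: an element of CU acts on the points of the quadratic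
module by a scalar modulo (I, Omega) (comm_scalar_on), hence normalizes the relative
elementary group; the three subgroups argument (comm_comm) and perfectness of EU give
[CU, EU] inside the relative elementary group, hence inside H (sandwich_normalized).

If H is normalized by EU: let I be the set of x with T_ij(x) in H for all i, j, and Omega
the set of (x, y) in Delta with T_i(x, y) in H for all i and with the level conditions on
x and y. This is an odd form ideal (level_ideal), whose relative elementary group
lies in H. For s in H put u = s e_i. A vector f orthogonal to u with many zero
coordinates gives an elementary transvection t along f that fixes u; then s^-1 t s fixes
e_i and differs from t by an element of H. Commutators of such elements with elementary
matrices yield elementary matrices in H whose parameters are products of entries of u
(product_step), and then, by unimodularity of u, the entries themselves (offdiag).
The same device puts the odd coordinate of u in Omega (column_step, column). So s acts
as a scalar modulo (I, Omega) (scalar_on_H), which means that s is in CU (in_CUrel). *)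

Set Implicit Arguments.
Unset Strict Implicit.
Unset Printing Implicit Defensive.

Import GRing.Theory.
Local Open Scope ring_scope.

(** * Indices, the involution and the hermitian form *)

Section Indices.
Variable n : nat.
Implicit Types i j k l : 'I_(n.*2.+1).

Lemma th_oppK i : th_opp (th_opp i) = i. Proof. exact: rev_ordK. Qed.

Lemma eq_th_opp i j : (th_opp i == th_opp j) = (i == j).
Proof. by apply/eqP/eqP => [/rev_ord_inj|->]. Qed.

Lemma th_opp_eqC i j : (th_opp i == j) = (i == th_opp j).
Proof. by rewrite -{1}(th_oppK j) eq_th_opp. Qed.

Lemma th_opp_zero : th_opp (th_zero n) = th_zero n.
Proof. by apply: val_inj => /=; lia. Qed.

Lemma th_hb_opp i : th_hb (th_opp i) = th_hb i.
Proof. by rewrite /th_hb th_opp_eqC th_opp_zero. Qed.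

Lemma th_hb_neq i : th_hb i -> (i == th_opp i) = false.
Proof.
move=> hi; apply/negP => /eqP/(congr1 val) /= ei; case/eqP: hi.
by have := ltn_ord i; move=> li; apply: val_inj => /=; lia.
Qed.

Lemma th_pos_opp i : th_pos (th_opp i) = th_neg i.
Proof. by have := ltn_ord i; rewrite /th_pos /th_neg /=; lia. Qed.

Lemma th_neg_opp i : th_neg (th_opp i) = th_pos i.
Proof. by rewrite -th_pos_opp th_oppK. Qed.

Lemma th_hbE i : th_hb i = th_pos i || th_neg i.
Proof. by rewrite /th_hb -val_eqE /th_pos /th_neg /=; lia. Qed.

Lemma th_negE i : th_hb i -> th_neg i = ~~ th_pos i.
Proof. by rewrite /th_hb -val_eqE /th_pos /th_neg /=; lia. Qed.

(** The pairs (i, j) for which the transvection along e_i with value in R e_j is one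
of the matrices T_ij. The relation is symmetric and insensitive to signs, unlike the
condition on the indices of T_ij, since T(e_i; x e_j, 0) has its entries at (j, -i) and (i, -j). *)
Definition far i j := [&& th_hb i, th_hb j, i != j & i != th_opp j].

Lemma far_sym i j : far i j = far j i.
Proof.
rewrite /far [j == i]eq_sym -(th_opp_eqC i) [th_opp i == _]eq_sym.
by case: (th_hb i); case: (th_hb j).
Qed.

Lemma far_oppl i j : far (th_opp i) j = far i j.
Proof.
by rewrite /far th_hb_opp th_opp_eqC eq_th_opp; case: (i == j); case: (i == _).
Qed.

Lemma far_oppr i j : far i (th_opp j) = far i j.
Proof. by rewrite far_sym far_oppl far_sym. Qed.

Lemma far_hbl i j : far i j -> th_hb i. Proof. by case/and4P. Qed.
Lemma far_hbr i j : far i j -> th_hb j. Proof. by case/and4P. Qed.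

Lemma far_neq i j : far i j -> [/\ (i == j) = false, (j == i) = false,
  (i == th_opp j) = false & (j == th_opp i) = false].
Proof.
move=> f; split; apply/negbTE; first by case/and4P: f.
- by move: f; rewrite far_sym => /and4P[].
- by case/and4P: f.
- by move: f; rewrite far_sym => /and4P[].
Qed.

Lemma hb_cases i j : th_hb i -> th_hb j -> [\/ i = j, i = th_opp j | far i j].
Proof.
move=> hi hj; case: (eqVneq i j) => [->|ne]; first by constructor 1.
case: (eqVneq i (th_opp j)) => [->|ne']; first by constructor 2.
by constructor 3; rewrite /far hi hj ne ne'.
Qed.

(** Here n >= 3 matters: of three hyperbolic pairs, one avoids two given indices. *)
Lemma far_ex i j : (3 <= n)%N -> th_hb i -> th_hb j ->
  exists l, far l i /\ far l j.
Proof.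
move=> hn hi hj.
have lt3 a : (a < 3)%N -> (a < n.*2.+1)%N by lia.
have w a (ha : (a < 3)%N) k : th_hb k -> nat_of_ord k <> a ->
    nat_of_ord k <> (n.*2 - a)%N -> far (Ordinal (lt3 a ha)) k.
  move=> hk n1 n2; have := ltn_ord k; rewrite /far hk andTb /th_hb -!val_eqE /=.
  by move=> lk; apply/and3P; split; apply/eqP => /=; lia.
have ci a : {nat_of_ord i = a \/ nat_of_ord i = (n.*2 - a)%N} +
            {nat_of_ord i <> a /\ nat_of_ord i <> (n.*2 - a)%N}.
  case: (eqVneq (nat_of_ord i) a) => [->|/eqP ?]; first by left; left.
  by case: (eqVneq (nat_of_ord i) (n.*2 - a)%N) => [->|/eqP ?]; [left; right|right].
have cj a : {nat_of_ord j = a \/ nat_of_ord j = (n.*2 - a)%N} +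
            {nat_of_ord j <> a /\ nat_of_ord j <> (n.*2 - a)%N}.
  case: (eqVneq (nat_of_ord j) a) => [->|/eqP ?]; first by left; left.
  by case: (eqVneq (nat_of_ord j) (n.*2 - a)%N) => [->|/eqP ?]; [left; right|right].
have ok a (ha : (a < 3)%N) : nat_of_ord i <> a /\ nat_of_ord i <> (n.*2 - a)%N ->
   nat_of_ord j <> a /\ nat_of_ord j <> (n.*2 - a)%N ->
   exists l, far l i /\ far l j.
  by move=> [? ?] [? ?]; exists (Ordinal (lt3 a ha)); split; apply: w.
case: (ci 0%N) => [i0|i0]; case: (cj 0%N) => [j0|j0]; last exact: (ok 0%N).
- by apply: (ok 1%N) => //; lia.
- case: (cj 1%N) => [j1|j1]; [apply: (ok 2%N)|apply: (ok 1%N)] => //; lia.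
- case: (ci 1%N) => [j1|j1]; [apply: (ok 2%N)|apply: (ok 1%N)] => //; lia.
Qed.

End Indices.

Section CommHerm.
Variables (R : comNzRingType) (h : hermRing R).
Notation "x ^!" := (bar h x) (at level 1, format "x ^!").
Notation lam := (lam h).
Notation mu := (mu h).

Lemma lamV : lam * lam^! = 1. Proof. exact: lam_bar. Qed.

Lemma barK x : x^!^! = x.
Proof. by rewrite bar_bar mulrAC lamV mul1r. Qed.

Lemma mubar : mu^! = mu * lam^!.
Proof. by rewrite {2}mu_bar -mulrA lamV mulr1. Qed.

Lemma bar_sum (I : Type) (r : seq I) (P : pred I) (E : I -> R) :
  (\sum_(i <- r | P i) E i)^! = \sum_(i <- r | P i) (E i)^!.
Proof. by apply: (big_morph (bar h)); [apply: barD|apply: bar0]. Qed.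

Lemma barB x y : (x - y)^! = x^! - y^!.
Proof. by rewrite barD barN. Qed.

Lemma barX x m : (x ^+ m)^! = x^! ^+ m.
Proof. by elim: m => [|m IH]; rewrite ?expr0 ?bar1 // !exprS barM IH mulrC. Qed.

Definition barE := (barD, barM, barN, bar0, bar1, barX, barK, mubar).
End CommHerm.

Section Form.
Variables (R : comNzRingType) (h : hermRing R) (n : nat).
Notation "x ^!" := (bar h x) (at level 1, format "x ^!").
Notation lam := (lam h).
Notation mu := (mu h).
Notation vec := 'cV[R]_(n.*2.+1).
Notation idx := 'I_(n.*2.+1).
Notation o := (th_zero n).
Implicit Types (u v w f p q : vec) (i j k l : idx) (a x y z : R).

(** The sesquilinear form behind q: the second component of q(u) is hyp_form u u. *)
Definition hyp_form u v : R := \sum_(i : idx | th_pos i) (u i 0)^! * v (th_opp i) 0.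

Fact form_key : unit. Proof. exact tt. Qed.

(** The form b, by form_bE, written through hyp_form so that its symmetry under the
involution is visible. It is locked: conversion must not unfold the sums. *)
Definition hform u v : R := locked_with form_key
  (hyp_form u v + (u o 0)^! * mu * v o 0 + lam * (hyp_form v u)^!).

(** The form in the coefficient of u in a transvection: conj(b(w,v)) = b(v,w) lam^-1. *)
Definition hform_op v w : R := locked_with form_key ((hform w v)^!).

Lemma formU u v : hform u v = hyp_form u v + (u o 0)^! * mu * v o 0 + lam * (hyp_form v u)^!.
Proof. by rewrite /hform unlock. Qed.

Lemma lformU v w : hform_op v w = (hform w v)^!.
Proof. by rewrite /hform_op unlock. Qed.

Lemma qpolDl u u' v : hyp_form (u + u') v = hyp_form u v + hyp_form u' v.
Proof. by rewrite -big_split; apply: eq_bigr => i _; rewrite mxE !barE mulrDl. Qed.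
Lemma qpolDr u v v' : hyp_form u (v + v') = hyp_form u v + hyp_form u v'.
Proof. by rewrite -big_split; apply: eq_bigr => i _; rewrite mxE mulrDr. Qed.
Lemma qpolZl a u v : hyp_form (a *: u) v = a^! * hyp_form u v.
Proof. by rewrite big_distrr; apply: eq_bigr => i _; rewrite mxE !barE /=; ring. Qed.
Lemma qpolZr a u v : hyp_form u (a *: v) = a * hyp_form u v.
Proof. by rewrite big_distrr; apply: eq_bigr => i _; rewrite mxE /=; ring. Qed.

Lemma formDl u u' v : hform (u + u') v = hform u v + hform u' v.
Proof. by rewrite !formU !(qpolDl, qpolDr) !mxE !barE; ring. Qed.
Lemma formDr u v v' : hform u (v + v') = hform u v + hform u v'.
Proof. by rewrite !formU !(qpolDl, qpolDr) !mxE !barE; ring. Qed.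
Lemma formZl a u v : hform (a *: u) v = a^! * hform u v.
Proof. by rewrite !formU !(qpolZl, qpolZr) !mxE !barE; ring. Qed.
Lemma formZr a u v : hform u (a *: v) = a * hform u v.
Proof. by rewrite !formU !(qpolZl, qpolZr) !mxE !barE; ring. Qed.
Lemma formNl u v : hform (- u) v = - hform u v.
Proof. by rewrite -scaleN1r formZl !barE mulN1r. Qed.
Lemma formNr u v : hform u (- v) = - hform u v.
Proof. by rewrite -scaleN1r formZr mulN1r. Qed.
Lemma form0l v : hform 0 v = 0.
Proof. by rewrite -(scale0r 0) formZl !barE mul0r. Qed.
Lemma form0r u : hform u 0 = 0.
Proof. by rewrite -(scale0r 0) formZr mul0r. Qed.
Definition formE := (formDl, formDr, formZl, formZr, formNl, formNr, form0l, form0r).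

Lemma form_bar u v : (hform u v)^! = hform v u * lam^!.
Proof. by rewrite !formU !barE; ring : (lamV h). Qed.

Lemma form_swap u v : hform v u = lam * (hform u v)^!.
Proof. by rewrite form_bar; ring : (lamV h). Qed.

Lemma form0_sym u v : hform u v = 0 -> hform v u = 0.
Proof. by move=> uv; rewrite form_swap uv bar0 mulr0. Qed.

Lemma lformE u v : hform_op u v = hform u v * lam^!.
Proof. by rewrite lformU form_bar. Qed.

(** The only nonzero entries of the Gram matrix: b(e_i, e_-i). *)
Definition gram i : R := if th_pos i then 1 else if th_neg i then lam else mu.

Lemma form_sum u v : hform u v = \sum_i (u i 0)^! * gram i * v (th_opp i) 0.
Proof.
rewrite (bigID (@th_pos n)) /= formU -addrA; congr (_ + _).
  by apply: eq_bigr => i p; rewrite /gram p mulr1.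
rewrite (bigD1 o) /=; last by rewrite /th_pos ltnn.
rewrite th_opp_zero /gram /th_pos /th_neg ltnn; congr (_ + _).
rewrite bar_sum big_distrr /= (reindex_inj (@rev_ord_inj _)) /=.
apply: eq_big => i; rewrite -!/(th_opp i) -/(th_pos _) th_pos_opp.
  rewrite -/(th_pos i); case: (boolP (i == o)) => [/eqP->|ho].
    by rewrite /th_pos /th_neg ltnn.
  by rewrite th_negE //= andbT.
move=> ni; move: (ni); rewrite th_negE; last by rewrite th_hbE ni orbT.
rewrite -/(th_pos i) -/(th_neg i) => /negbTE->; rewrite ni th_oppK !barE; ring.
Qed.

End Form.

Section FormB.
Variables (R : comNzRingType) (F : hermFormRing R) (n : nat).
Lemma form_bE (u v : 'cV[R]_(n.*2.+1)) : form_b F u v = hform F u v.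
Proof.
rewrite /form_b formU; congr (_ + _ + _).
rewrite bar_sum big_distrr /= (reindex_inj (@rev_ord_inj _)) /=.
apply: eq_big => i; rewrite -!/(th_opp i) ?th_neg_opp // => _.
by rewrite th_oppK !barE; ring.
Qed.
End FormB.

(** * Transvections *)

Section Transvections.
Variables (R : comNzRingType) (h : hermRing R) (n : nat).
Notation "x ^!" := (bar h x) (at level 1, format "x ^!").
Notation lam := (lam h).
Notation mu := (mu h).
Notation vec := 'cV[R]_(n.*2.+1).
Notation mat := 'M[R]_(n.*2.+1).
Notation idx := 'I_(n.*2.+1).
Notation o := (th_zero n).
Notation form := (hform h).
Notation lform := (hform_op h).
Notation cc := (gram h).
Implicit Types (u v w f p q : vec) (i j k l : idx) (a x y z : R) (g : mat).

Definition bvec i : vec := delta_mx i 0.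

Lemma evE i k m : bvec i k m = (k == i)%:R.
Proof. by rewrite !mxE ord1 eqxx andbT. Qed.

Lemma form_el i w : form (bvec i) w = cc i * w (th_opp i) 0.
Proof.
rewrite form_sum (bigD1 i) //= evE eqxx bar1 mul1r big1 ?addr0 // => k ne.
by rewrite evE (negbTE ne) bar0 !mul0r.
Qed.

Lemma form_er u j : form u (bvec j) = (u (th_opp j) 0)^! * cc (th_opp j).
Proof.
rewrite form_sum (bigD1 (th_opp j)) //= evE th_oppK eqxx mulr1 big1 ?addr0 // => k ne.
by rewrite evE th_opp_eqC (negbTE ne) !mulr0.
Qed.

Lemma form_vec u w : form u w = \sum_j form u (bvec j) * w j 0.
Proof.
rewrite form_sum (reindex_inj (@rev_ord_inj _)) /=; apply: eq_bigr => i _.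
by rewrite form_er -!/(th_opp i) th_oppK.
Qed.

Lemma ccV i : th_hb i -> cc i * (cc i)^! = 1.
Proof.
rewrite th_hbE /gram => /orP[->|ni]; first by rewrite bar1 mulr1.
by case: ifP => _; rewrite ?ni ?bar1 ?mulr1 ?lamV.
Qed.

Lemma cc_opp i : th_hb i -> cc (th_opp i) = lam * (cc i)^!.
Proof.
move=> hi; rewrite /gram th_pos_opp th_neg_opp th_negE //.
by case: (th_pos i) => /=; rewrite ?bar1 ?mulr1 ?lamV.
Qed.

Lemma cc_zero : cc o = mu. Proof. by rewrite /gram /th_pos /th_neg ltnn. Qed.

Lemma lformDl v v' w : lform (v + v') w = lform v w + lform v' w.
Proof. by rewrite !lformU formE barE. Qed.
Lemma lformDr v w w' : lform v (w + w') = lform v w + lform v w'.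
Proof. by rewrite !lformU formE barE. Qed.
Lemma lformZl a v w : lform (a *: v) w = a^! * lform v w.
Proof. by rewrite !lformU formE !barE; ring. Qed.
Lemma lformZr a v w : lform v (a *: w) = a * lform v w.
Proof. by rewrite !lformU formE !barE; ring. Qed.
Lemma lformNl v w : lform (- v) w = - lform v w.
Proof. by rewrite !lformU formE !barE; ring. Qed.
Lemma lformNr v w : lform v (- w) = - lform v w.
Proof. by rewrite !lformU formE !barE; ring. Qed.
Lemma lform0l w : lform 0 w = 0.
Proof. by rewrite !lformU formE barE. Qed.
Lemma lform0r v : lform v 0 = 0.
Proof. by rewrite !lformU formE barE. Qed.
Definition lfE :=
  (lformDl, lformDr, lformZl, lformZr, lformNl, lformNr, lform0l, lform0r).

Lemma lform0 u v : form u v = 0 -> lform u v = 0.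
Proof. by rewrite lformE => ->; rewrite mul0r. Qed.

Lemma mx_ext (M N : mat) : (forall w, M *m w = N *m w) -> M = N.
Proof.
by move=> MN; apply/matrixP => i j; move/colP/(_ i): (MN (bvec j)); rewrite -!colE !mxE.
Qed.

(** The Eichler-Siegel-Dickson transvection, see TvE. It is an isometry when u is singular,
b(u,v) = 0 and y is a half of - b(v,v) in the sense of the hypothesis of Tv_iso. *)
Definition transv u v y : mat :=
  \matrix_(i, j) ((i == j)%:R + form u (bvec j) * v i 0 - lform v (bvec j) * u i 0
                  + y * form u (bvec j) * u i 0).

Lemma TvE u v y w :
  transv u v y *m w = w + form u w *: v - lform v w *: u + (y * form u w) *: u.
Proof.
apply/colP => i; rewrite !mxE.
have -> : lform v w = \sum_j lform v (bvec j) * w j 0.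
  rewrite lformE form_vec big_distrl; apply: eq_bigr => j _.
  by rewrite lformE /=; ring.
rewrite form_vec !big_distrl !big_distrr /= big_distrl /=.
rewrite -[w i 0]mul1r -sumrN.
have -> : 1 * w i 0 = \sum_j (i == j)%:R * w j 0.
  rewrite (bigD1 i) //= eqxx big1 ?addr0 // => j; rewrite eq_sym => /negbTE->.
  by rewrite mul0r.
rewrite -!big_split; apply: eq_bigr => j _; rewrite !mxE /=; ring.
Qed.

Lemma Tv_add u v y v' y' : form u u = 0 -> form u v = 0 -> form u v' = 0 ->
  transv u v y *m transv u v' y' = transv u (v + v') (y + y' - lform v v').
Proof.
move=> uu uv uv'; apply: mx_ext => w; rewrite -mulmxA !TvE !(formE, lfE).
rewrite uu uv' (lform0 (form0_sym uv)).
by apply/colP => i; rewrite !mxE; ring.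
Qed.

Lemma Tv0 u : transv u 0 0 = 1%:M.
Proof.
apply: mx_ext => w; rewrite TvE mul1mx lform0l mul0r !scale0r scaler0.
by rewrite !addr0 oppr0 addr0.
Qed.

Lemma Tv_inv u v y : form u u = 0 -> form u v = 0 ->
  transv u v y *m transv u (- v) (- y - lform v v) = 1%:M.
Proof.
move=> uu uv; rewrite Tv_add // ?formE ?uv ?oppr0 // subrr -(Tv0 u).
by congr (transv u 0 _); rewrite lfE; ring.
Qed.

Lemma Tv_invr u v y : form u u = 0 -> form u v = 0 ->
  transv u (- v) (- y - lform v v) *m transv u v y = 1%:M.
Proof.
move=> uu uv; rewrite Tv_add // ?formE ?uv ?oppr0 // addNr -(Tv0 u).
by congr (transv u 0 _); rewrite lfE; ring.
Qed.

Lemma Tv_iso u v y w w' : form u u = 0 -> form u v = 0 ->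
  form v v + y^! + y * lam = 0 ->
  form (transv u v y *m w) (transv u v y *m w') = form w w'.
Proof.
move=> uu uv vv; rewrite !TvE !formE uu uv (form0_sym uv) !barE.
rewrite (form_swap h v w) (form_swap h u w) !lformE !barE.
have -> : form v v = - y^! - y * lam by rewrite -[RHS]add0r -vv; ring.
by ring : (lamV h).
Qed.

Lemma Tv_conj g g' u v y : g *m g' = 1%:M ->
  (forall w w', form (g *m w) (g *m w') = form w w') ->
  g *m transv u v y *m g' = transv (g *m u) (g *m v) y.
Proof.
move=> gg' giso; apply: mx_ext => w.
have -> : w = g *m (g' *m w) by rewrite mulmxA gg' mul1mx.
set w' := g' *m w; rewrite -mulmxA [g' *m _]mulmxA.
have -> : g' *m g = 1%:M by apply: mulmx1C.
rewrite mul1mx -mulmxA !TvE !lformU !giso !(mulmxDr, mulmxN) -!scalemxAr.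
by [].
Qed.

Lemma Tv_scale a u v y : transv (a *: u) v y = transv u (a^! *: v) (y * a * a^!).
Proof.
apply: mx_ext => w; rewrite !TvE !(formE, lfE) !barE.
by apply/colP => i; rewrite !mxE; ring.
Qed.

(** For y = 0 the two vectors play symmetric roles. This turns a statement on
T(f; e_j, 0) into one on T(e_j; f, 0). *)
Lemma Tv_swap u v : transv u v 0 = transv v (- lam^! *: u) 0.
Proof.
apply: mx_ext => w; rewrite !TvE !(formE, lfE) !lformE !barE.
by apply/colP => i; rewrite !mxE; ring : (lamV h).
Qed.

(** Additivity in the first argument holds up to a transvection of the plane of the two
singular vectors; it is the source of every reduction below. *)
Lemma Tv_split p q v y : form p p = 0 -> form q q = 0 -> form p q = 0 ->
  form p v = 0 -> form q v = 0 -> form v v + y^! + y * lam = 0 ->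
  transv (p + q) v y = transv q v y *m transv p v y *m transv q (y *: p) 0.
Proof.
move=> pp qq pq pv qv vv; apply: mx_ext => w; rewrite -!mulmxA !TvE !(formE, lfE).
rewrite pp qq pq (form0_sym pq) ?pv ?qv (lform0 (form0_sym pv)) (lform0 (form0_sym qv)).
rewrite !lformE; have -> : form v v = - y^! - y * lam by rewrite -[RHS]add0r -vv; ring.
by apply/colP => i; rewrite !mxE; ring : (lamV h).
Qed.

End Transvections.

(** * Frames and points *)

(** A form parameter fD over a subring fA of scalars, in coordinates: fD x y stands for
(x, y) in the form parameter. The last two axioms say that the second components and the
products conj(x) mu x' are scalars, which is automatic only when all elements are. *)
Record frame (R : comNzRingType) (h : hermRing R) := Frame {
  fA : R -> Prop;
  fD : R -> R -> Prop;
  fA1 : fA 1;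
  fAB : forall x y, fA x -> fA y -> fA (x - y);
  fAM : forall x y, fA x -> fA y -> fA (x * y);
  fAbar : forall x, fA x -> fA (bar h x);
  fAlam : fA (lam h);
  fDD : forall x y x' y', fD x y -> fD x' y' ->
    fD (x + x') (y + y' - bar h x * mu h * x');
  fDN : forall x y, fD x y -> fD (- x) (- y - bar h x * mu h * x);
  fDZ : forall a x y, fA a -> fD x y -> fD (x * a) (bar h a * y * a);
  fDmin : forall x, fA x -> fD 0 (x - bar h x * lam h);
  fDtr : forall x y, fD x y -> bar h x * mu h * x + y + bar h y * lam h = 0;
  fDA : forall x y, fD x y -> fA y;
  fDJ : forall x y x' y', fD x y -> fD x' y' -> fA (bar h x * mu h * x') }.

Section Frame.
Variables (R : comNzRingType) (h : hermRing R) (S : frame h) (n : nat).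
Notation "x ^!" := (bar h x) (at level 1, format "x ^!").
Notation lam := (lam h).
Notation A := (fA S).
Notation D := (fD S).
Notation vec := 'cV[R]_(n.*2.+1).
Notation mat := 'M[R]_(n.*2.+1).
Notation idx := 'I_(n.*2.+1).
Notation o := (th_zero n).
Notation form := (hform h).
Notation lform := (hform_op h).
Notation qpol := (hyp_form h).
Notation cc := (gram h).
Notation ev := (@bvec R n).
Implicit Types (u v w f p q : vec) (i j k l : idx) (a x y z : R) (g : mat).

Lemma fA0 : A 0. Proof. by rewrite -(subrr 1); apply: fAB; apply: fA1. Qed.
Lemma fAN x : A x -> A (- x).
Proof. by move=> ax; rewrite -sub0r; apply: fAB => //; apply: fA0. Qed.
Lemma fAD x y : A x -> A y -> A (x + y).
Proof. by move=> ax ay; rewrite -[y]opprK; apply: fAB => //; apply: fAN. Qed.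
Lemma fA_sum (I : Type) (r : seq I) (Q : pred I) (E : I -> R) :
  (forall t, Q t -> A (E t)) -> A (\sum_(t <- r | Q t) E t).
Proof. by move=> AE; apply: (big_ind A) => //; [apply: fA0|apply: fAD]. Qed.
Lemma fAX x m : A x -> A (x ^+ m).
Proof.
by move=> ax; elim: m => [|m IH]; rewrite ?expr0 ?exprS; [apply: fA1|apply: fAM].
Qed.
Lemma fA_cc i : th_hb i -> A (cc i).
Proof.
rewrite th_hbE /gram => /orP[->|ni]; first exact: fA1.
by case: ifP => _; [apply: fA1|rewrite ni; apply: fAlam].
Qed.

Lemma fD_eq x y x' y' : D x y -> x = x' -> y = y' -> D x' y'.
Proof. by move=> d <- <-. Qed.

Lemma fD0 : D 0 0.
Proof. by apply: (fD_eq (fDmin fA0)); rewrite ?barE; ring. Qed.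

Lemma fD_min_add x y z : D x y -> A z -> D x (y + (z - z^! * lam)).
Proof.
by move=> d az; apply: (fD_eq (fDD d (fDmin az))); ring.
Qed.

Definition hbA v := forall k, th_hb k -> A (v k 0).
Definition nvec v := hbA v /\ exists y, D (v o 0) y.
(** Points of the quadratic module: y measures how far q(v) is from the form parameter.
They are the parameters of transvections, and an element g of the unitary group acts on
them by (v, y) |-> (g v, y). *)
Definition qpoint v y := hbA v /\ D (v o 0) (qpol v v + y^!).

Lemma point_nvec v y : qpoint v y -> nvec v.
Proof. by case=> hv d; split=> //; exists (qpol v v + y^!). Qed.

Lemma fA_qpol u v : hbA u -> hbA v -> A (qpol u v).
Proof.
move=> hu hv; apply: fA_sum => i pi; apply: fAM; first apply: fAbar.
  by apply: hu; rewrite th_hbE pi.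
by apply: hv; rewrite th_hb_opp th_hbE pi.
Qed.

Lemma fA_form u v : nvec u -> nvec v -> A (form u v).
Proof.
move=> [hu [y du]] [hv [y' dv]]; rewrite formU; do !apply: fAD.
- exact: fA_qpol.
- exact: fDJ du dv.
- by apply: fAM; [apply: fAlam|apply: fAbar; apply: fA_qpol].
Qed.

Lemma point_A v y : qpoint v y -> A y.
Proof.
move=> [hv d]; rewrite -(barK h y); apply: fAbar.
by rewrite -[y^!](addKr (qpol v v)); apply: fAD; [apply: fAN; apply: fA_qpol|apply: fDA d].
Qed.

Lemma point_tr v y : qpoint v y -> form v v + y^! + y * lam = 0.
Proof. by move=> [_ d]; rewrite -(fDtr d) formU !barE; ring. Qed.

Lemma point_sing v : qpoint v 0 -> form v v = 0.
Proof. by move/point_tr; rewrite !barE mul0r !addr0. Qed.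

Lemma pointD v y v' y' : qpoint v y -> qpoint v' y' ->
  qpoint (v + v') (y + y' - lform v v').
Proof.
move=> [hv d] [hv' d']; split=> [k hk|]; first by rewrite mxE; apply: fAD; auto.
have z := fD_min_add (fDD d' d) (fA_qpol hv hv').
apply: (fD_eq z); rewrite ?mxE ?(addrC (v o 0)) //.
by rewrite !(qpolDl, qpolDr) lformU !barE formU; ring.
Qed.

Lemma pointZ a v y : A a -> qpoint v y -> qpoint (a *: v) (y * (a * a^!)).
Proof.
move=> ha [hv d]; split=> [k hk|]; first by rewrite mxE; apply: fAM; auto.
apply: (fD_eq (fDZ ha d)); [by rewrite mxE mulrC|].
by rewrite !(qpolZl, qpolZr) !barE; ring.
Qed.

Lemma pointN v y : qpoint v y -> qpoint (- v) y.
Proof.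
move=> vy; have := pointZ (fAN (fA1 S)) vy.
by rewrite scaleN1r !barE; congr qpoint; ring.
Qed.

Lemma point_inv v y : qpoint v y -> qpoint (- v) (- y - lform v v).
Proof.
move=> vy; have := pointN vy; rewrite /qpoint => -[hv d]; split=> //.
have t := point_tr vy; have ay : A (y^!) by apply: fAbar (point_A vy).
apply: (fD_eq (fD_min_add d (fAN ay))) => //.
rewrite lformU !barE.
have -> : form v v = - y^! - y * lam by rewrite -[RHS]add0r -t; ring.
ring.
Qed.

Lemma point0 : qpoint 0 0.
Proof.
split=> [k _|]; first by rewrite mxE; apply: fA0.
apply: (fD_eq fD0); rewrite ?mxE //.
by rewrite /hyp_form big1 ?barE ?addr0 // => i _; rewrite mxE barE mul0r.
Qed.

Lemma point_eq v y v' y' : qpoint v y -> v = v' -> y = y' -> qpoint v' y'.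
Proof. by move=> d <- <-. Qed.

Lemma point_min x v y : A x -> qpoint v y -> qpoint v (y + (x - x^! * lam^!)).
Proof.
move=> ax [hv d]; split=> //; apply: (fD_eq (fD_min_add d (fAbar ax))) => //.
by rewrite !barE; ring.
Qed.

Lemma qpol_ev j x : th_hb j -> qpol (x *: ev j) (x *: ev j) = 0.
Proof.
move=> hj; apply: big1 => i pi; rewrite !mxE eqxx !andbT.
case: (eqVneq i j) => [ei|]; last by rewrite mulr0 bar0 mul0r.
by rewrite ei eq_sym th_hb_neq // !mulr0.
Qed.

Lemma qpol_e0 x v : qpol (x *: ev o) v = 0.
Proof.
apply: big1 => i pi; rewrite !mxE eqxx andbT.
case: (eqVneq i o) pi => [->|_ _]; first by rewrite /th_pos ltnn.
by rewrite mulr0 bar0 mul0r.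
Qed.

Lemma point_ev j x : th_hb j -> A x -> qpoint (x *: ev j) 0.
Proof.
move=> hj ax; split=> [k _|].
  by rewrite !mxE; case: (_ == _); rewrite ?mulr0 ?mulr1 //; apply: fA0.
apply: (fD_eq fD0); rewrite ?qpol_ev ?barE ?addr0 // !mxE eq_sym.
by rewrite (negbTE hj) mulr0.
Qed.

Lemma point_e0 x y : D x y^! -> qpoint (x *: ev o) y.
Proof.
move=> d; split=> [k hk|].
  by rewrite !mxE (negbTE hk) mulr0; apply: fA0.
by apply: (fD_eq d); rewrite ?qpol_e0 ?add0r // !mxE !eqxx mulr1.
Qed.

Lemma nvecZ a u : A a -> nvec u -> nvec (a *: u).
Proof.
move=> aa [hu [y d]]; split=> [k hk|]; first by rewrite mxE; apply: fAM; auto.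
by rewrite mxE mulrC; exists (a^! * y * a); apply: fDZ.
Qed.

Lemma nvec_ev j : th_hb j -> nvec (ev j).
Proof. by move=> hj; rewrite -[ev j]scale1r; apply: (@point_nvec _ 0); apply: point_ev => //; apply: fA1. Qed.

(** Every point is a sum, for the addition under which T(e_i; -, -) is multiplicative
(pointD, Tv_add), of points carried by one coordinate; coordinates in ex are to be avoided. *)
Lemma point_ind (K : vec -> R -> Prop) (ex : pred idx) :
  (forall v y v' y', K v y -> K v' y' -> K (v + v') (y + y' - lform v v')) ->
  (forall j x, th_hb j -> ~~ ex j -> A x -> K (x *: ev j) 0) ->
  (forall x y, D x y^! -> K (x *: ev o) y) ->
  forall v y, qpoint v y -> (forall j, th_hb j -> ex j -> v j 0 = 0) -> K v y.
Proof.
move=> Kadd Kev Ke0.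
suff H (s : seq idx) : forall v y, qpoint v y ->
    (forall j, th_hb j -> ex j -> v j 0 = 0) ->
    (forall j, th_hb j -> j \notin s -> v j 0 = 0) -> K v y.
  by move=> v y vy vex; apply: (H (enum idx)) => // j _; rewrite mem_enum.
elim: s => [|k s IH] v y vy vex vs.
  have ev0 : v = v o 0 *: ev o.
    apply/colP => j; rewrite !mxE; case: (boolP (th_hb j)) => hj.
      by rewrite vs // (negbTE hj) mulr0.
    by rewrite /th_hb negbK in hj; rewrite hj (eqP hj) mulr1.
  rewrite ev0; apply: Ke0; case: vy => _ d; apply: (fD_eq d) => //.
  by rewrite {1}ev0 qpol_e0 add0r.
case: (boolP (th_hb k && ~~ ex k)) => [/andP[hk nk]|nk]; last first.
  apply: IH => // j hj js; case: (eqVneq j k) => [ejk|ne].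
    by subst j; rewrite hj /= negbK in nk; apply: vex.
  by apply: vs => //; rewrite inE negb_or ne.
pose x := v k 0; pose v' := v - x *: ev k.
have ax : A x by case: vy => hv _; apply: hv.
have vk : qpoint (- (x *: ev k)) 0 by apply: pointN; apply: point_ev.
have := pointD vy vk; rewrite -/v' addr0 lfE opprK => v'y.
have fk : form (ev k) (ev k) = 0.
  by rewrite form_el evE th_opp_eqC th_hb_neq // mulr0.
have -> : v = v' + x *: ev k by rewrite subrK.
have -> : y = (y + lform v (x *: ev k)) + 0 - lform v' (x *: ev k).
  rewrite /v' !lfE (lform0 fk) !mulr0; ring.
apply: Kadd; last exact: Kev.
apply: IH => // j hj.
  move=> xj; rewrite /v' !mxE vex //; case: (eqVneq j k) nk => [<-|_ _].
    by rewrite xj.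
  by rewrite mulr0 subr0.
rewrite /v' !mxE; case: (eqVneq j k) => [->|ne js].
  by rewrite mulr1 subrr.
by rewrite mulr0 subr0; apply: vs => //; rewrite inE negb_or ne.
Qed.

End Frame.

(** * Elementary transvections *)

Section Elementary.
Variables (R : comNzRingType) (h : hermRing R) (S : frame h) (n : nat).

Notation "x ^!" := (bar h x) (at level 1, format "x ^!").
Notation lam := (lam h).
Notation mu := (mu h).
Notation A := (fA S).
Notation D := (fD S).
Notation vec := 'cV[R]_(n.*2.+1).
Notation mat := 'M[R]_(n.*2.+1).
Notation idx := 'I_(n.*2.+1).
Notation o := (th_zero n).
Notation form := (hform h).
Notation lform := (hform_op h).
Notation qpol := (hyp_form h).
Notation cc := (gram h).
Notation ev := (@bvec R n).
Notation Tv := (@transv R h n).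
Notation point := (qpoint S).
Implicit Types (u v w f p q : vec) (i j k l m : idx) (a x y z : R) (g : mat).

Lemma form_evev i j : (j == th_opp i) = false -> form (ev i) (ev j) = 0.
Proof. by rewrite form_el evE th_opp_eqC eq_sym th_opp_eqC eq_sym => ->; rewrite mulr0. Qed.

Lemma form_evev0 i : th_hb i -> form (ev i) (ev i) = 0.
Proof. by move=> hi; rewrite form_evev // th_hb_neq. Qed.

Lemma form_evopp i : form (ev i) (ev (th_opp i)) = cc i.
Proof. by rewrite form_el evE eqxx mulr1. Qed.

Lemma form_far i j : far i j -> form (ev i) (ev j) = 0.
Proof. by case/far_neq=> _ _ _ e; apply: form_evev. Qed.

Lemma form_ev_e0 i : th_hb i -> form (ev i) (ev o) = 0.
Proof.
by move=> hi; rewrite form_el evE th_opp_eqC th_opp_zero (negbTE hi) mulr0.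
Qed.

Lemma form_e0_ev i : th_hb i -> form (ev o) (ev i) = 0.
Proof. by move=> hi; apply: form0_sym; apply: form_ev_e0. Qed.

(** With z the displacement of w, q(w + z) and q(w) differ by q(z) and a term of the
form x - conj(x) lam; both are controlled because z is a sum of multiples of the points
(v, y) and (e, 0). *)
Lemma Tv_q e v y w : point e 0 -> point v y -> form e v = 0 ->
  hbA S w -> A (form e w) -> A (form v w) ->
  hbA S (Tv e v y *m w) /\
  D ((Tv e v y *m w) o 0 - w o 0)
    (qpol (Tv e v y *m w) (Tv e v y *m w) - qpol w w
     + (((Tv e v y *m w) o 0)^! - (w o 0)^!) * mu * w o 0).
Proof.
move=> se vy ev hw ae av.
set a := form e w in ae *; pose t := y * a - lform v w.
have at_ : A t.
  apply: fAB; first by apply: fAM => //; apply: point_A vy.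
  by rewrite lformE; apply: fAM => //; apply: fAbar; apply: fAlam.
have [z ez] : exists z : vec, z = a *: v + t *: e by eexists.
have -> : Tv e v y *m w = w + z.
  by rewrite TvE ez /t -/a; apply/colP => i; rewrite !mxE; ring.
have vz : point z (y * (a * a^!)).
  apply: (point_eq (pointD (pointZ ae vy) (pointZ at_ se))); first by rewrite ez.
  by rewrite !lfE (lform0 (form0_sym ev)); ring.
have [hz d] := vz; split=> [k hk|]; first by rewrite mxE; apply: fAD; auto.
have d1 := fD_min_add d (fA_qpol hw hz).
have d2 := fD_min_add d1 (fAM (fAbar ae) av).
have wz : (w + z) o 0 = w o 0 + z o 0 by rewrite [LHS]mxE.
apply: (fD_eq d2); first by rewrite wz; ring.
rewrite wz.
have fz : form z w = a^! * form v w + t^! * a by rewrite ez !formE.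
have -> : qpol (w + z) (w + z) = qpol w w + qpol z z + qpol w z
            + (form z w - (z o 0)^! * mu * w o 0 - lam * (qpol w z)^!).
  by rewrite !(qpolDl, qpolDr) formU; ring.
rewrite fz /t lformU !barE (form_swap h v w); ring : (lamV h).
Qed.

Lemma Tv_point e v y w z : point e 0 -> point v y -> form e v = 0 ->
  point w z -> point (Tv e v y *m w) z.
Proof.
move=> se vy ev vw.
have [hT d] := Tv_q se vy ev vw.1 (fA_form (point_nvec se) (point_nvec vw))
   (fA_form (point_nvec vy) (point_nvec vw)).
split=> //; apply: (fD_eq (fDD d vw.2)); first by rewrite subrK.
by rewrite !barE; ring.
Qed.

Lemma Tv_nvec e v y w : point e 0 -> point v y -> form e v = 0 ->
  nvec S w -> nvec S (Tv e v y *m w).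
Proof.
move=> se vy ev nw.
have [hT d] := Tv_q se vy ev nw.1 (fA_form (point_nvec se) nw)
   (fA_form (point_nvec vy) nw).
split=> //; case: nw => _ [t dt].
by eexists; apply: (fD_eq (fDD d dt)); [rewrite subrK|reflexivity].
Qed.

(** The properties of elementary matrices on which the two main facts depend; inverses of
generators are again generators. *)
Record elem_closed (P : mat -> Prop) := ClosedP {
  P_one : P 1%:M;
  P_mul : forall g g', P g -> P g' -> P (g *m g');
  P_gen_far : forall i j x, far i j -> A x -> P (Tv (ev i) (x *: ev j) 0);
  P_gen_e0 : forall i x y, th_hb i -> D x y^! -> P (Tv (ev i) (x *: ev o) y) }.

Variables (P : mat -> Prop) (cP : elem_closed P).

Lemma Tv_self u x : Tv u (x *: u) 0 = Tv u 0 (x - x^! * lam^!).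
Proof.
apply: mx_ext => w; rewrite !TvE !lfE !lformE.
by apply/colP => i; rewrite !mxE; ring.
Qed.

(** The points v with v_-i = 0 are sums of points e_j x and e_0 x, for which T(e_i; -, -) is
a generator; the multiples of e_i itself contribute matrices T(e_i; 0, x - conj(x) lam^-1)
(Tv_self), which are among the T_i. *)
Lemma P_ev i v y : th_hb i -> point v y -> v (th_opp i) 0 = 0 -> P (Tv (ev i) v y).
Proof.
move=> hi vy vi.
pose K v y := form (ev i) v = 0 /\ P (Tv (ev i) v y).
suff [] : K v y by [].
have ii := form_evev0 hi.
apply: (@point_ind _ _ S _ K (pred1 (th_opp i))) vy _ => //.
- move=> {vi}v {}y v' y' [iv pv] [iv' pv']; split; first by rewrite formE iv iv' addr0.
  by rewrite -Tv_add //; apply: P_mul.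
- move=> j x hj /= ji ax; rewrite /K formE; case: (hb_cases hj hi) => [ji'|ji'|f].
  + subst j; rewrite ii mulr0; split=> //; rewrite Tv_self.
    rewrite -(scale0r (ev o)); apply: P_gen_e0 => //.
    by apply: (fD_eq (fDmin (fAbar ax))); rewrite ?barE //; ring.
  + by rewrite ji' eqxx in ji.
  + rewrite form_far 1?far_sym // mulr0; split=> //; apply: P_gen_far => //.
    by rewrite far_sym.
- move=> x {}y d; split; last exact: P_gen_e0.
  by rewrite formE form_ev_e0 // mulr0.
- by move=> j hj /= /eqP->.
Qed.

Lemma P_swap f j x : point f 0 -> th_hb j -> A x -> f (th_opp j) 0 = 0 ->
  P (Tv f (x *: ev j) 0).
Proof.
move=> sf hj ax fj; rewrite Tv_swap Tv_scale mul0r mul0r; apply: P_ev => //.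
  have al : A (x^! * (- lam^!)).
    by apply: fAM; [apply: fAbar|apply: fAN; apply: fAbar; apply: fAlam].
  by apply: (point_eq (pointZ al sf)); rewrite ?scalerA ?mul0r.
by rewrite !mxE fj !mulr0.
Qed.

Lemma point_peel v y j x : point v y -> th_hb j -> A x ->
  point (v - x *: ev j) (y + lform v (x *: ev j)).
Proof.
move=> vy hj ax; apply: (point_eq (pointD vy (pointN (point_ev hj ax)))) => //.
by rewrite lfE; ring.
Qed.

Lemma Tv_peel f v y j x : form f f = 0 -> form f v = 0 -> form f (ev j) = 0 ->
  th_hb j ->
  Tv f v y = Tv f (v - x *: ev j) (y + lform v (x *: ev j)) *m Tv f (x *: ev j) 0.
Proof.
move=> ff fv fj hj; rewrite Tv_add // ?formE ?fv ?fj; [|by ring|by ring].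
rewrite subrK; congr (Tv _ _ _).
by rewrite !lfE (lform0 (form_evev0 hj)); ring.
Qed.

(** After v has been made to avoid l and -l as well, the elementary matrix T(e_l; c f, 0), for
a suitable unit c, fixes v and takes e_-l to e_-l + f. So T(e_-l + f; v, y) is elementary,
and Tv_split gives T(f; v, y) from it. *)
Lemma P_avoid f l v y : point f 0 -> th_hb l -> f l 0 = 0 -> f (th_opp l) 0 = 0 ->
  point v y -> form f v = 0 -> P (Tv f v y).
Proof.
move=> sf hl fl fl' vy fv; have ff := point_sing sf.
have hl' : th_hb (th_opp l) by rewrite th_hb_opp.
have fel : form f (ev l) = 0 by rewrite form_er fl' barE mul0r.
have fel' : form f (ev (th_opp l)) = 0 by rewrite form_er th_oppK fl barE mul0r.
rewrite (Tv_peel y (v l 0) ff fv fel hl).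
apply: P_mul => //; last by apply: P_swap => //; apply: vy.1.
have vy1 := point_peel vy hl (vy.1 l hl).
set v1 := v - _ in vy1 *; set y1 := (y + _) in vy1 *.
have fv1 : form f v1 = 0 by rewrite !formE fv fel mulr0 subr0.
have v1l : v1 l 0 = 0 by rewrite /v1 !mxE !eqxx mulr1 subrr.
clearbody v1 y1.
rewrite (Tv_peel y1 (v1 (th_opp l) 0) ff fv1 fel' hl').
apply: P_mul => //; last by apply: P_swap; rewrite ?th_oppK //; apply: vy1.1.
have vy2 := point_peel vy1 hl' (vy1.1 _ hl').
set v2 := v1 - _ in vy2 *; set y2 := (y1 + _) in vy2 *.
have v2l' : v2 (th_opp l) 0 = 0 by rewrite /v2 !mxE !eqxx mulr1 subrr.
have v2l : v2 l 0 = 0 by rewrite /v2 !mxE (th_hb_neq hl) v1l mulr0 subr0.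
have fv2 : form f v2 = 0 by rewrite !formE fv1 fel' mulr0 subr0.
clearbody v2 y2; clear vy fv vy1 fv1 v1l v1 y1 v y.
move: v2 y2 vy2 v2l v2l' fv2 => v y vy vl vl' fv.
pose p := ev (th_opp l); pose c := (cc l)^!.
have lf : form (ev l) (c *: f) = 0 by rewrite formE form_el fl' !mulr0.
have ll := form_evev0 hl.
pose g := Tv (ev l) (c *: f) 0.
pose g' := Tv (ev l) (- (c *: f)) (- 0 - lform (c *: f) (c *: f)).
have vcf : point (c *: f) 0.
  by apply: (point_eq (pointZ (fAbar (fA_cc S hl)) sf)); rewrite ?mul0r.
have pg : P g by apply: P_ev => //; rewrite mxE fl' mulr0.
have pg' : P g' by apply: P_ev; [|apply: point_inv|rewrite !mxE fl' mulr0 oppr0].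
have pp : P (Tv (p + f) v y).
  have gp : g *m p = p + f.
    rewrite TvE form_evopp mul0r scale0r addr0 scalerA ccV // scale1r.
    by rewrite !lfE (lform0 fel') mulr0 scale0r subr0.
  have gv : g *m v = v.
    rewrite TvE form_el vl' !mulr0 !scale0r !lfE (lform0 fv).
    by rewrite mulr0 scale0r subr0 !addr0.
  rewrite -gp -[X in Tv _ X _]gv -(Tv_conj (g' := g')); first last.
  - by move=> w w'; apply: Tv_iso => //; apply: point_tr vcf.
  - exact: Tv_inv.
  by do ![apply: P_mul => //]; apply: P_ev => //; rewrite th_oppK.
have pv : form p v = 0 by rewrite form_el th_oppK vl mulr0.
have ep : form p p = 0 by apply: form_evev0.
have ay := point_A vy.
rewrite (Tv_split ep ff (form0_sym fel') pv fv (point_tr vy)) in pp.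
have i1 : Tv f (y *: p) 0 *m Tv f ((- y) *: p) 0 = 1%:M.
  rewrite Tv_add ?formE ?fel' ?mulr0 // -scalerDl subrr scale0r -(Tv0 h f).
  by congr (Tv _ _ _); rewrite !lfE (lform0 ep); ring.
have i2 := Tv_inv y ep pv.
have -> : Tv f v y = Tv f v y *m Tv p v y *m Tv f (y *: p) 0
    *m Tv f ((- y) *: p) 0 *m Tv p (- v) (- y - lform v v).
  by rewrite -(mulmxA (Tv f v y *m Tv p v y)) i1 mulmx1 -mulmxA i2 mulmx1.
apply: P_mul => //; last by apply: P_ev; [|apply: point_inv|rewrite mxE th_oppK vl oppr0].
by apply: P_mul => //; apply: P_swap; rewrite ?th_oppK //; apply: fAN.
Qed.
End Elementary.

(** * Scalars of elementary transvections *)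

Section Radical.
Variables (R : comNzRingType) (A I : R -> Prop).
Hypothesis IA : forall x, I x -> A x.
Hypothesis I0 : I 0.
Hypothesis ID : forall x y, I x -> I y -> I (x + y).
Hypothesis IM : forall a x, A a -> I x -> I (a * x).
Hypothesis AD : forall x y, A x -> A y -> A (x + y).
Hypothesis A1 : A 1.
Hypothesis AM : forall x y, A x -> A y -> A (x * y).

Definition rad (s : R) := A s /\ exists N, I (s ^+ N).

Lemma AX x m : A x -> A (x ^+ m).
Proof. by move=> ax; elim: m => [|m IH]; rewrite ?expr0 ?exprS //; apply: AM. Qed.

Lemma rad_in s : I s -> rad s.
Proof. by move=> i; split; [apply: IA|exists 1%N]. Qed.

Lemma radD s t : rad s -> rad t -> rad (s + t).
Proof.
move=> [a1 [N1 i1]] [a2 [N2 i2]]; split; first exact: AD.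
exists (N1 + N2)%N; rewrite exprDn; apply: (big_ind I) => // i _.
have In x m : I x -> I (x *+ m).
  by move=> ix; elim: m => [|m IH]; rewrite ?mulr0n ?mulrS //; apply: ID.
apply: In; case: (leqP N2 i) => hi.
  by rewrite -(subnKC hi) exprD mulrA mulrAC; apply: IM => //; apply: AM; apply: AX.
have hj : (N1 <= N1 + N2 - i)%N by lia.
rewrite -(subnKC hj) exprD -mulrA mulrC; apply: IM => //; apply: AM; exact: AX.
Qed.

Lemma radM a s : A a -> rad s -> rad (a * s).
Proof.
move=> aa [a1 [N i]]; split; first exact: AM.
by exists N; rewrite exprMn; apply: IM => //; apply: AX.
Qed.

Lemma rad_root m s : A s -> rad (s ^+ m) -> rad s.
Proof. by move=> sa [_ [N i]]; split=> //; exists (m * N)%N; rewrite exprM. Qed.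

Lemma rad1 : rad 1 -> I 1.
Proof. by case=> _ [N]; rewrite expr1n. Qed.
End Radical.

Section Main.
Variables (R : comNzRingType) (h : hermRing R) (S : frame h) (n : nat).
Hypothesis hn : (3 <= n)%N.
Notation "x ^!" := (bar h x) (at level 1, format "x ^!").
Notation lam := (lam h).
Notation A := (fA S).
Notation vec := 'cV[R]_(n.*2.+1).
Notation mat := 'M[R]_(n.*2.+1).
Notation idx := 'I_(n.*2.+1).
Notation o := (th_zero n).
Notation form := (hform h).
Notation lform := (hform_op h).
Notation cc := (gram h).
Notation ev := (@bvec R n).
Notation Tv := (@transv R h n).
Notation point := (qpoint S).
Implicit Types (u v w f p q : vec) (i j k l m : idx) (a x y z s : R) (g : mat).
Variables (P : mat -> Prop) (cP : elem_closed S P).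

(** A vector orthogonal to u, proportional to f modulo e_-k; for f = e_m it has only two
nonzero coordinates, so that P_avoid applies to it. *)
Definition koszul u k f : vec := locked_with form_key
  (form u (ev (th_opp k)) *: f - form u f *: ev (th_opp k)).

Lemma koszulU u k f :
  koszul u k f = form u (ev (th_opp k)) *: f - form u f *: ev (th_opp k).
Proof. by rewrite /koszul unlock. Qed.

Lemma koszulD u k f f' : koszul u k (f + f') = koszul u k f + koszul u k f'.
Proof. by rewrite !koszulU formE; apply/colP => i; rewrite !mxE; ring. Qed.

Lemma koszulZ u k x f : koszul u k (x *: f) = x *: koszul u k f.
Proof. by rewrite !koszulU formE; apply/colP => i; rewrite !mxE; ring. Qed.

Lemma form_koszul u k f : form u (koszul u k f) = 0.
Proof. by rewrite !koszulU !formE; ring. Qed.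

Definition nrm u k : R := locked_with form_key (u k 0 * (u k 0)^!).

Lemma nrmU u k : nrm u k = u k 0 * (u k 0)^!.
Proof. by rewrite /nrm unlock. Qed.

Lemma nrm_bar u k : (nrm u k)^! = nrm u k.
Proof. by rewrite nrmU !barE mulrC. Qed.

Section Fixed.
Variables (u : vec) (k : idx).
Hypothesis su : point u 0.
Hypothesis hk : th_hb k.
Notation F := (koszul u k).
Notation b := (form u (ev (th_opp k))).
Notation s0 := (nrm u k).

Let uu := point_sing su.
Let hk' : th_hb (th_opp k). Proof. by rewrite th_hb_opp. Qed.

Lemma bE : b = (u k 0)^! * cc k. Proof. by rewrite form_er th_oppK. Qed.

Lemma bb : b^! * b = s0.
Proof. by rewrite bE !barE nrmU; ring : (ccV h hk). Qed.

Lemma ab : A b. Proof. by apply: fA_form; [apply: point_nvec su|apply: nvec_ev]. Qed.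

Lemma as0 : A s0.
Proof. by rewrite nrmU; apply: fAM; [|apply: fAbar]; apply: su.1. Qed.

Lemma ek_f f : f k 0 = 0 -> form (ev (th_opp k)) f = 0.
Proof. by move=> fk; rewrite form_el th_oppK fk mulr0. Qed.

Lemma f_ek f : f k 0 = 0 -> form f (ev (th_opp k)) = 0.
Proof. by move=> fk; apply: form0_sym; apply: ek_f. Qed.

Lemma form_koszul2 f f' : f k 0 = 0 -> f' k 0 = 0 ->
  form (F f) (F f') = s0 * form f f'.
Proof.
move=> fk fk'; rewrite !koszulU !formE (ek_f fk') (f_ek fk) (form_evev0 h hk').
by rewrite -bb; ring.
Qed.

Lemma point_koszul f y : point f y -> f k 0 = 0 -> point (F f) (y * s0).
Proof.
move=> fy fk.
have af : A (form u f) by apply: fA_form; [apply: point_nvec su|apply: point_nvec fy].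
apply: (point_eq (pointD (pointZ ab fy) (pointN (point_ev hk' af)))).
  by rewrite koszulU.
by rewrite !lfE (lform0 (f_ek fk)) -bb; ring.
Qed.

Lemma far_k m : far m k -> [/\ ev m k 0 = 0 :> R, ev m (th_opp k) 0 = 0 :> R,
   ev (th_opp m) k 0 = 0 :> R & ev (th_opp m) (th_opp k) 0 = 0 :> R].
Proof.
move=> f; have [e1 e2 e3 e4] := far_neq f.
by split; rewrite evE ?eq_th_opp ?th_opp_eqC ?th_oppK ?e1 ?e2 ?e3 ?e4 // eq_sym ?e1 ?e2 ?e3 ?e4.
Qed.

(** The vector koszul u k e_m lives on m and -k, so it avoids a third hyperbolic pair. *)
Lemma P_koszul_ev m v y : far m k -> point v y -> form (F (ev m)) v = 0 ->
  P (Tv (F (ev m)) v y).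
Proof.
move=> fm vy orth; have hm := far_hbl fm.
have [l [lm lk]] := far_ex hn hm hk.
have [e1 e2 e3 e4] := far_neq lm.
have [e1' e2' e3' e4'] := far_neq lk.
apply: (@P_avoid _ _ _ _ _ cP _ l) => //.
- apply: (point_eq (point_koszul (point_ev hm (fA1 S)) _)); rewrite ?scale1r ?mul0r //.
  by case: (far_k fm).
- exact: far_hbl lm.
- by rewrite !koszulU !mxE e1 e3' !mulr0 subr0.
- by rewrite !koszulU !mxE eq_th_opp e1' th_opp_eqC e3 !mulr0 subr0.
Qed.

Lemma point_koszul_ev m x : far m k -> A x -> point (x *: F (ev m)) 0.
Proof.
move=> fm ax; have hm := far_hbl fm; rewrite -koszulZ.
have [z _ _ _] := far_k fm.
by apply: (point_eq (point_koszul (point_ev hm ax) _)); rewrite ?mul0r // mxE z mulr0.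
Qed.

Lemma P_u_koszul m x : far m k -> A x -> P (Tv u (x *: F (ev m)) 0).
Proof.
move=> fm ax; rewrite Tv_swap Tv_scale !mul0r; apply: P_koszul_ev => //.
  have al : A (x^! * (- lam^!)).
    by apply: fAM; [apply: fAbar|apply: fAN; apply: fAbar; apply: fAlam].
  by apply: (point_eq (pointZ al su)); rewrite ?scalerA ?mul0r.
by rewrite !formZr (form0_sym (form_koszul _ _ _)) !mulr0.
Qed.

(** The elementary matrix T(u; f_m, 0) takes f_-m to f_-m - kap u, where f_m = koszul u k e_m
and kap is s0 up to a unit, and it fixes v. Hence T(f_-m - kap u; v, y) is elementary, and
so is T(kap u; v, y) by Tv_split. *)
Lemma P_orth m v y : far m k -> point v y -> form u v = 0 ->
  form (F (ev m)) v = 0 -> form (F (ev (th_opp m))) v = 0 ->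
  P (Tv u (s0 *: v) (y * s0 ^+ 2)).
Proof.
move=> fm; have hm := far_hbl fm.
have hm' : th_hb (th_opp m) by rewrite th_hb_opp.
have fm' : far (th_opp m) k by rewrite far_oppl.
have [z1 z2 z3 z4] := far_k fm.
suff H v' y' : point v' y' -> form u v' = 0 -> form (F (ev m)) v' = 0 ->
    form (F (ev (th_opp m))) v' = 0 ->
    P (Tv u (- (s0 * cc (th_opp m)) *: v') (y' * s0 ^+ 2)).
  move=> vy uv mv mv'; pose c := cc (th_opp m); have cu : c * c^! = 1 by apply: ccV.
  have -> : s0 *: v = - (s0 * c) *: ((- c^!) *: v).
    by rewrite scalerA; congr (_ *: _); ring : cu.
  have vy' := pointZ (fAN (fAbar (fA_cc S hm'))) vy.
  have cc1 : y * (- c^! * (- c^!)^!) = y by rewrite !barE; ring : cu.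
  by rewrite cc1 in vy'; apply: H; rewrite // formZr ?uv ?mv ?mv' mulr0.
move: v' y' => {}v {}y vy uv mv mv'.
pose f := F (ev m); pose f' := F (ev (th_opp m)).
have uf : form u f = 0 by apply: form_koszul.
have uf' : form u f' = 0 by apply: form_koszul.
have fu' := form0_sym uf'.
have ff' : form f f' = s0 * cc m by rewrite form_koszul2 // form_evopp.
have sf : point f 0 by rewrite -[f]scale1r; apply: point_koszul_ev => //; apply: fA1.
have sf' : point f' 0 by rewrite -[f']scale1r; apply: point_koszul_ev => //; apply: fA1.
pose kap := s0 * cc m * lam^!.
have lff' : lform f f' = kap by rewrite lformE ff'.
have pF x : A x -> P (Tv u (x *: f') 0) by apply: P_u_koszul.
have pG : P (Tv u f 0) by rewrite -[f]scale1r; apply: P_u_koszul => //; apply: fA1.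
have pG' : P (Tv u (- f) (- 0 - lform f f)).
  have -> : - 0 - lform f f = 0.
    by rewrite (lform0 (point_sing sf)) !oppr0 addr0.
  by rewrite -scaleN1r; apply: P_u_koszul => //; apply: fAN (fA1 S).
have pf' v1 y1 : point v1 y1 -> form f' v1 = 0 -> P (Tv f' v1 y1) by apply: P_koszul_ev.
rewrite -/f in mv; rewrite -/f' in mv'; clearbody f f'.
have pc : P (Tv (f' + (- kap) *: u) v y).
  have Gf' : Tv u f 0 *m f' = f' + (- kap) *: u.
    by rewrite TvE uf' lff' mul0r !scale0r !addr0 scaleNr.
  have Gv : Tv u f 0 *m v = v.
    by rewrite TvE uv (lform0 mv) mulr0 !scale0r !addr0 subr0.
  rewrite -Gf' -[X in Tv _ X _]Gv -(Tv_conj (g' := Tv u (- f) (- 0 - lform f f))).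
  - by do ![apply: (P_mul cP) => //]; apply: pf'.
  - exact: Tv_inv.
  by move=> w w'; apply: Tv_iso => //; apply: point_tr sf.
have kk : (- kap)^! = - (s0 * cc (th_opp m)).
  by rewrite /kap cc_opp // !barE nrm_bar; ring.
have ak : A (- kap).
  apply: fAN; apply: fAM; last exact: fAbar (fAlam S).
  by apply: fAM; [apply: as0|apply: fA_cc].
clearbody kap.
have hku : form (- kap *: u) (- kap *: u) = 0 by rewrite !formE uu !mulr0.
rewrite (Tv_split (point_sing sf') hku _ mv' _ (point_tr vy)) in pc; first last.
- by rewrite formE uv mulr0.
- by rewrite formE fu' mulr0.
have ay := point_A vy.
have e1 : Tv (- kap *: u) (y *: f') 0 *m Tv (- kap *: u) ((- y) *: f') 0 = 1%:M.
  rewrite (Tv_add _ _ hku) ?formZr ?formZl ?uf' ?mulr0 //.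
  rewrite -scalerDl subrr scale0r -(Tv0 h (- kap *: u)).
  by congr (Tv _ _ _); rewrite !lfE (lform0 (point_sing sf')); ring.
have e2 := Tv_inv y (point_sing sf') mv'.
have -> : Tv u (- (s0 * cc (th_opp m)) *: v) (y * s0 ^+ 2) = Tv (- kap *: u) v y.
  rewrite Tv_scale kk; congr (Tv _ _ _); rewrite -mulrA; congr (_ * _).
  rewrite -[X in X * _](barK h) kk cc_opp // !barE nrm_bar; ring : (ccV h hm) (lamV h).
have -> : Tv (- kap *: u) v y = Tv (- kap *: u) v y *m Tv f' v y *m
     Tv (- kap *: u) (y *: f') 0 *m Tv (- kap *: u) ((- y) *: f') 0
     *m Tv f' (- v) (- y - lform v v).
  rewrite -(mulmxA (Tv (- kap *: u) v y *m Tv f' v y)) e1 mulmx1.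
  by rewrite -mulmxA e2 mulmx1.
apply: (P_mul cP).
  apply: (P_mul cP) => //; rewrite Tv_scale !mul0r scalerA; apply: pF.
  by apply: fAM; [apply: fAbar|apply: fAN].
by apply: pf'; [apply: point_inv|rewrite formE mv' oppr0].
Qed.

(** Sum over the coordinates of f. Those with nonzero index are covered by P_u_koszul, and
the odd one by P_orth, since koszul u k e_0 is orthogonal to koszul u k e_m and koszul u k e_-m. *)
Lemma P_koszul f y : point f y -> f k 0 = 0 -> f (th_opp k) 0 = 0 ->
  P (Tv u (s0 *: F f) (y * s0 ^+ 3)).
Proof.
move=> fy fk fk'.
pose K f y := [/\ f k 0 = 0, f (th_opp k) 0 = 0 & P (Tv u (s0 *: F f) (y * s0 ^+ 3))].
suff [] : K f y by [].
apply: (@point_ind _ _ S _ K (pred2 k (th_opp k))) fy _ => //.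
- move=> {fk fk'} v {}y v' y' [v1 v2 pv] [v1' v2' pv']; split; [by rewrite mxE v1 v1' addr0|by rewrite mxE v2 v2' addr0|].
  rewrite koszulD scalerDr.
  have -> : (y + y' - lform v v') * s0 ^+ 3 =
     y * s0 ^+ 3 + y' * s0 ^+ 3 - lform (s0 *: F v) (s0 *: F v').
    by rewrite !lfE nrm_bar !lformE form_koszul2 //; ring.
  by rewrite -Tv_add ?formZr ?form_koszul ?mulr0 //; apply: (P_mul cP).
- move=> j x hj /=; rewrite negb_or => /andP[jk jk'] ax.
  have fj : far j k by rewrite /far hj hk jk jk'.
  have [z1 z2 _ _] := far_k fj.
  split; [by rewrite mxE z1 mulr0|by rewrite mxE z2 mulr0|].
  rewrite koszulZ scalerA mul0r; apply: P_u_koszul => //.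
  by apply: fAM => //; apply: as0.
- move=> x {}y d.
  have z1 : (x *: ev o) k 0 = 0 by rewrite mxE evE (negbTE hk) mulr0.
  have z2 : (x *: ev o) (th_opp k) 0 = 0 by rewrite mxE evE (negbTE hk') mulr0.
  split=> //; have [m [fm _]] := far_ex hn hk hk.
  have fm' : far (th_opp m) k by rewrite far_oppl.
  have [k1 _ _ _] := far_k fm; have [k1' _ _ _] := far_k fm'.
  have -> : y * s0 ^+ 3 = (y * s0) * s0 ^+ 2 by ring.
  apply: (P_orth fm).
  + by apply: point_koszul => //; apply: point_e0.
  + exact: form_koszul.
  + by rewrite form_koszul2 // formE form_ev_e0 ?(far_hbl fm) // !mulr0.
  + by rewrite form_koszul2 // formE form_ev_e0 ?(far_hbl fm') // !mulr0.
- by move=> j hj /= /orP[] /eqP->.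
Qed.

(** The vector v = u_k w - w_k u has v_k = 0, so that a multiple of it is a Koszul vector.
As T(u; x u, 0) = T(u; 0, x - conj(x) lam^-1) is covered by P_orth with v = 0, the multiple of
u does not matter. *)
Lemma P_cube w x : point w 0 -> form u w = 0 -> A x -> P (Tv u ((s0 ^+ 3 * x) *: w) 0).
Proof.
move=> sw uw ax.
have [v ev1] : exists v, v = u k 0 *: w - w k 0 *: u by eexists.
have au : A (u k 0) by apply: su.1.
have aw : A (w k 0) by apply: sw.1.
have sv : point v 0.
  apply: (point_eq (pointD (pointZ au sw) (pointN (pointZ aw su)))) => //.
  by rewrite !lfE (lform0 (form0_sym uw)); ring.
have uv : form u v = 0 by rewrite ev1 !formE uw uu; ring.
have vk : v k 0 = 0 by rewrite ev1 !mxE; ring.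
have [f ef] : exists f, f = v - v (th_opp k) 0 *: ev (th_opp k) by eexists.
have sf : point f 0.
  have := point_peel sv hk' (sv.1 _ hk'); rewrite -ef => H; apply: (point_eq H) => //.
  by rewrite lfE (lform0 (f_ek vk)); ring.
have fk : f k 0 = 0 by rewrite ef !mxE vk (th_hb_neq hk) mulr0 subr0.
have fk' : f (th_opp k) 0 = 0 by rewrite ef !mxE !eqxx mulr1 subrr.
have Ff : F f = b *: v.
  rewrite koszulU ef !formE uv; apply/colP => i; rewrite !mxE; ring.
have [t et] : exists t, t = x * (cc k)^! * b * w k 0 by eexists.
have at_ : A t.
  rewrite et.
  by do !apply: fAM => //; [apply: fAbar; apply: fA_cc|apply: ab].
have a1 : A (s0 * (x * (cc k)^!)).
  apply: fAM; first exact: as0.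
  by apply: fAM => //; apply: fAbar; apply: fA_cc.
have := pointZ a1 sf; rewrite mul0r => sxf.
have p1 := P_koszul sxf; rewrite !mxE fk fk' !mulr0 mul0r koszulZ Ff !scalerA in p1.
have p1' := p1 erefl erefl.
have p2 : P (Tv u 0 ((t - t^! * lam^!) * s0 ^+ 2)).
  have [m [fm _]] := far_ex hn hk hk.
  have := point_min at_ (point0 S n); rewrite add0r => v0.
  by have := P_orth fm v0; rewrite scaler0 !form0r; apply.
have -> : Tv u ((s0 ^+ 3 * x) *: w) 0 =
   Tv u (s0 * (s0 * (x * (cc k)^!)) * b *: v) 0 *m Tv u 0 ((t - t^! * lam^!) * s0 ^+ 2).
  have -> : (t - t^! * lam^!) * s0 ^+ 2 = s0 ^+ 2 * t - (s0 ^+ 2 * t)^! * lam^!.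
    by rewrite barM barX nrm_bar; ring.
  rewrite -Tv_self Tv_add ?formE ?uu ?uv ?mulr0 //.
  have vu := form0_sym uv.
  congr (Tv _ _ _); last by rewrite !lfE (lform0 vu); ring.
  rewrite ev1 et bE nrmU; apply/colP => i; rewrite !mxE.
  by ring : (ccV h hk).
exact: (P_mul cP).
Qed.

End Fixed.

(** The hypotheses of P_unimodular; they are preserved by isometries. *)
Definition uni_pair u w := [/\ point u 0, point w 0, form u w = 0 &
  exists2 w', nvec S w' & form u w' = 1].

(** The ideal of multiples of w all of whose multiples give transvections in P. *)
Definition elem_coef u w s := A s /\ forall x, A x -> P (Tv u ((s * x) *: w) 0).

Lemma uni_pair_Tv e v y u w : point e 0 -> point v y -> form e v = 0 -> uni_pair u w ->
  uni_pair (Tv e v y *m u) (Tv e v y *m w).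
Proof.
move=> se vy ev [su sw uw [w' nw' uw']].
have iso := Tv_iso _ _ (point_sing se) ev (point_tr vy).
split; [exact: Tv_point|exact: Tv_point|by rewrite iso|].
by exists (Tv e v y *m w'); [apply: Tv_nvec|rewrite iso].
Qed.

Section Ideal.
Variables (u w : vec).
Hypothesis gd : uni_pair u w.
Notation I := (elem_coef u w).

Lemma elem_coefA s : I s -> A s. Proof. by case. Qed.

Lemma elem_coef0 : I 0.
Proof.
split=> [|x ax]; first exact: fA0.
by rewrite mul0r scale0r Tv0; apply: P_one cP.
Qed.

Lemma elem_coefD s t : I s -> I t -> I (s + t).
Proof.
case: gd => su sw uw _ [a1 p1] [a2 p2]; split; first exact: fAD.
move=> x ax; have := P_mul cP (p1 x ax) (p2 x ax).
rewrite Tv_add ?formE ?uw ?(point_sing su) ?mulr0 // -scalerDl -mulrDl.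
by rewrite !lfE (lform0 (point_sing sw)) !mulr0 subr0 addr0.
Qed.

Lemma elem_coefM a s : A a -> I s -> I (a * s).
Proof.
move=> aa [as_ ps]; split; first exact: fAM.
by move=> x ax; rewrite (mulrC a) -mulrA; apply: ps; apply: fAM.
Qed.

(** The radical of that ideal; P_unimodular amounts to 1 being in it. *)
Definition srad s := rad A I s.

Lemma sradD s t : srad s -> srad t -> srad (s + t).
Proof. exact: (radD elem_coef0 elem_coefD elem_coefM (@fAD _ _ S) (fA1 S) (@fAM _ _ S)). Qed.
Lemma sradM a s : A a -> srad s -> srad (a * s).
Proof. exact: (radM elem_coefM (fA1 S) (@fAM _ _ S)). Qed.
Lemma srad_root (N : nat) s : A s -> srad (s ^+ N) -> srad s.
Proof. exact: rad_root. Qed.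
Lemma srad0 : srad 0. Proof. exact: (rad_in elem_coefA elem_coef0). Qed.
Lemma srad_sum (J : Type) (r : seq J) (Q : pred J) (E : J -> R) :
  (forall t, Q t -> srad (E t)) -> srad (\sum_(t <- r | Q t) E t).
Proof. by move=> AE; apply: (big_ind srad) => //; [apply: srad0|apply: sradD]. Qed.
Lemma sradA s : srad s -> A s. Proof. by case. Qed.
Lemma sradN s : srad s -> srad (- s).
Proof. by move=> rs; rewrite -mulN1r; apply: sradM => //; apply: fAN (fA1 S). Qed.
Lemma sradB s t : srad s -> srad t -> srad (s - t).
Proof. by move=> rs rt; apply: sradD => //; apply: sradN. Qed.

Lemma srad_nrm k : th_hb k -> srad (u k 0 * (u k 0)^!).
Proof.
move=> hk; have [su sw uw _] := gd; have as_ := as0 su hk; rewrite -nrmU; split=> //.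
by exists 3%N; split=> [|x ax]; [apply: fAX|apply: P_cube].
Qed.
End Ideal.

(** Conjugation by an elementary matrix carries the transvections for (u, w) to those for
the images, so both pairs have the same ideal. Hence any relation proved for all pairs
may be applied after an elementary change of u. *)
Lemma srad_Tv i v y u w s : uni_pair u w -> th_hb i -> point v y -> form (ev i) v = 0 ->
  v (th_opp i) 0 = 0 ->
  srad (Tv (ev i) v y *m u) (Tv (ev i) v y *m w) s -> srad u w s.
Proof.
move=> gd hi vy iv vi [as_ [N [aN pN]]]; split=> //; exists N; split=> // x ax.
have si : point (ev i) 0 by rewrite -[ev i]scale1r; apply: point_ev => //; apply: fA1.
have ii := point_sing si.
have iso := Tv_iso _ _ ii iv (point_tr vy).
pose g' := Tv (ev i) (- v) (- y - lform v v).
have gg' : Tv (ev i) v y *m g' = 1%:M by apply: Tv_inv.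
have g'g : g' *m Tv (ev i) v y = 1%:M by apply: Tv_invr.
have := pN x ax; rewrite scalemxAr -(Tv_conj _ _ _ gg' iso) => pc.
have p1 : P (Tv (ev i) v y) by apply: (P_ev cP).
have p2 : P g' by apply: (P_ev cP) => //; [apply: point_inv|rewrite mxE vi oppr0].
have := P_mul cP p2 (P_mul cP pc p1).
by rewrite !mulmxA g'g mul1mx -mulmxA g'g mulmx1.
Qed.

End Main.

(** * Transvections along unimodular vectors *)

Section Coordinates.
Variables (R : comNzRingType) (h : hermRing R) (n : nat).
Notation "x ^!" := (bar h x) (at level 1, format "x ^!").
Notation ev := (@bvec R n).
Notation Tv := (@transv R h n).
Implicit Types (i j k : 'I_(n.*2.+1)) (u : 'cV[R]_(n.*2.+1)).

Lemma Tv_far_coord i j x u k : (Tv (ev i) (x *: ev j) 0 *m u) k 0 =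
  u k 0 + (k == j)%:R * (x * gram h i * u (th_opp i) 0)
        - (k == i)%:R * (x^! * gram h j * (lam h)^! * u (th_opp j) 0).
Proof.
rewrite TvE form_el lformZl lformE form_el mul0r scale0r addr0 !mxE !eqxx !andbT.
ring.
Qed.

Lemma Tv_e0_coord i x y u k : th_hb k ->
  (Tv (ev i) (x *: ev (th_zero n)) y *m u) k 0 =
  u k 0 + (k == i)%:R * (y * gram h i * u (th_opp i) 0
        - x^! * mu h * (lam h)^! * u (th_zero n) 0).
Proof.
move=> hk; rewrite TvE form_el lformZl lformE form_el th_opp_zero cc_zero.
by rewrite !mxE !eqxx !andbT (negbTE hk) /=; ring.
Qed.
End Coordinates.

Section Main.
Variables (R : comNzRingType) (h : hermRing R) (S : frame h) (n : nat).
Hypothesis hn : (3 <= n)%N.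
Notation "x ^!" := (bar h x) (at level 1, format "x ^!").
Notation lam := (lam h).
Notation mu := (mu h).
Notation A := (fA S).
Notation D := (fD S).
Notation vec := 'cV[R]_(n.*2.+1).
Notation mat := 'M[R]_(n.*2.+1).
Notation idx := 'I_(n.*2.+1).
Notation o := (th_zero n).
Notation form := (hform h).
Notation cc := (gram h).
Notation ev := (@bvec R n).
Notation Tv := (@transv R h n).
Notation point := (qpoint S).
Implicit Types (u v w f p q : vec) (i j k l m : idx) (a x y z s : R) (g : mat).
Variables (P : mat -> Prop) (cP : elem_closed S P).
Notation uni_pair := (uni_pair S).
Notation srad := (srad S P).

Lemma srad_far i j x u w s : uni_pair u w -> far i j -> A x ->
  uni_pair (Tv (ev i) (x *: ev j) 0 *m u) (Tv (ev i) (x *: ev j) 0 *m w) /\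
  (srad (Tv (ev i) (x *: ev j) 0 *m u) (Tv (ev i) (x *: ev j) 0 *m w) s ->
   srad u w s).
Proof.
move=> gd fij ax; have [hi hj] := (far_hbl fij, far_hbr fij).
have vx : point (x *: ev j) 0 by apply: point_ev.
have ij : form (ev i) (x *: ev j) = 0 by rewrite formE form_far // mulr0.
have si : point (ev i) 0 by rewrite -[ev i]scale1r; apply: point_ev => //; apply: fA1.
split; first exact: uni_pair_Tv.
apply: srad_Tv => //; rewrite mxE evE.
by have [_ _ _ e] := far_neq fij; rewrite eq_sym e mulr0.
Qed.

Lemma srad_e0 i x y u w s : uni_pair u w -> th_hb i -> D x y^! ->
  uni_pair (Tv (ev i) (x *: ev o) y *m u) (Tv (ev i) (x *: ev o) y *m w) /\
  (srad (Tv (ev i) (x *: ev o) y *m u) (Tv (ev i) (x *: ev o) y *m w) s ->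
   srad u w s).
Proof.
move=> gd hi d.
have vx : point (x *: ev o) y by apply: point_e0.
have i0 : form (ev i) (x *: ev o) = 0 by rewrite formE form_ev_e0 // mulr0.
have si : point (ev i) 0 by rewrite -[ev i]scale1r; apply: point_ev => //; apply: fA1.
split; first exact: uni_pair_Tv.
apply: srad_Tv => //; rewrite mxE evE.
by rewrite th_opp_eqC th_opp_zero (negbTE hi) mulr0.
Qed.

Lemma uni_pair_A u w k : uni_pair u w -> th_hb k -> A (u k 0) /\ A ((u k 0)^!).
Proof. by case=> su _ _ _ hk; split; [|apply: fAbar]; apply: su.1. Qed.

(** Applying srad_nrm to u and to the vector with j-th coordinate u_j + u_k puts
u_j conj(u_k) + u_k conj(u_j) in the radical. Multiplied by u_j conj(u_k) this is the square of
u_j conj(u_k) modulo the radical. *)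
Lemma srad_far_prod u w j k : uni_pair u w -> far j k -> srad u w (u j 0 * (u k 0)^!).
Proof.
move=> gd fjk; have [hj hk] := (far_hbl fjk, far_hbr fjk).
have hk' : th_hb (th_opp k) by rewrite th_hb_opp.
have fkj : far (th_opp k) j by rewrite far_oppl far_sym.
have [aj aj'] := uni_pair_A gd hj; have [ak ak'] := uni_pair_A gd hk.
have ac := fAbar (fA_cc S hk').
have [gd' tr] := srad_far (u j 0 * (u j 0)^! + u j 0 * (u k 0)^! +
  (u k 0 * (u j 0)^! + u k 0 * (u k 0)^!)) gd fkj ac.
have := srad_nrm hn cP gd' hj; rewrite !Tv_far_coord eqxx.
have [_ _ e _] := far_neq fjk; rewrite e /= th_oppK.
have -> : u j 0 + 1 * ((cc (th_opp k))^! * cc (th_opp k) * u k 0) -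
   0 * ((cc (th_opp k))^!^! * cc j * lam^! * u (th_opp j) 0) = u j 0 + u k 0.
  by ring : (ccV h hk').
rewrite barD mulrDl !mulrDr => /tr r.
have {}r : srad u w (u j 0 * (u k 0)^! + u k 0 * (u j 0)^!).
  have := sradB cP gd (sradB cP gd r (srad_nrm hn cP gd hj)) (srad_nrm hn cP gd hk).
  by congr srad; ring.
have as_ : A (u j 0 * (u k 0)^!) by apply: fAM.
apply: (srad_root (N := 2)) => //.
have r1 := sradM (fAM aj ak') r (P := P).
have r2 := sradM (fAM ak ak') (srad_nrm hn cP gd hj) (P := P).
by have := sradB cP gd r1 r2; congr srad; ring.
Qed.

(** The previous lemma for the vector obtained from u by an elementary matrix that adds u_-j to
u_l and a multiple of u_-l to u_j; then squares again. *)
Lemma srad_opp_prod u w j : uni_pair u w -> th_hb j ->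
  srad u w (u j 0 * (u (th_opp j) 0)^!).
Proof.
move=> gd hj; have [l [flj _]] := far_ex hn hj hj.
have hl := far_hbl flj; have fjl : far j l by rewrite far_sym.
have hj' : th_hb (th_opp j) by rewrite th_hb_opp.
have hl' : th_hb (th_opp l) by rewrite th_hb_opp.
have [aj aj'] := uni_pair_A gd hj; have [al al'] := uni_pair_A gd hl.
have [an an'] := uni_pair_A gd hj'; have [am am'] := uni_pair_A gd hl'.
have ac := fAbar (fA_cc S hj).
have aeps : A (cc j * cc l * lam^!).
  by do !apply: fAM; [apply: fA_cc|apply: fA_cc|apply: fAbar; apply: fAlam].
have [eps eE] : exists eps, eps = cc j * cc l * lam^! by eexists.
rewrite -eE in aeps.
have [gd' tr] := srad_far ((u j 0 - eps * u (th_opp l) 0) * (u l 0 + u (th_opp j) 0)^!)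
  gd fjl ac.
have := srad_far_prod gd' fjl; rewrite !Tv_far_coord !eqxx.
have [e1 e2 _ _] := far_neq fjl; rewrite e1 e2 /=.
have -> : u j 0 + 0 * ((cc j)^! * cc j * u (th_opp j) 0) -
   1 * ((cc j)^!^! * cc l * lam^! * u (th_opp l) 0) = u j 0 - eps * u (th_opp l) 0.
  by rewrite barK eE; ring.
have -> : u l 0 + 1 * ((cc j)^! * cc j * u (th_opp j) 0) -
   0 * ((cc j)^!^! * cc l * lam^! * u (th_opp l) 0) = u l 0 + u (th_opp j) 0.
  by ring : (ccV h hj).
move=> /tr r.
have r1 := srad_far_prod gd fjl.
have r2 : srad u w (u (th_opp l) 0 * (u (th_opp j) 0)^!).
  by apply: srad_far_prod => //; rewrite far_oppl far_oppr.
have {}r : srad u w (u j 0 * (u (th_opp j) 0)^! - eps * (u (th_opp l) 0 * (u l 0)^!)).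
  have := sradD cP gd (sradB cP gd r r1) (sradM aeps r2 (P := P)).
  by congr srad; rewrite barD; ring.
apply: (srad_root (N := 2)) => //; first exact: fAM.
have r3 := sradM (fAM aj an') r (P := P).
have r4 := sradM (fAM aeps (fAM am an')) r1 (P := P).
by have := sradD cP gd r3 r4; congr srad; ring.
Qed.

Lemma srad_prod u w j k : uni_pair u w -> th_hb j -> th_hb k ->
  srad u w (u j 0 * (u k 0)^!).
Proof.
move=> gd hj hk; case: (hb_cases hk hj) => [->|->|f].
- exact: srad_nrm.
- exact: srad_opp_prod.
- by apply: srad_far_prod => //; rewrite far_sym.
Qed.

(** Here the elementary change is T_i(x, y), which adds multiples of conj(x) mu u_0 and of
u_-i to u_i. *)
Lemma srad_zero_prod u w j x y : uni_pair u w -> th_hb j -> D x y ->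
  srad u w (u j 0 * ((u o 0)^! * mu * x)) /\
  srad u w ((u j 0)^! * (u o 0 * mu * lam^! * x^!)).
Proof.
move=> gd hj d; have [i [fij _]] := far_ex hn hj hj; have hi := far_hbl fij.
have [e1 e2 e3 e4] := far_neq fij.
have hi' : th_hb (th_opp i) by rewrite th_hb_opp.
have d' : D x y^!^! by rewrite barK.
have key j' k' : th_hb j' -> th_hb k' ->
    srad u w ((Tv (ev i) (x *: ev o) y^! *m u) j' 0 *
     ((Tv (ev i) (x *: ev o) y^! *m u) k' 0)^!).
  move=> hj' hk'; have [gd' tr] := srad_e0 ((Tv (ev i) (x *: ev o) y^! *m u) j' 0 *
     ((Tv (ev i) (x *: ev o) y^! *m u) k' 0)^!) gd hi d'.
  by apply: tr; apply: srad_prod.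
have ay : A (y^! * cc i).
  by apply: fAM; [apply: fAbar; apply: fDA d|apply: fA_cc].
split.
- have := key j i hj hi; rewrite !Tv_e0_coord // eqxx e2 /= => r.
  have r1 := srad_prod gd hj hi.
  have r2 := sradM (fAbar ay) (srad_prod gd hj hi') (P := P).
  have := sradB cP gd (sradD cP gd r1 r2) r.
  by congr srad; rewrite !barE; ring : (lamV h).
- have := key i j hi hj; rewrite !Tv_e0_coord // eqxx e2 /= => r.
  have r1 := srad_prod gd hi hj.
  have r2 := sradM ay (srad_prod gd hi' hj) (P := P).
  have := sradB cP gd (sradD cP gd r1 r2) r.
  by congr srad; rewrite !barE; ring.
Qed.

Lemma form_split u w : form u w = (u o 0)^! * mu * w o 0 +
  \sum_(i | th_hb i) (u i 0)^! * cc i * w (th_opp i) 0.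
Proof. by rewrite form_sum (bigD1 o) //= th_opp_zero cc_zero. Qed.

(** Multiply the equation b(u,w') = 1 by u_j: each term is one of the products above. *)
Lemma srad_coord u w j : uni_pair u w -> th_hb j ->
  srad u w (u j 0) /\ srad u w ((u j 0)^!).
Proof.
move=> gd hj; have [su sw uw [w' nw' uw']] := gd.
have [hw' [y' dw']] := nw'.
have [r1 r2] := srad_zero_prod gd hj dw'.
split.
- rewrite -[u j 0]mulr1 -uw' form_split mulrDr; apply: (sradD cP gd) => //.
  rewrite big_distrr /=; apply: (srad_sum cP gd) => i hi.
  have -> : u j 0 * ((u i 0)^! * cc i * w' (th_opp i) 0) =
    (cc i * w' (th_opp i) 0) * (u j 0 * (u i 0)^!) by ring.
  apply: (sradM (P := P)); last exact: srad_prod.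
  by apply: fAM; [apply: fA_cc|apply: hw'; rewrite th_hb_opp].
- rewrite -[(u j 0)^!]mulr1 -(bar1 h) -uw' form_split barD mulrDr.
  apply: (sradD cP gd); first by move: r2; congr srad; rewrite !barE; ring.
  rewrite bar_sum big_distrr /=; apply: (srad_sum cP gd) => i hi.
  have -> : (u j 0)^! * ((u i 0)^! * cc i * w' (th_opp i) 0)^! =
    ((cc i)^! * (w' (th_opp i) 0)^!) * (u i 0 * (u j 0)^!) by rewrite !barE; ring.
  apply: (sradM (P := P)); last exact: srad_prod.
  by apply: fAM; apply: fAbar; [apply: fA_cc|apply: hw'; rewrite th_hb_opp].
Qed.

(** All terms of b(u,w') = 1 but the odd one, z, are in the radical; so z is 1 modulo the
radical. On the other hand b(u,u) = 0 puts the product z conj(z), a multiple of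
conj(u_0) mu u_0, in the radical. *)
Theorem P_unimodular u w x : uni_pair u w -> A x -> P (Tv u (x *: w) 0).
Proof.
move=> gd ax; suff r : srad u w 1.
  by have [_ pI] := rad1 r; have := pI x ax; rewrite mul1r.
have [su sw uw [w' nw' uw']] := gd; have [hw' [y' dw']] := nw'.
have rs v : hbA S v ->
    srad u w (\sum_(i | th_hb i) (u i 0)^! * cc i * v (th_opp i) 0).
  move=> hv; apply: (srad_sum cP gd) => i hi; rewrite -mulrA mulrC.
  apply: (sradM (P := P)); last by case: (srad_coord gd hi).
  by apply: fAM; [apply: fA_cc|apply: hv; rewrite th_hb_opp].
have rs' : srad u w (\sum_(i | th_hb i) (u i 0)^! * cc i * w' (th_opp i) 0)^!.
  rewrite bar_sum; apply: (srad_sum cP gd) => i hi; rewrite !barM mulrA.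
  apply: (sradM (P := P)).
    by apply: fAM; apply: fAbar; [apply: hw'; rewrite th_hb_opp|apply: fA_cc].
  by rewrite barK; case: (srad_coord gd hi).
have r1 := rs _ hw'; have r2 := rs _ su.1.
have e1 := form_split u w'; rewrite uw' in e1.
have e2 := form_split u u; rewrite (point_sing su) in e2.
set s1 := \sum_(i | _) _ * w' _ _ in r1 rs' e1.
set s2 := \sum_(i | _) _ in r2 e2.
have [z ez] : exists z, z = (u o 0)^! * mu * w' o 0 by eexists.
rewrite -ez in e1.
have az : A z.
  have -> : z = 1 - s1 by rewrite e1; ring.
  by apply: fAB; [apply: fA1|apply: sradA r1].
have aw : A (lam^! * ((w' o 0)^! * mu * w' o 0)).
  by apply: fAM; [apply: fAbar; apply: fAlam|apply: (fDJ dw' dw')].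
have r3 : srad u w (z * z^!).
  have -> : z * z^! = - ((lam^! * ((w' o 0)^! * mu * w' o 0)) * s2).
    have -> : s2 = - ((u o 0)^! * mu * u o 0) by apply: (addrI ((u o 0)^! * mu * u o 0)); rewrite -e2 subrr.
    by rewrite ez !barE; ring.
  by apply: (sradN (P := P)); apply: (sradM (P := P)).
have -> : 1 = z * z^! + (s1 + z * s1^!).
  have -> : s1^! = 1 - z^! by rewrite -[1](bar1 h) e1 !barE; ring.
  by rewrite {1}e1; ring.
by apply: (sradD cP gd) => //; apply: (sradD cP gd) => //; apply: (sradM (P := P)).
Qed.

End Main.

(** * The frame of a form ring and the frame of congruent pairs *)

Section Morphism.
Variables (B R : comNzRingType) (hB : hermRing B) (h : hermRing R).
Variables (n : nat) (phi : {rmorphism B -> R}).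
Hypothesis phi_bar : forall x, phi (bar hB x) = bar h (phi x).
Hypothesis phi_lam : phi (lam hB) = lam h.
Hypothesis phi_mu : phi (mu hB) = mu h.
Implicit Types (u v : 'cV[B]_(n.*2.+1)).

Lemma phi_qpol u v : phi (hyp_form hB u v) = hyp_form h (map_mx phi u) (map_mx phi v).
Proof.
by rewrite /hyp_form rmorph_sum; apply: eq_bigr => i _; rewrite rmorphM phi_bar !mxE.
Qed.

Lemma phi_form u v : phi (hform hB u v) = hform h (map_mx phi u) (map_mx phi v).
Proof.
by rewrite !formU !rmorphD !rmorphM phi_bar phi_bar phi_lam phi_mu !phi_qpol !mxE.
Qed.

Lemma phi_lform u v : phi (hform_op hB u v) = hform_op h (map_mx phi u) (map_mx phi v).
Proof. by rewrite !lformU phi_bar phi_form. Qed.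

Lemma phi_ev i : map_mx phi (@bvec B n i) = @bvec R n i.
Proof. by rewrite /bvec map_delta_mx. Qed.

Lemma phi_Tv u v y : map_mx phi (transv hB u v y) = transv h (map_mx phi u) (map_mx phi v) (phi y).
Proof.
apply/matrixP => i j; rewrite !mxE !rmorphD rmorphN !rmorphM phi_form phi_lform.
by rewrite phi_ev rmorph_nat.
Qed.
End Morphism.

Section Frames.
Variables (R : comNzRingType) (F : hermFormRing R).
Notation "x ^!" := (bar F x) (at level 1, format "x ^!").
Notation lam := (lam F).
Notation mu := (mu F).
Implicit Types (x y z r : R).

Definition dl x y := Delta F ((x, y) : heis F).

Lemma sm_D (S : set (heis F)) x y x' y' : is_heis_submodule S ->
  S ((x, y) : heis F) -> S ((x', y') : heis F) ->
  S ((x + x', y + y' - x^! * mu * x') : heis F).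
Proof. by move=> [[_ SM _] _] s s'; apply: (SM _ _ s s'). Qed.

Lemma sm_N (S : set (heis F)) x y : is_heis_submodule S ->
  S ((x, y) : heis F) -> S ((- x, - y - x^! * mu * x) : heis F).
Proof. by move=> [[_ _ SV] _] s; apply: (SV _ s). Qed.

Lemma sm_Z (S : set (heis F)) r x y : is_heis_submodule S ->
  S ((x, y) : heis F) -> S ((x * r, r^! * y * r) : heis F).
Proof. by move=> [_ SZ] s; apply: (SZ _ r s). Qed.

Lemma dl_sm : is_heis_submodule (Delta F).
Proof. by case: (DeltaP F). Qed.

Lemma dlD x y x' y' : dl x y -> dl x' y' -> dl (x + x') (y + y' - x^! * mu * x').
Proof. exact: sm_D dl_sm. Qed.

Lemma dlN x y : dl x y -> dl (- x) (- y - x^! * mu * x).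
Proof. exact: sm_N dl_sm. Qed.

Lemma dlZ r x y : dl x y -> dl (x * r) (r^! * y * r).
Proof. exact: sm_Z dl_sm. Qed.

Lemma dl_eq x y x' y' : dl x y -> x = x' -> y = y' -> dl x' y'.
Proof. by move=> d <- <-. Qed.

Lemma dl_min x : dl 0 (x - x^! * lam).
Proof. by case: (DeltaP F) => _ Dm _; apply: Dm; exists x. Qed.

Lemma dl_tr x y : dl x y -> x^! * mu * x + y + y^! * lam = 0.
Proof. by case: (DeltaP F) => _ _ Dm d; apply: (Dm _ d). Qed.

Definition full : frame F.
Proof.
by refine (@Frame R F (fun _ => True) dl I (fun _ _ _ _ => I) (fun _ _ _ _ => I)
  (fun _ _ => I) I dlD dlN (fun r x y _ => @dlZ r x y) (fun x _ => dl_min x) dl_tr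
  (fun _ _ _ => I) (fun _ _ _ _ _ _ => I)).
Defined.

Section PairRing.

Definition pbar (x : R * R) : R * R := (bar F x.1, bar F x.2).

Lemma pbar_bij : bijective pbar.
Proof. by exists pbar => -[x y]; rewrite /pbar /= !barK. Qed.
Lemma pbarD (x y : R * R) : pbar (x + y) = pbar x + pbar y.
Proof. by rewrite /pbar !barD. Qed.
Lemma pbarM (x y : R * R) : pbar (x * y) = pbar y * pbar x.
Proof. by rewrite /pbar !barM. Qed.
Lemma pbar1 : pbar 1 = 1.
Proof. by rewrite /pbar !bar1. Qed.
Lemma pbar_bar (x : R * R) : pbar (pbar x) = (lam, lam) * x * pbar (lam, lam).
Proof. by case: x => x y; rewrite /pbar /= !bar_bar. Qed.
Lemma pmu_bar : (mu, mu) = pbar (mu, mu) * (lam, lam).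
Proof. by rewrite /pbar /=; congr pair; apply: mu_bar. Qed.

Definition pherm : hermRing (R * R)%type :=
  @HermRing (R * R)%type pbar (lam, lam) (mu, mu) pbar_bij pbarD pbarM pbar1
    pbar_bar pmu_bar.

End PairRing.

Section Double.
Variables (I : set R) (Om : set (heis F)).
Hypothesis IOm : is_odd_form_ideal F I Om.

Definition om x y := Om ((x, y) : heis F).

Lemma idI : is_ideal I. Proof. by case: IOm. Qed.
Lemma om_sm : is_heis_submodule Om. Proof. by case: IOm. Qed.
Lemma I0 : I 0. Proof. by case: idI. Qed.
Lemma ID x y : I x -> I y -> I (x + y). Proof. by case: idI => _ H _ _; apply: H. Qed.
Lemma IMl r x : I x -> I (r * x). Proof. by case: idI => _ _ H _; apply: H. Qed.
Lemma IMr r x : I x -> I (x * r). Proof. by case: idI => _ _ _ H; apply: H. Qed.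
Lemma IN x : I x -> I (- x). Proof. by move=> i; rewrite -mulN1r; apply: IMl. Qed.
Lemma IB x y : I x -> I y -> I (x - y). Proof. by move=> i j; apply: ID => //; apply: IN. Qed.
Lemma Ibar x : I x -> I x^!. Proof. by case: IOm => _ H _ _ _; apply: H. Qed.

Lemma omD x y x' y' : om x y -> om x' y' -> om (x + x') (y + y' - x^! * mu * x').
Proof. exact: sm_D om_sm. Qed.

Lemma omN x y : om x y -> om (- x) (- y - x^! * mu * x).
Proof. exact: sm_N om_sm. Qed.

Lemma omZ r x y : om x y -> om (x * r) (r^! * y * r).
Proof. exact: sm_Z om_sm. Qed.

Lemma om_eq x y x' y' : om x y -> x = x' -> y = y' -> om x' y'.
Proof. by move=> d <- <-. Qed.

Lemma om_min x : I x -> om 0 (x - x^! * lam).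
Proof.
case: IOm => _ _ _ Omin _ ix; apply: Omin.
exists ((0, x - x^! * lam) : heis F); first by exists x.
exists (1%g : heis F); last by rewrite mulg1.
by move=> G [[G1 _ _] _]; apply: G1.
Qed.

Lemma om_act x y r : dl x y -> I r -> om (x * r) (r^! * y * r).
Proof.
case: IOm => _ _ _ Omin _ d ir; apply: Omin.
exists (1%g : heis F).
  by exists 0; [apply: I0|rewrite bar0 mul0r subr0].
exists (heis_act ((x, y) : heis F) r); last by rewrite mul1g.
by move=> G [_ G1]; apply: G1; exists ((x, y) : heis F) => //; exists r.
Qed.

Lemma om_dl x y : om x y -> dl x y.
Proof. by case: IOm => _ _ _ _ Omax /Omax[]. Qed.
Lemma om_I x y : om x y -> I y.
Proof. by case: IOm => _ _ _ _ Omax /Omax[]. Qed.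
Lemma om_tilde x y x' y' : om x y -> dl x' y' -> I (x'^! * mu * x).
Proof. by case: IOm => _ _ _ _ Omax /Omax[_ t _] d; apply: t; exists y'. Qed.
Lemma om_tildeC x y x' y' : om x y -> dl x' y' -> I (x^! * mu * x').
Proof.
move=> o d; have /Ibar/(IMr lam) := om_tilde o d.
by rewrite !barE; congr I; ring : (lamV F).
Qed.

Lemma om_min_add x y z : om x y -> I z -> om x (y + (z - z^! * lam)).
Proof. by move=> d iz; apply: (om_eq (omD d (om_min iz))); ring. Qed.

(** Conjugation in the Heisenberg group changes the second component by a commutator,
which is in Omega because the first components of Omega lie in I-tilde. *)
Lemma om_conj p s x y : dl p s -> om x y -> om x (y - (p^! * mu * x - (p^! * mu * x)^! * lam)).
Proof.
move=> d o; have i := IN (om_tilde o d).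
by apply: (om_eq (om_min_add o i)); rewrite // barN; ring.
Qed.

Definition dA (x : R * R) := I (x.1 - x.2).

(** Pairs of elements of Delta whose difference in the Heisenberg group is in Omega, in
coordinates. *)
Definition dD (x y : R * R) :=
  [/\ dl x.1 y.1, dl x.2 y.2 &
      om (x.1 - x.2) (y.1 - y.2 + (x.1^! - x.2^!) * mu * x.2)].

Lemma dAM (x y : R * R) : dA x -> dA y -> dA (x * y).
Proof.
move=> ax ay; rewrite /dA; have -> : (x * y).1 - (x * y).2 =
  x.1 * (y.1 - y.2) + (x.1 - x.2) * y.2 by rewrite /=; ring.
by apply: ID; [apply: IMl|apply: IMr].
Qed.

Lemma dDD (x y x' y' : R * R) : dD x y -> dD x' y' ->
  dD (x + x') (y + y' - pbar x * (mu, mu) * x').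
Proof.
move=> [d1 d2 o] [d1' d2' o']; split=> /=; [exact: dlD|exact: dlD|].
by apply: (om_eq (omD (om_conj d1 o') o)); rewrite ?barE; ring : (lamV F).
Qed.

Lemma dDN (x y : R * R) : dD x y -> dD (- x) (- y - pbar x * (mu, mu) * x).
Proof.
move=> [d1 d2 o]; split=> /=; [exact: dlN|exact: dlN|].
by apply: (om_eq (om_conj (dlN d1) (omN o))); rewrite ?barE; ring : (lamV F).
Qed.

Lemma dDZ (r x y : R * R) : dA r -> dD x y -> dD (x * r) (pbar r * y * r).
Proof.
move=> ar [d1 d2 o]; split=> /=; [exact: dlZ|exact: dlZ|].
have o1 := omD (omZ r.1 o) (om_act d2 ar).
have iz : I (r.2^! * y.2 * (r.1 - r.2)) by apply: IMl.
apply: (om_eq (om_min_add o1 iz)); first by ring.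
rewrite !barE; apply: subr0_eq.
transitivity ((x.2^! * mu * x.2 + y.2 + y.2^! * lam) * (r.2^! - r.1^!) * r.2).
  by ring.
by rewrite dl_tr // !mul0r.
Qed.

Lemma dDmin (x : R * R) : dA x -> dD 0 (x - pbar x * (lam, lam)).
Proof.
move=> ax; split=> /=; [exact: dl_min|exact: dl_min|].
by apply: (om_eq (om_min ax)); rewrite ?barE; ring.
Qed.

Lemma dDtr (x y : R * R) : dD x y -> pbar x * (mu, mu) * x + y + pbar y * (lam, lam) = 0.
Proof. by move=> [d1 d2 _]; congr pair => /=; apply: dl_tr. Qed.

Lemma dDA (x y : R * R) : dD x y -> dA y.
Proof.
move=> [d1 d2 o]; rewrite /dA.
have := IB (om_I o) (om_tildeC o d2); congr I; rewrite !barE; ring.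
Qed.

Lemma dDJ (x y x' y' : R * R) : dD x y -> dD x' y' -> dA (pbar x * (mu, mu) * x').
Proof.
move=> [d1 d2 o] [d1' d2' o']; rewrite /dA /=.
have := ID (om_tilde o' d1) (om_tildeC o d2'); congr I; rewrite !barE; ring.
Qed.

(** Pairs congruent modulo (I, Omega) form a frame over R * R. That multiplication by
congruent scalars preserves congruence (dDZ) uses both Delta o I inside Omega and the
condition tr = 0 on Delta. *)
Definition double : frame pherm.
Proof.
refine (@Frame (R * R)%type pherm dA dD _ _ dAM _ _ dDD dDN dDZ dDmin dDtr dDA dDJ).
- by rewrite /dA /= subrr; apply: I0.
- by move=> x y ax ay; rewrite /dA /=; have := IB ax ay; congr I; ring.
- by move=> x ax; rewrite /dA /= -barB; apply: Ibar.
- by rewrite /dA /= subrr; apply: I0.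
Defined.

End Double.
End Frames.

(** * Unitary matrices and their elementary generators *)

Section Groups.
Variable G : groupType.
Implicit Types (A X : set G) (g h : G).
Local Open Scope group_scope.

Lemma gen_subgroup X : is_subgroup (generated X).
Proof.
split=> [K [[K1 _ _] _]|g h gg gh K KX|g gg K KX] //.
- by case: (KX) => -[_ KM _] _; apply: KM; [apply: gg|apply: gh].
- by case: (KX) => -[_ _ KV] _; apply: KV; apply: gg.
Qed.

Lemma sub_gen X g : X g -> generated X g.
Proof. by move=> xg K [_ XK]; apply: XK. Qed.

Lemma gen_min X A : is_subgroup A -> (forall g, X g -> A g) ->
  forall g, generated X g -> A g.
Proof. by move=> sA XA g gg; apply: gg; split. Qed.

Lemma normalizedP A (E : set G) : is_subgroup E ->
  (forall e x, E e -> A x -> A (e * x * e^-1)) -> normalized_by E A.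
Proof.
move=> [_ _ EV] H g Eg; apply/seteqP; split=> [_ [x Ax <-]|x Ax]; first exact: H.
exists (g^-1 * x * g); last by rewrite !mulgA mulgV mul1g mulgK.
by have := H _ _ (EV _ Eg) Ax; rewrite invgK.
Qed.

Lemma normalized_conj A (E : set G) e x : normalized_by E A -> E e -> A x ->
  A (e * x * e^-1).
Proof. by move=> H Ee Ax; rewrite -(H e Ee); exists x. Qed.
End Groups.

Section Bridge.
Variables (R : comNzRingType) (F : hermFormRing R) (n : nat).
Notation "x ^!" := (bar F x) (at level 1, format "x ^!").
Notation lam := (lam F).
Notation mu := (mu F).
Notation vec := 'cV[R]_(n.*2.+1).
Notation mat := 'M[R]_(n.*2.+1).
Notation idx := 'I_(n.*2.+1).
Notation o := (th_zero n).
Notation form := (hform F).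
Notation qpol := (hyp_form F).
Notation cc := (gram F).
Notation ev := (@bvec R n).
Notation Tv := (@transv R F n).
Notation G := (GL R n.*2.+1).
Notation point := (qpoint (full F)).
Implicit Types (u v w f p q : vec) (i j k l m : idx) (a x y z s : R) (g : G).

Lemma gl_mxM g g' : gl_mx (g * g')%g = gl_mx g *m gl_mx g'. Proof. by []. Qed.
Lemma gl_mx1 : gl_mx (1%g : G) = 1%:M. Proof. by []. Qed.
Lemma gl_mulV g : gl_mx g *m gl_mx g^-1%g = 1%:M.
Proof. by rewrite -gl_mxM mulgV. Qed.
Lemma gl_Vmul g : gl_mx g^-1%g *m gl_mx g = 1%:M.
Proof. by rewrite -gl_mxM mulVg. Qed.

Lemma gl_ex (M N : mat) : M *m N = 1%:M -> exists g : G, gl_mx g = M.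
Proof.
move=> MN; have NM : N *m M = 1%:M by apply: mulmx1C.
have p : ((M, N).1 *m (M, N).2 == 1%:M) && ((M, N).2 *m (M, N).1 == 1%:M).
  by rewrite /= MN NM !eqxx.
by exists (MkGL p).
Qed.

Lemma form_qE u : form_q F u = (u o 0, qpol u u). Proof. by []. Qed.

Lemma congr_modE (S : set (heis F)) u v : congr_mod S (form_q F u) (form_q F v) <->
  S ((u o 0 - v o 0, qpol u u - qpol v v + ((u o 0)^! - (v o 0)^!) * mu * v o 0) : heis F).
Proof.
rewrite /congr_mod; have -> : (form_q F u * (form_q F v)^-1)%g =
  ((u o 0 - v o 0, qpol u u - qpol v v + ((u o 0)^! - (v o 0)^!) * mu * v o 0) : heis F).
  by rewrite !form_qE; congr pair => /=; ring.
by [].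
Qed.

Lemma UgroupP g : Ugroup F n g <->
  (forall u v, form (gl_mx g *m u) (gl_mx g *m v) = form u v) /\
  (forall u, congr_mod (Delta F) (form_q F (gl_mx g *m u)) (form_q F u)).
Proof.
by split=> -[H1 H2]; split=> // u v; have := H1 u v; rewrite !form_bE.
Qed.

Lemma Ugroup_subgroup : is_subgroup (Ugroup F n).
Proof.
have [[[D1 DM DV] _] _ _] := DeltaP F.
split.
- apply/UgroupP; rewrite gl_mx1; split=> [u v|u]; rewrite !mul1mx //.
  by rewrite /congr_mod mulgV.
- move=> g g' /UgroupP[f1 c1] /UgroupP[f2 c2]; apply/UgroupP; rewrite gl_mxM.
  split=> [u v|u]; rewrite -!mulmxA ?f1 //.
  have := DM _ _ (c1 (gl_mx g' *m u)) (c2 u); rewrite /congr_mod.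
  by rewrite mulgA mulgVK.
- move=> g /UgroupP[f1 c1]; apply/UgroupP; split=> [u v|u].
    by rewrite -f1 !mulmxA gl_mulV !mul1mx.
  have := DV _ (c1 (gl_mx g^-1%g *m u)); rewrite mulmxA gl_mulV mul1mx.
  by rewrite invgM invgK.
Qed.

Lemma U_form g u v : Ugroup F n g -> form (gl_mx g *m u) (gl_mx g *m v) = form u v.
Proof. by case/UgroupP. Qed.

Lemma U_point g u y : Ugroup F n g -> point u y -> point (gl_mx g *m u) y.
Proof.
move=> /UgroupP[_ c] [_ d]; split=> //=; have /congr_modE c' := c u.
apply: (dl_eq (dlD c' d)); first by rewrite subrK.
by rewrite !barE; ring.
Qed.

Lemma Tv_inU e v y g : point e 0 -> point v y -> form e v = 0 -> gl_mx g = Tv e v y ->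
  Ugroup F n g.
Proof.
move=> se vy ev gE; apply/UgroupP; rewrite gE; split=> [u w|u].
  by apply: Tv_iso => //; [apply: point_sing se|apply: point_tr vy].
by apply/congr_modE; case: (Tv_q se vy ev (w := u)).
Qed.

Lemma Tv_gl e v y : form e e = 0 -> form e v = 0 -> exists g : G, gl_mx g = Tv e v y.
Proof. by move=> ee ev; apply: gl_ex; apply: Tv_inv. Qed.

Lemma lam_expE i : th_hb i ->
  lam_exp F ((th_eps (th_opp i) - 1) %/ 2)%Z = cc i * lam^! /\
  lam_exp F ((1 - th_eps i) %/ 2)%Z = cc i /\
  lam_exp F (- ((1 + th_eps i) %/ 2)%Z) = cc i * lam^!.
Proof.
move=> hi; rewrite /th_eps th_pos_opp th_negE // /gram th_negE //.
have e1 : ((-1 - 1 : int) %/ 2)%Z = -1 by [].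
have e2 : ((1 - 1 : int) %/ 2)%Z = 0 by [].
have e3 : ((1 + 1 : int) %/ 2)%Z = 1 by [].
have e4 : ((1 - -1 : int) %/ 2)%Z = 1 by [].
have e5 : ((1 + -1 : int) %/ 2)%Z = 0 by [].
case: (th_pos i); rewrite ?negbK ?e1 ?e2 ?e3 ?e4 ?e5.
  by rewrite mul1r; do !split; rewrite /lam_exp /= ?expr1.
by rewrite lamV oppr0; do !split; rewrite /lam_exp /= ?expr1.
Qed.

Lemma andb_natr (b c : bool) : (b && c)%:R = b%:R * c%:R :> R.
Proof. by rewrite -mulnb natrM. Qed.

Lemma Tshort_Tv i j x : far i j ->
  Tshort F j (th_opp i) (cc i * x) = Tv (ev i) (x *: ev j) 0.
Proof.
move=> f; have [hi hj] := (far_hbl f, far_hbr f).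
have [e1 _] := lam_expE hi; have [_ [e2 _]] := lam_expE hj.
apply/matrixP => r c; rewrite /Tshort e1 e2 !mxE !lformZl !lformE !form_el !evE.
rewrite !eqxx !andbT !andb_natr th_oppK [c == _]eq_sym [c == th_opp j]eq_sym.
by rewrite !barE; ring : (ccV F hi).
Qed.

Lemma Textra_Tv i x y : th_hb i ->
  Textra i ((cc i * x, cc i * y) : heis F) = Tv (ev i) (x *: ev o) y.
Proof.
move=> hi; have [_ [_ e1]] := lam_expE hi.
apply/matrixP => r c; rewrite /Textra e1 !mxE !lformZl !lformE !form_el !evE.
rewrite !eqxx !andbT !andb_natr th_opp_zero cc_zero [c == _]eq_sym [c == o]eq_sym.
by rewrite /= !barE; ring : (ccV F hi).
Qed.

Lemma top_ideal : is_odd_form_ideal F setT (Delta F).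
Proof.
have [sm Dmin Dmax] := DeltaP F.
split=> //.
- move=> _ [a [x _ <-] [b gb <-]]; have [[_ DM _] DZ] := sm; apply: DM.
    by apply: Dmin; exists x.
  apply: gb; split; first by case: sm.
  by move=> _ [d dd [r _ <-]]; apply: DZ.
Qed.

Section Ideal.
Variables (I : set R) (Om : set (heis F)).
Hypothesis IOm : is_odd_form_ideal F I Om.
Notation om := (om Om).

(** The passage between Omega and Omega^-1: conjugating y costs a multiplication by a power
of lam, because tr vanishes. *)
Lemma om_flip x y : om x y -> om (x * lam^!) (y^! * lam).
Proof.
move=> d; have t := dl_tr (om_dl IOm d).
apply: (om_eq (omZ IOm (- lam^!) (omN IOm d))); first by ring.
rewrite !barE; have -> : x^! * mu * x = - y - y^! * lam.
  by rewrite -[RHS]add0r -t; ring.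
by ring : (lamV F).
Qed.

Lemma heis_sgnP i x y : th_hb i ->
  heis_sgn Om (- th_eps i) ((cc i * x, cc i * y) : heis F) <-> om x y^!.
Proof.
move=> hi; rewrite /heis_sgn /th_eps /gram th_negE //.
case: (th_pos i) => /=; first by rewrite !mul1r.
split=> d.
  by apply: (om_eq (om_flip d)); rewrite ?barE; ring : (lamV F).
have := om_flip d; rewrite barK => d'.
by apply: (om_eq (omZ IOm (lam * lam) d')); rewrite ?barE; ring : (lamV F).
Qed.

(** All generators as transvections along basis vectors, uniformly in the signs. *)
Lemma elementaryP g : elementary I Om g <->
  (exists i j x, [/\ far i j, I x & gl_mx g = Tv (ev i) (x *: ev j) 0]) \/
  (exists i x y, [/\ th_hb i, om x y^! & gl_mx g = Tv (ev i) (x *: ev o) y]).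
Proof.
split.
- case=> [[j [k [x [[hj hk jk jk' ix] gE]]]]|[i [[x y] [hi d gE]]]]; [left|right].
    have f : far (th_opp k) j by rewrite far_oppl far_sym /far hj hk jk jk'.
    have hk' := far_hbl f.
    exists (th_opp k), j, ((cc (th_opp k))^! * x); split=> //; first exact: (IMl IOm).
    rewrite gE -Tshort_Tv // th_oppK; congr (Tshort _ _ _ _).
    by ring : (ccV F hk').
  have ex : x = cc i * ((cc i)^! * x) by ring : (ccV F hi).
  have ey : y = cc i * ((cc i)^! * y) by ring : (ccV F hi).
  exists i, ((cc i)^! * x), ((cc i)^! * y); split=> //.
    by apply/(heis_sgnP _ _ hi); rewrite -ex -ey.
  by rewrite gE -Textra_Tv // -ex -ey.
- case=> [[i [j [x [f ix gE]]]]|[i [x [y [hi d gE]]]]]; [left|right].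
    exists j, (th_opp i), (cc i * x); split; last by rewrite gE Tshort_Tv.
    have [e1 e2 e3 e4] := far_neq f; have [hi hj] := (far_hbl f, far_hbr f).
    by split; rewrite ?th_hb_opp ?th_oppK ?e4 ?e2 //; apply: (IMl IOm).
  exists i, ((cc i * x, cc i * y) : heis F); split=> //; last by rewrite Textra_Tv.
  by apply/heis_sgnP.
Qed.

End Ideal.
End Bridge.

(** * Congruence modulo an odd form ideal *)

Section EU.
Variables (R : comNzRingType) (F : hermFormRing R) (n : nat).
Notation vec := 'cV[R]_(n.*2.+1).
Notation mat := 'M[R]_(n.*2.+1).
Notation idx := 'I_(n.*2.+1).
Notation o := (th_zero n).
Notation ev := (@bvec R n).
Notation Tv := (@transv R F n).
Notation G := (GL R n.*2.+1).
Notation point := (qpoint (full F)).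
Notation EU := (EUgroup F n).
Implicit Types (u v w f p q : vec) (i j k l m : idx) (a x y z : R) (g s t : G).

Lemma point_evi i : th_hb i -> point (ev i) 0.
Proof. by move=> hi; rewrite -[ev i]scale1r; apply: point_ev => //; apply: fA1. Qed.

Lemma EU_subgroup : is_subgroup EU. Proof. exact: gen_subgroup. Qed.
Lemma EU1 : EU 1%g. Proof. by case: EU_subgroup. Qed.
Lemma EUM s t : EU s -> EU t -> EU (s * t)%g.
Proof. by case: EU_subgroup => _ H _; apply: H. Qed.
Lemma EUV s : EU s -> EU s^-1%g.
Proof. by case: EU_subgroup => _ _ H; apply: H. Qed.

Definition EUmx (m : mat) := exists2 g : G, EU g & gl_mx g = m.

Lemma EUmx_elem_closed : elem_closed (full F) EUmx.
Proof.
split.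
- by exists 1%g; [apply: EU1|].
- by move=> M N [g eg <-] [g' eg' <-]; exists (g * g')%g; [apply: EUM|].
- move=> i j x f _; have hi := far_hbl f.
  have [g gE] : exists g : G, gl_mx g = Tv (ev i) (x *: ev j) 0.
    by apply: Tv_gl; [apply: form_evev0|rewrite formE form_far // mulr0].
  exists g => //; apply: sub_gen; apply/(elementaryP (top_ideal F)); left.
  by exists i, j, x.
- move=> i x y hi d.
  have [g gE] : exists g : G, gl_mx g = Tv (ev i) (x *: ev o) y.
    by apply: Tv_gl; [apply: form_evev0|rewrite formE form_ev_e0 // mulr0].
  exists g => //; apply: sub_gen; apply/(elementaryP (top_ideal F)); right.
  by exists i, x, y.
Qed.

Lemma EU_mx (M : mat) g : EUmx M -> gl_mx g = M -> EU g.
Proof. by case=> g' eg <- /gl_mx_inj->. Qed.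

Lemma EU_ev i v y g : th_hb i -> point v y -> v (th_opp i) 0 = 0 ->
  gl_mx g = Tv (ev i) v y -> EU g.
Proof. by move=> hi vy vi; apply: EU_mx; apply: (P_ev EUmx_elem_closed). Qed.

Lemma EU_U g : EU g -> Ugroup F n g.
Proof.
apply: gen_min; first exact: Ugroup_subgroup.
move=> {}g /(elementaryP (top_ideal F))[[i [j [x [f _ gE]]]]|[i [x [y [hi d gE]]]]].
- have [hi hj] := (far_hbl f, far_hbr f).
  apply: (Tv_inU (point_evi hi) _ _ gE); first exact: point_ev.
  by rewrite formE form_far // mulr0.
- apply: (Tv_inU (point_evi hi) _ _ gE); first exact: point_e0.
  by rewrite formE form_ev_e0 // mulr0.
Qed.

End EU.

Section Pairs.
Variables (R : comNzRingType) (F : hermFormRing R) (n : nat).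
Notation "x ^!" := (bar F x) (at level 1, format "x ^!").
Notation mu := (mu F).
Notation vec := 'cV[R]_(n.*2.+1).
Notation mat := 'M[R]_(n.*2.+1).
Notation idx := 'I_(n.*2.+1).
Notation o := (th_zero n).
Notation form := (hform F).
Notation lform := (hform_op F).
Notation qpol := (hyp_form F).
Notation ev := (@bvec R n).
Notation ev2 := (@bvec (R * R)%type n).
Notation Tv := (@transv R F n).
Notation Tv2 := (@transv (R * R)%type (pherm F) n).
Notation G := (GL R n.*2.+1).
Notation point := (qpoint (full F)).
Notation EU := (EUgroup F n).
Implicit Types (u v w f p q : vec) (i j k l m : idx) (a x y z : R) (g s t : G).

Definition pv u v : 'cV[R * R]_(n.*2.+1) := \col_i ((u i 0, v i 0) : R * R).

Lemma pair_ext (A B : Type) (x y : A * B) : x.1 = y.1 -> x.2 = y.2 -> x = y.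
Proof. by case: x y => [a b] [c d] /= -> ->. Qed.

Lemma map_fst_pv u v : map_mx fst (pv u v) = u.
Proof. by apply/colP => i; rewrite !mxE. Qed.
Lemma map_snd_pv u v : map_mx snd (pv u v) = v.
Proof. by apply/colP => i; rewrite !mxE. Qed.

Lemma pv_ext (U V : 'cV[R * R]_(n.*2.+1)) :
  map_mx fst U = map_mx fst V -> map_mx snd U = map_mx snd V -> U = V.
Proof.
move=> /colP e1 /colP e2; apply/colP => i; apply: pair_ext.
  by have := e1 i; rewrite !mxE.
by have := e2 i; rewrite !mxE.
Qed.

Lemma pvD u v u' v' : pv (u + u') (v + v') = pv u v + pv u' v'.
Proof. by apply/colP => i; rewrite !mxE. Qed.
Lemma pvZ a b u v : pv (a *: u) (b *: v) = ((a, b) : R * R) *: pv u v.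
Proof. by apply/colP => i; rewrite !mxE. Qed.
Lemma pv_ev i : pv (ev i) (ev i) = ev2 i.
Proof.
by apply/colP => k; rewrite mxE !evE; apply: pair_ext; case: (k == i).
Qed.

Lemma fst_Tv U V Y : map_mx fst (Tv2 U V Y) = Tv (map_mx fst U) (map_mx fst V) Y.1.
Proof. exact: phi_Tv. Qed.
Lemma snd_Tv U V Y : map_mx snd (Tv2 U V Y) = Tv (map_mx snd U) (map_mx snd V) Y.2.
Proof. exact: phi_Tv. Qed.

Lemma Tv_pv u u' v v' y y' w w' :
  Tv2 (pv u u') (pv v v') (y, y') *m pv w w' = pv (Tv u v y *m w) (Tv u' v' y' *m w').
Proof.
by apply: pv_ext; rewrite map_mxM /= ?fst_Tv ?snd_Tv !(map_fst_pv, map_snd_pv).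
Qed.

Lemma qpol_pv u v u' v' : hyp_form (pherm F) (pv u v) (pv u' v') = (qpol u u', qpol v v').
Proof.
apply: pair_ext.
  by rewrite (@phi_qpol _ _ (pherm F) F n fst) // !map_fst_pv.
by rewrite (@phi_qpol _ _ (pherm F) F n snd) // !map_snd_pv.
Qed.

Lemma form_pv u v u' v' : hform (pherm F) (pv u v) (pv u' v') = (form u u', form v v').
Proof.
apply: pair_ext.
  by rewrite (@phi_form _ _ (pherm F) F n fst) // !map_fst_pv.
by rewrite (@phi_form _ _ (pherm F) F n snd) // !map_snd_pv.
Qed.

Lemma lform_pv u v u' v' : hform_op (pherm F) (pv u v) (pv u' v') = (lform u u', lform v v').
Proof. by rewrite !lformU form_pv. Qed.

Section Congruence.
Variables (I : set R) (Om : set (heis F)).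
Hypothesis IOm : is_odd_form_ideal F I Om.
Notation om := (om Om).
Notation point2 := (qpoint (double IOm)).

(** Congruence of points modulo (I, Omega): the pair is a point over R * R. *)
Definition eqv u y v y' := point2 (pv u v) ((y, y') : R * R).

Lemma eqvP u y v y' : eqv u y v y' <->
  [/\ point u y, point v y', forall k, th_hb k -> I (u k 0 - v k 0) &
  om (u o 0 - v o 0) (qpol u u + y^! - (qpol v v + y'^!) +
     ((u o 0)^! - (v o 0)^!) * mu * v o 0)].
Proof.
rewrite /eqv; split.
- case=> hI []; rewrite qpol_pv mxE /= => d1 d2 o; split=> //.
  by move=> k /hI; rewrite mxE.
- case=> [[_ d1] [_ d2] hI o]; split=> [k /hI|]; first by rewrite mxE.
  by rewrite qpol_pv mxE.
Qed.

Lemma eqv_point u y v y' : eqv u y v y' -> point u y /\ point v y'.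
Proof. by case/eqvP. Qed.

Lemma eqv_refl u y : point u y -> eqv u y u y.
Proof.
move=> vy; apply/eqvP; split=> // [k _|]; first by rewrite subrr; apply: I0 IOm.
by apply: (om_eq (om_min IOm (I0 IOm))); rewrite ?bar0; ring.
Qed.

Lemma eqv_sym u y v y' : eqv u y v y' -> eqv v y' u y.
Proof.
move=> /eqvP[v1 v2 hI om1]; apply/eqvP; split=> // [k hk|].
  by rewrite -opprB; apply: (IN IOm); apply: hI.
by apply: (om_eq (omN IOm om1)); rewrite ?barE; ring.
Qed.

Lemma eqv_trans u y v y' w z : eqv u y v y' -> eqv v y' w z -> eqv u y w z.
Proof.
move=> /eqvP[v1 v2 hI om1] /eqvP[_ v3 hI' om2]; apply/eqvP; split=> // [k hk|].
  by have := ID IOm (hI k hk) (hI' k hk); congr I; ring.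
by apply: (om_eq (omD IOm om1 om2)); rewrite ?barE; ring.
Qed.

Lemma eqvD u y v y' u2 y2 v2 y2' : eqv u y v y' -> eqv u2 y2 v2 y2' ->
  eqv (u + u2) (y + y2 - lform u u2) (v + v2) (y' + y2' - lform v v2).
Proof.
move=> e1 e2; rewrite /eqv pvD; apply: (point_eq (pointD e1 e2)) => //.
by rewrite lform_pv.
Qed.

Lemma eqvZ a u y v y' : eqv u y v y' ->
  eqv (a *: u) (y * (a * a^!)) (a *: v) (y' * (a * a^!)).
Proof.
move=> e; rewrite /eqv pvZ; apply: (point_eq (pointZ (a := (a, a)) _ e)) => //.
by rewrite /= /dA subrr; apply: (I0 IOm).
Qed.

Lemma eqv_unit a b u y : I (a - b) -> point u y ->
  eqv (a *: u) (y * (a * a^!)) (b *: u) (y * (b * b^!)).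
Proof.
move=> ia /eqv_refl e; rewrite /eqv pvZ.
by apply: (point_eq (pointZ (a := (a, b)) _ e)).
Qed.

Lemma eqv_unit1 a u y : I (a - 1) -> point u y -> eqv (a *: u) (y * (a * a^!)) u y.
Proof.
move=> ia vy; have := eqv_unit ia vy.
by rewrite scale1r !barE !mulr1.
Qed.

Definition respects (M N : mat) := forall u y v y',
  eqv u y v y' -> eqv (M *m u) y (N *m v) y'.

Lemma respects_mul M N M' N' : respects M N -> respects M' N' -> respects (M *m M') (N *m N').
Proof. by move=> h1 h2 u y v y' e; rewrite -!mulmxA; apply: h1; apply: h2. Qed.

Lemma respects_one : respects 1%:M 1%:M.
Proof. by move=> u y v y' e; rewrite !mul1mx. Qed.

Lemma eqv_evi i : th_hb i -> eqv (ev i) 0 (ev i) 0.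
Proof. by move=> hi; apply: eqv_refl; apply: point_evi. Qed.

Lemma respects_Tv i v y v' y' : th_hb i -> eqv v y v' y' ->
  form (ev i) v = 0 -> form (ev i) v' = 0 -> respects (Tv (ev i) v y) (Tv (ev i) v' y').
Proof.
move=> hi e iv iv' w z w' z' ew.
rewrite /eqv -Tv_pv; apply: Tv_point => //; first exact: eqv_evi.
by rewrite form_pv iv iv'.
Qed.

Notation EUi := (@EUideal R F n I Om).
Notation EUr := (EUrel F n I Om).

Lemma EUi_EU g : EUi g -> EU g.
Proof.
apply: gen_min; first exact: EU_subgroup.
move=> {}g /(elementaryP IOm) gE; apply: sub_gen; apply/(elementaryP (top_ideal F)).
case: gE => [[i [j [x [f _ gE]]]]|[i [x [y [hi d gE]]]]]; [left|right].
  by exists i, j, x.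
by exists i, x, y; split=> //; exact: (om_dl IOm d).
Qed.

Lemma EUr_subgroup : is_subgroup EUr. Proof. exact: gen_subgroup. Qed.
Lemma EUr1 : EUr 1%g. Proof. by case: EUr_subgroup. Qed.
Lemma EUrM s t : EUr s -> EUr t -> EUr (s * t)%g.
Proof. by case: EUr_subgroup => _ H _; apply: H. Qed.
Lemma EUrV s : EUr s -> EUr s^-1%g.
Proof. by case: EUr_subgroup => _ _ H; apply: H. Qed.

Lemma EUr_conj_gen c :
  (forall e t, EU e -> elementary I Om t -> EUr (c * e * t * e^-1 * c^-1)%g) ->
  forall g, EUr g -> EUr (c * g * c^-1)%g.
Proof.
move=> H; apply: gen_min.
  split=> [|g g' h1 h2|g h1].
  - by rewrite mulg1 mulgV; apply: EUr1.
  - by have := EUrM h1 h2; rewrite !mulgA mulgVK.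
  - by have := EUrV h1; rewrite !invgM invgK mulgA.
move=> _ [e Ee [x ix <-]]; move: x ix; apply: gen_min.
  split=> [|g g' h1 h2|g h1].
  - by rewrite mulg1 mulgV mulg1 mulgV; apply: EUr1.
  - by have := EUrM h1 h2; rewrite !mulgA mulgVK mulgVK.
  - by have := EUrV h1; rewrite !invgM !invgK !mulgA.
by move=> t et; rewrite !mulgA; apply: H.
Qed.

Lemma EUr_normal e g : EU e -> EUr g -> EUr (e * g * e^-1)%g.
Proof.
move=> Ee; apply: EUr_conj_gen => e' t Ee' et; apply: sub_gen.
exists (e * e')%g; first exact: EUM.
exists t; first exact: sub_gen.
by rewrite invgM !mulgA.
Qed.

Lemma EUi_EUr g : EUi g -> EUr g.
Proof.
move=> gi; apply: sub_gen; exists 1%g; first exact: EU1.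
by exists g => //; rewrite mul1g invg1 mulg1.
Qed.

Lemma EUr_EU g : EUr g -> EU g.
Proof.
apply: gen_min; first exact: EU_subgroup.
by move=> _ [e Ee [x /EUi_EU xE <-]]; apply: EUM; [apply: EUM|apply: EUV].
Qed.

Definition pairEU (M : 'M[R * R]_(n.*2.+1)) := exists g s,
  [/\ EU s, EUr (g * s^-1)%g, map_mx fst M = gl_mx g & map_mx snd M = gl_mx s].

(** A generator over R * R has components T(e_i; x e_j, 0) and
T(e_i; x' e_j, 0) with x - x' in I, or the analogue with e_0; their quotient is a generator
of EU(I, Omega). Closure under products is normality of the relative group. *)
Lemma pairEU_elem_closed : elem_closed (double IOm) pairEU.
Proof.
split.
- exists 1%g, 1%g; rewrite !map_mx1; split=> //; first exact: EU1.
  by rewrite mulgV; apply: EUr1.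
- move=> M M' [g [s [es r e1 e2]]] [g' [s' [es' r' e1' e2']]].
  exists (g * g')%g, (s * s')%g; rewrite !map_mxM e1 e2 e1' e2'; split=> //.
    exact: EUM.
  have := EUrM r (EUr_normal es r').
  by rewrite invgM !mulgA mulgVK.
- move=> i j [x x'] f /= ax; have [hi hj] := (far_hbl f, far_hbr f).
  have ij (z : R) : form (ev i) (z *: ev j) = 0 by rewrite formE form_far // mulr0.
  have [s sE] := Tv_gl 0 (form_evev0 F hi) (ij x').
  have [t tE] := Tv_gl 0 (form_evev0 F hi) (ij (x - x')).
  exists (t * s)%g, s; rewrite fst_Tv snd_Tv !map_mxZ !phi_ev /= sE mulgK.
  split=> //.
  + apply: (EU_ev hi _ _ sE); first exact: point_ev.
    by rewrite !mxE; have [_ _ _ e] := far_neq f; rewrite eq_sym e mulr0.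
  + apply: EUi_EUr; apply: sub_gen; apply/(elementaryP IOm); left.
    by exists i, j, (x - x').
  + rewrite gl_mxM tE sE Tv_add ?form_evev0 // -scalerDl subrK.
    by congr (Tv _ _ _); rewrite !lfE (lform0 (form_evev0 F hj)); ring.
- move=> i [x x'] [y y'] hi /= [d1 d2 om1]; rewrite /= in d1 d2 om1.
  have i0 (z : R) : form (ev i) (z *: ev o) = 0 by rewrite formE form_ev_e0 // mulr0.
  have [s sE] := Tv_gl y' (form_evev0 F hi) (i0 x').
  pose z := y - y' + lform ((x - x') *: ev o) (x' *: ev o).
  have [t tE] := Tv_gl z (form_evev0 F hi) (i0 (x - x')).
  exists (t * s)%g, s; rewrite fst_Tv snd_Tv !map_mxZ !phi_ev /= sE mulgK.
  split=> //.
  + apply: (EU_ev hi _ _ sE); first exact: point_e0.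
    by rewrite !mxE th_opp_eqC th_opp_zero (negbTE hi) mulr0.
  + apply: EUi_EUr; apply: sub_gen; apply/(elementaryP IOm); right.
    exists i, (x - x'), z; split=> //.
    have iz := om_tilde IOm om1 d2.
    apply: (om_eq (om_min_add IOm om1 iz)) => //.
    rewrite /z barD lformU barK !formE form_el evE th_opp_zero eqxx cc_zero.
    by rewrite !barE /=; ring : (lamV F).
  + rewrite gl_mxM tE sE Tv_add ?form_evev0 // -scalerDl subrK.
    by congr (Tv _ _ _); rewrite /z; ring.
Qed.

End Congruence.
End Pairs.

(** * Normality of the elementary subgroups *)

Section Relative.
Variables (R : comNzRingType) (F : hermFormRing R) (n : nat).
Hypothesis hn : (3 <= n)%N.
Notation "x ^!" := (bar F x) (at level 1, format "x ^!").
Notation vec := 'cV[R]_(n.*2.+1).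
Notation idx := 'I_(n.*2.+1).
Notation o := (th_zero n).
Notation form := (hform F).
Notation lform := (hform_op F).
Notation cc := (gram F).
Notation ev := (@bvec R n).
Notation Tv := (@transv R F n).
Notation G := (GL R n.*2.+1).
Notation point := (qpoint (full F)).
Notation EU := (EUgroup F n).
Notation U := (Ugroup F n).
Implicit Types (u v w f p q : vec) (i j k l m : idx) (a x y z : R) (g s t c : G).

Lemma UV g : U g -> U g^-1%g.
Proof. by case: (Ugroup_subgroup F n) => _ _ H; apply: H. Qed.
Lemma UM g g' : U g -> U g' -> U (g * g')%g.
Proof. by case: (Ugroup_subgroup F n) => _ H _; apply: H. Qed.

Lemma gl_conj_Tv g t e v y : U g -> gl_mx t = Tv e v y ->
  gl_mx (g * t * g^-1)%g = Tv (gl_mx g *m e) (gl_mx g *m v) y.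
Proof.
move=> ug tE; rewrite !gl_mxM tE Tv_conj ?gl_mulV //.
by move=> w w'; apply: U_form.
Qed.

(** Conjugating T_j(x, y) by the matrix that adds e_i to e_j gives
T_i(x, y) T_j(x, y) T(e_i; y e_j, 0) by Tv_split. So T_i is a product of conjugates of the T_ij;
in particular properties of T_i follow from properties of the T_ij. *)
Lemma e0_decomp i j x y : far j i -> exists t1 t2 : G,
  [/\ gl_mx t1 = Tv (ev (th_opp j)) ((cc (th_opp j))^! *: ev i) 0,
      gl_mx t2 = Tv (ev i) (y *: ev j) 0 &
      forall tj t : G, point (x *: ev o) y -> gl_mx tj = Tv (ev j) (x *: ev o) y ->
       gl_mx t = Tv (ev i) (x *: ev o) y ->
       t = (t1 * (tj * (t1^-1 * t2^-1) * tj^-1))%g].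
Proof.
move=> f; have [hj hi] := (far_hbl f, far_hbr f).
have f' : far i j by rewrite far_sym.
have hj' : th_hb (th_opp j) by rewrite th_hb_opp.
have f2 : far (th_opp j) i by rewrite far_oppl.
have [t1 t1E] : exists t1 : G, gl_mx t1 = Tv (ev (th_opp j)) ((cc (th_opp j))^! *: ev i) 0.
  by apply: Tv_gl; [apply: form_evev0|rewrite formE form_far // mulr0].
have [t2 t2E] : exists t2 : G, gl_mx t2 = Tv (ev i) (y *: ev j) 0.
  by apply: Tv_gl; [apply: form_evev0|rewrite formE form_far // mulr0].
exists t1, t2; split=> // tj t vx tjE tE.
have t1U : U t1.
  apply: (Tv_inU (point_evi F hj') _ _ t1E); first exact: point_ev.
  by rewrite formE form_far // mulr0.
have t1j : gl_mx t1 *m ev j = ev j + ev i.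
  rewrite t1E TvE form_el evE th_oppK eqxx mulr1 mul0r scale0r addr0 scalerA ccV //.
  by rewrite scale1r lformZl (lform0 (form_far F f')) mulr0 scale0r subr0.
have t1o : gl_mx t1 *m (x *: ev o) = x *: ev o.
  rewrite t1E TvE !formE form_ev_e0 // !mulr0 !scale0r !addr0.
  by rewrite !lfE (lform0 (form_ev_e0 F hi)) !mulr0 scale0r subr0.
have E := gl_conj_Tv t1U tjE; rewrite t1j t1o in E.
rewrite (Tv_split (form_evev0 F hj) (form_evev0 F hi) (form_far F f)) in E; first last.
- exact: point_tr vx.
- by rewrite formE form_ev_e0 // mulr0.
- by rewrite formE form_ev_e0 // mulr0.
have : (t1 * tj * t1^-1 = t * tj * t2)%g.
  by apply: gl_mx_inj; rewrite E !gl_mxM tE tjE t2E.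
move=> e; have : (t1 * tj * t1^-1 * t2^-1 * tj^-1 = t)%g by rewrite e !mulgK.
by move <-; rewrite !mulgA.
Qed.

Section Congruence.
Variables (I : set R) (Om : set (heis F)).
Hypothesis IOm : is_odd_form_ideal F I Om.
Notation respects := (@respects R F n I Om IOm).
Notation EUr := (EUrel F n I Om).

Lemma EU_respects t : EU t -> respects (gl_mx t) (gl_mx t).
Proof.
pose K : set G := fun t => respects (gl_mx t) (gl_mx t) /\ respects (gl_mx t^-1%g) (gl_mx t^-1%g).
move=> et; suff [] : K t by [].
move: t et; apply: gen_min.
  split=> [|g g' [h1 h2] [h1' h2']|g [h1 h2]].
  - by split; rewrite ?invg1 gl_mx1; apply: respects_one.
  - by split; rewrite ?invgM gl_mxM; apply: respects_mul.
  - by split; rewrite ?invgK.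
have key i v y g : th_hb i -> point v y -> form (ev i) v = 0 ->
    gl_mx g = Tv (ev i) v y -> K g.
  move=> hi vy iv gE; split; first by rewrite gE; apply: respects_Tv => //; apply: eqv_refl.
  have -> : gl_mx g^-1%g = Tv (ev i) (- v) (- y - lform v v).
    have e := Tv_inv y (form_evev0 F hi) iv.
    by rewrite -[LHS]mulmx1 -e -gE mulmxA gl_Vmul mul1mx.
  by apply: respects_Tv; rewrite ?formE ?iv ?oppr0 //; apply: eqv_refl; apply: point_inv.
move=> g /(elementaryP (top_ideal F))[[i [j [x [f _ gE]]]]|[i [x [y [hi d gE]]]]].
- have [hi hj] := (far_hbl f, far_hbr f).
  apply: (key _ _ _ _ hi _ _ gE); first exact: point_ev.
  by rewrite formE form_far // mulr0.
- apply: (key _ _ _ _ hi _ _ gE); first exact: point_e0.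
  by rewrite formE form_ev_e0 // mulr0.
Qed.

(** The conjugates of g by s and of g' by t are elementary and congruent modulo the
relative elementary group. *)
Definition conj_pair s t g g' := EU (t * g' * t^-1)%g /\
  EUr (s * g * s^-1 * (t * g' * t^-1)^-1)%g.

Lemma conj_pair_mul s t g1 g1' g2 g2' : conj_pair s t g1 g1' -> conj_pair s t g2 g2' ->
  conj_pair s t (g1 * g2)%g (g1' * g2')%g.
Proof.
move=> [e1 r1] [e2 r2]; split; first by have := EUM e1 e2; rewrite !mulgA mulgVK.
have := EUrM r1 (EUr_normal e1 r2); congr EUrel.
by rewrite !(invgM, invgK, mulgA, mulgVK, mulgK, mulgV, mulVg, mul1g).
Qed.

Lemma conj_pair_inv s t g g' : conj_pair s t g g' -> conj_pair s t g^-1%g g'^-1%g.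
Proof.
move=> [e r]; split; first by have := EUV e; rewrite !invgM invgK mulgA.
have := EUr_normal (EUV e) (EUrV r); congr EUrel.
by rewrite !(invgM, invgK, mulgA, mulgVK, mulgK, mulgV, mulVg, mul1g).
Qed.

(** P_unimodular over R * R, for the images of e_i and e_j under s and t: the second
components say that EU is normalized by the unitary group. *)
Lemma conj_pair_far s t i j x x' g g' : U s -> U t -> respects (gl_mx s) (gl_mx t) ->
  far i j -> I (x - x') -> gl_mx g = Tv (ev i) (x *: ev j) 0 ->
  gl_mx g' = Tv (ev i) (x' *: ev j) 0 -> conj_pair s t g g'.
Proof.
move=> us ut st f ix gE gE'; have [hi hj] := (far_hbl f, far_hbr f).
have hi' : th_hb (th_opp i) by rewrite th_hb_opp.
pose X := pv (gl_mx s *m ev i) (gl_mx t *m ev i).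
pose Y := pv (gl_mx s *m ev j) (gl_mx t *m ev j).
have v0 k : th_hb k ->
    qpoint (double IOm) (pv (gl_mx s *m ev k) (gl_mx t *m ev k)) ((0, 0) : R * R).
  by move=> hk; apply: st; apply: eqv_evi.
have gd : uni_pair (double IOm) X Y.
  split; [exact: v0|exact: v0|by rewrite form_pv !U_form // form_far|].
  exists (((cc i)^!, (cc i)^!) *: pv (gl_mx s *m ev (th_opp i)) (gl_mx t *m ev (th_opp i))).
    apply: nvecZ; last by apply: point_nvec (v0 _ hi').
    by rewrite /= /dA subrr; apply: (I0 IOm).
  by rewrite formZr form_pv !U_form // form_evopp; apply: pair_ext; rewrite /= mulrC ccV.
have [c [d [ed rd e1 e2]]] := P_unimodular hn (pairEU_elem_closed n IOm) gd (x := (x, x')) ix.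
have cE : (c = s * g * s^-1)%g.
  apply: gl_mx_inj; rewrite (gl_conj_Tv us gE) -e1 fst_Tv map_mxZ !map_fst_pv /=.
  by rewrite scalemxAr.
have dE : (d = t * g' * t^-1)%g.
  apply: gl_mx_inj; rewrite (gl_conj_Tv ut gE') -e2 snd_Tv map_mxZ !map_snd_pv /=.
  by rewrite scalemxAr.
by split; rewrite -?cE -dE.
Qed.

(** On generators T_ij this is conj_pair_far; e0_decomp reduces T_i to them. *)
Lemma conj_pair_EU g : EU g -> forall s t, U s -> U t -> respects (gl_mx s) (gl_mx t) -> conj_pair s t g g.
Proof.
move=> eg; apply: (gen_min _ _ eg (A := fun g => forall s t, U s -> U t ->
  respects (gl_mx s) (gl_mx t) -> conj_pair s t g g)).
  split=> [s t _ _ _|g1 g2 h1 h2 s t us ut st|g1 h1 s t us ut st].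
  - by split; rewrite !mulg1 !mulgV ?invg1 ?mulg1; [apply: EU1|apply: EUr1].
  - by apply: conj_pair_mul; [apply: h1|apply: h2].
  - by apply: conj_pair_inv; apply: h1.
have far_case i j x g' s t : far i j -> gl_mx g' = Tv (ev i) (x *: ev j) 0 ->
    U s -> U t -> respects (gl_mx s) (gl_mx t) -> conj_pair s t g' g'.
  move=> f gE us ut st; apply: (conj_pair_far us ut st f _ gE gE).
  by rewrite subrr; apply: (I0 IOm).
move=> {eg}g /(elementaryP (top_ideal F))[[i [j [x [f _ gE]]]]|[i [x [y [hi d gE]]]]] s t us ut st.
  exact: far_case f gE us ut st.
have [j [f _]] := far_ex hn hi hi; have hj := far_hbl f.
have [t1 [t2 [t1E t2E te]]] := e0_decomp x y f.
have j0 : form (ev j) (x *: ev o) = 0 by rewrite formE form_ev_e0 // mulr0.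
have [tj tjE] := Tv_gl y (form_evev0 F hj) j0.
have vx : point (x *: ev o) y by apply: point_e0.
have tjEU : EU tj.
  apply: (EU_ev hj vx _ tjE).
  by rewrite !mxE th_opp_eqC th_opp_zero (negbTE hj) mulr0.
rewrite (te _ _ vx tjE gE).
have f' : far (th_opp j) i by rewrite far_oppl.
have f'' : far i j by rewrite far_sym.
apply: conj_pair_mul; first exact: far_case f' t1E us ut st.
have [us' ut'] := (UM us (EU_U tjEU), UM ut (EU_U tjEU)).
have st' : respects (gl_mx (s * tj)%g) (gl_mx (t * tj)%g).
  by rewrite !gl_mxM; apply: respects_mul => //; apply: EU_respects.
have := conj_pair_mul (conj_pair_inv (far_case _ _ _ _ _ _ f' t1E us' ut' st'))
             (conj_pair_inv (far_case _ _ _ _ _ _ f'' t2E us' ut' st')).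
by rewrite /conj_pair !invgM !mulgA.
Qed.

(** On T_ij(x), x in I, compare its conjugate with that of T_ij(0) = 1. For T_i(d), d in Omega,
note that T_j(d) acts on points modulo (I, Omega) as the identity; by e0_decomp, T_i(d) is
a commutator with T_j(d), up to a conjugate of T_ij(y) with y in I. *)
Lemma conj_elementary g c : elementary I Om g -> U c -> respects (gl_mx c) (gl_mx c) ->
  EUr (c * g * c^-1)%g.
Proof.
have far0 i j x g' s t : far i j -> I x -> gl_mx g' = Tv (ev i) (x *: ev j) 0 ->
    U s -> U t -> respects (gl_mx s) (gl_mx t) -> conj_pair s t g' 1%g.
  move=> f ix gE us ut st; apply: (conj_pair_far us ut st f (x' := 0) _ gE).
    by rewrite subr0.
  by rewrite scale0r Tv0.
case/(elementaryP IOm)=> [[i [j [x [f ix gE]]]]|[i [x [y [hi d gE]]]]] uc ccD.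
  by have [_] := far0 _ _ _ _ _ _ f ix gE uc uc ccD; rewrite mulg1 mulgV invg1 mulg1.
have [j [f _]] := far_ex hn hi hi; have hj := far_hbl f.
have [t1 [t2 [t1E t2E te]]] := e0_decomp x y f.
have j0 : form (ev j) (x *: ev o) = 0 by rewrite formE form_ev_e0 // mulr0.
have [tj tjE] := Tv_gl y (form_evev0 F hj) j0.
have vx : point (x *: ev o) y by apply: point_e0; apply: (om_dl IOm d).
have tjEU : EU tj.
  apply: (EU_ev hj vx _ tjE).
  by rewrite !mxE th_opp_eqC th_opp_zero (negbTE hj) mulr0.
rewrite (te _ _ vx tjE gE).
have f' : far (th_opp j) i by rewrite far_oppl.
have f'' : far i j by rewrite far_sym.
have hj' : th_hb (th_opp j) by rewrite th_hb_opp.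
have iy : I y by rewrite -(barK F y); apply: (Ibar IOm); apply: (om_I IOm d).
have tjD : respects (gl_mx tj) 1%:M.
  rewrite tjE -(Tv0 F (ev j)); apply: respects_Tv; rewrite ?form0r //.
  apply/eqvP; split=> //.
  - exact: point0.
  - by move=> k hk; rewrite !mxE (negbTE hk) mulr0 subrr; apply: (I0 IOm).
  - apply: (om_eq d); first by rewrite !mxE !eqxx mulr1 subr0.
    rewrite !mxE !eqxx qpol_e0 mulr0 barE.
    by rewrite -(scale0r (ev o)) qpol_e0; ring.
have uctj := UM uc (EU_U tjEU).
have cD : respects (gl_mx (c * tj)%g) (gl_mx c).
  by rewrite gl_mxM -[gl_mx c as X in respects _ X]mulmx1; apply: respects_mul.
have t1EU : EU t1.
  apply: (EU_ev hj' _ _ t1E); first exact: point_ev.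
  by rewrite !mxE th_oppK; have [_ e _ _] := far_neq f''; rewrite e mulr0.
have [e1 _] := conj_pair_EU t1EU uc uc ccD.
have [_ r] := conj_pair_mul (conj_pair_inv (conj_pair_EU t1EU uctj uc cD)) (conj_pair_inv (far0 _ _ _ _ _ _ f'' iy t2E uctj uc cD)).
have := EUr_normal e1 r; congr EUrel.
by rewrite !(invgM, invgK, mulgA, mulgVK, mulgK, mulgV, mulVg, mul1g, mulg1, invg1).
Qed.

(** The matrix c need not be elementary: P_unimodular replaces the explicit formulas for
conjugates of generators. *)
Lemma respects_normalizes c : U c -> respects (gl_mx c) (gl_mx c) ->
  forall g, EUr g -> EUr (c * g * c^-1)%g.
Proof.
move=> uc ccD; apply: EUr_conj_gen => // e t Ee et.
have := conj_elementary et (UM uc (EU_U Ee)) (c := (c * e)%g).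
by rewrite invgM !mulgA; apply; rewrite gl_mxM; apply: respects_mul => //; apply: EU_respects.
Qed.

End Congruence.
End Relative.

(** * Principal congruence subgroups and scalar action *)

Section ThreeSubgroups.
Variables (G : groupType) (N : set G).
Local Open Scope group_scope.
Implicit Types x y z g : G.
Hypothesis sN : is_subgroup N.

Definition normalizes g := forall x, N x -> N (g * x * g^-1).

Let N1 : N 1. Proof. by case: sN. Qed.
Let NM x y : N x -> N y -> N (x * y). Proof. by case: sN => _ H _; apply: H. Qed.
Let NV x : N x -> N x^-1. Proof. by case: sN => _ _ H; apply: H. Qed.

Lemma comm_mulr x y z : normalizes y -> N (commutator x y) -> N (commutator x z) ->
  N (commutator x (y * z)).
Proof.
move=> ny xy xz; have := NM xy (ny _ xz); congr N; rewrite /commutator.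
by rewrite !(invgM, invgK, mulgA, mulgVK, mulgK, mulgV, mulVg, mul1g).
Qed.

Lemma comm_invr x y : normalizes y^-1 -> N (commutator x y) -> N (commutator x y^-1).
Proof.
move=> ny xy; have := ny _ (NV xy); congr N; rewrite /commutator.
by rewrite !(invgM, invgK, mulgA, mulgVK, mulgK, mulgV, mulVg, mul1g).
Qed.

Lemma comm_sym x y : N (commutator x y) -> N (commutator y x).
Proof.
move=> xy; have := NV xy; congr N; rewrite /commutator.
by rewrite !(invgM, invgK, mulgA).
Qed.

(** If conjugation by c multiplies t1 and t2 by r1 and r2, then the commutator of c with
[t1, t2] compares [r1 t1, r2 t2] with [t1, t2]; expanding it, every factor is a conjugate of
some [ri, tj] or of [r1, r2]. *)
Lemma comm_comm c t1 t2 r1 r2 :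
  c * t1 * c^-1 = r1 * t1 -> c * t2 * c^-1 = r2 * t2 ->
  normalizes r1 -> normalizes r2 -> normalizes t1 -> normalizes t2 -> normalizes t1^-1 -> normalizes t2^-1 -> normalizes r1^-1 -> normalizes r2^-1 ->
  N (commutator r1 t1) -> N (commutator r1 t2) -> N (commutator r2 t1) ->
  N (commutator r2 t2) -> N (commutator r1 (c * t2 * c^-1)) ->
  N (commutator c (commutator t1 t2)).
Proof.
move=> e1 e2 nr1 nr2 nt1 nt2 nt1' nt2' nr1' nr2' c11 c12 c21 c22 c12'.
have r12 : N (commutator r1 r2).
  have -> : r2 = c * t2 * c^-1 * t2^-1 by rewrite e2 mulgK.
  apply: comm_mulr => //; last exact: comm_invr.
  by rewrite e2 => x nx; rewrite !(invgM, mulgA) -!(mulgA r2) ; have := nr2 _ (nt2 _ nx); rewrite !mulgA.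
have eq : commutator c (commutator t1 t2) =
   commutator (r1 * t1) (r2 * t2) * (commutator t1 t2)^-1.
  rewrite -e1 -e2 /commutator.
  by rewrite !(invgM, invgK, mulgA, mulgVK, mulgK, mulgV, mulVg, mul1g).
rewrite eq.
have a1 : N (commutator t1 (r2 * t2) * (commutator t1 t2)^-1).
  have -> : commutator t1 (r2 * t2) * (commutator t1 t2)^-1 =
    commutator t1 r2 * (r2 * commutator t1 t2 * r2^-1 * (commutator t1 t2)^-1).
    by rewrite /commutator !(invgM, invgK, mulgA, mulgVK, mulgK, mulgV, mulVg, mul1g).
  apply: NM; first exact: comm_sym.
  rewrite {2}/commutator -[_ * _ * _ * _^-1]/(commutator r2 (t1 * t2 * t1^-1 * t2^-1)).
  apply: comm_mulr; last exact: comm_invr.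
    by move=> x nx; have := nt1 _ (nt2 _ (nt1' _ nx)); rewrite !invgM !invgK !mulgA.
  apply: comm_mulr; last exact: comm_invr.
    by move=> x nx; have := nt1 _ (nt2 _ nx); rewrite !invgM !mulgA.
  exact: comm_mulr.
have a2 : N (commutator r1 (r2 * t2)) by apply: comm_mulr.
have nK : normalizes (commutator t1 t2).
  move=> x nx; have := nt1 _ (nt2 _ (nt1' _ (nt2' _ nx))).
  by rewrite /commutator !(invgM, invgK, mulgA).
have a3 : N (commutator r1 (commutator t1 t2)).
  rewrite {2}/commutator; apply: comm_mulr; last exact: comm_invr.
    by move=> x nx; have := nt1 _ (nt2 _ (nt1' _ nx)); rewrite !invgM !invgK !mulgA.
  apply: comm_mulr; last exact: comm_invr.
    by move=> x nx; have := nt1 _ (nt2 _ nx); rewrite !invgM !mulgA.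
  exact: comm_mulr.
have := NM (NM (nr1 _ a1) a3) (nK _ a2); congr N.
rewrite /commutator.
by rewrite !(invgM, invgK, mulgA, mulgVK, mulgK, mulgV, mulVg, mul1g).
Qed.
End ThreeSubgroups.

Section Relative.
Variables (R : comNzRingType) (F : hermFormRing R) (n : nat).
Hypothesis hn : (3 <= n)%N.
Notation "x ^!" := (bar F x) (at level 1, format "x ^!").
Notation lam := (lam F).
Notation mu := (mu F).
Notation vec := 'cV[R]_(n.*2.+1).
Notation mat := 'M[R]_(n.*2.+1).
Notation idx := 'I_(n.*2.+1).
Notation o := (th_zero n).
Notation form := (hform F).
Notation lform := (hform_op F).
Notation qpol := (hyp_form F).
Notation cc := (gram F).
Notation ev := (@bvec R n).
Notation Tv := (@transv R F n).
Notation G := (GL R n.*2.+1).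
Notation point := (qpoint (full F)).
Notation EU := (EUgroup F n).
Notation U := (Ugroup F n).
Implicit Types (u v w f p q : vec) (i j k l m : idx) (a x y z : R) (g s t c : G).
Variables (I : set R) (Om : set (heis F)).
Hypothesis IOm : is_odd_form_ideal F I Om.
Notation eqv := (@eqv R F n I Om IOm).
Notation respects := (@respects R F n I Om IOm).
Notation EUr := (EUrel F n I Om).
Notation Ur := (Urel F n I Om).

Lemma mx_entry (M : mat) i j : M i j = (M *m ev j) i 0.
Proof. by rewrite -colE mxE. Qed.

Lemma mulmx_coord (M : mat) u k : (M *m u) k 0 = \sum_j M k j * u j 0.
Proof. by rewrite mxE. Qed.

Lemma one_entry i j : (1%:M : mat) i j = ev j i 0.
Proof. by rewrite evE mxE. Qed.

(** The definition of U((R,Delta),(I,Omega)) controls q only on vectors with odd coordinate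
in J(Delta), and these are the vectors of points; the congruence of the odd column of g
follows by pairing with g^-1 e_-k. *)
Lemma Urel_point g : Ur g -> forall u y, point u y -> eqv (gl_mx g *m u) y u y.
Proof.
move=> [ug ghb gq] u y vy.
have MD (w : vec) : point w 0 \/ (exists y, point w y) -> congr_mod Om (form_q F (gl_mx g *m w)) (form_q F w).
  by case=> [[_ d]|[z [_ d]]]; apply: gq; eexists; apply: d.
apply/eqvP; split=> //; first exact: U_point; last first.
  have /congr_modE d : congr_mod Om (form_q F (gl_mx g *m u)) (form_q F u).
    by apply: MD; right; exists y.
  by apply: (om_eq d) => //; ring.
move=> k hk.
have hk' : th_hb (th_opp k) by rewrite th_hb_opp.
rewrite mulmx_coord.
have -> : u k 0 = \sum_j (1%:M : mat) k j * u j 0 by rewrite -mulmx_coord mul1mx.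
rewrite -sumrB; apply: (big_ind I); [exact: (I0 IOm)|exact: (ID IOm)|].
move=> j _; rewrite -mulrBl; case: (boolP (th_hb j)) => hj.
  by apply: (IMr IOm); apply: ghb.
rewrite /th_hb negbK in hj; rewrite (eqP hj) {j hj}.
rewrite one_entry evE (negbTE hk) subr0 mx_entry.
pose w := gl_mx g^-1%g *m ev (th_opp k).
have gw : gl_mx g *m w = ev (th_opp k) by rewrite mulmxA gl_mulV mul1mx.
have vw : point w 0 by apply: U_point; [apply: UV|apply: point_evi].
have /congr_modE := MD w (or_introl vw); rewrite gw evE eq_sym (negbTE hk') sub0r => d.
have := om_tildeC IOm d (vy.2 : dl F _ _).
have e : form (ev (th_opp k)) (gl_mx g *m ev o) = (w o 0)^! * mu.
  by rewrite -gw U_form // form_er th_opp_zero cc_zero.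
rewrite form_el th_oppK in e.
move/(IMl IOm (- (cc (th_opp k))^!)); congr I.
have := ccV F hk'; set c := cc _ in e *; move=> e1.
by rewrite barN; transitivity (c^! * ((w o 0)^! * mu) * u o 0); [ring|rewrite -e; ring : e1].
Qed.

(** So U((R,Delta),(I,Omega)) is the group of isometries that act trivially on points
modulo (I, Omega). *)
Lemma point_Urel g : U g -> (forall u y, point u y -> eqv (gl_mx g *m u) y u y) -> Ur g.
Proof.
move=> ug H; split=> //.
- move=> i j hi hj; rewrite one_entry mx_entry.
  by have /eqvP[_ _ hI _] := H _ _ (point_evi F hj); apply: hI.
- move=> u [z d]; apply/congr_modE.
  have vz : point u (z - qpol u u)^! by split=> //=; rewrite barK addrC subrK.
  by have /eqvP[_ _ _ o1] := H _ _ vz; apply: (om_eq o1) => //; ring.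
Qed.

Lemma Urel_respects g : Ur g -> respects (gl_mx g) 1%:M.
Proof.
move=> rg u y v y' e; rewrite mul1mx; apply: (eqv_trans _ e).
by apply: Urel_point => //; case: (eqv_point e).
Qed.

(** g is congruent to 1 as a map on points, so conj_pair_EU compares the conjugates of t by
g and by 1. *)
Lemma Urel_comm g t : Ur g -> EU t -> EUr (commutator g t).
Proof.
move=> rg et; have ug : U g by case: rg.
have U1 : U 1%g by case: (Ugroup_subgroup F n).
have [_] := conj_pair_EU hn et ug U1 (Urel_respects rg).
by rewrite mul1g invg1 mulg1 /commutator.
Qed.

Definition scalar_on a (M : mat) := forall u y, point u y -> eqv (M *m u) y (a *: u) (y * (a * a^!)).

Lemma scalar_on_respects a c : scalar_on a (gl_mx c) -> respects (gl_mx c) (gl_mx c).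
Proof.
move=> sa u y v y' e; have [vu vv] := eqv_point e.
apply: (eqv_trans (sa _ _ vu)); apply: (eqv_trans (eqvZ a e)).
by apply: eqv_sym; apply: sa.
Qed.

(** Points are generated by the e_j and by points with odd coordinate x; the latter are
obtained from the images of e_-i under the matrices T_i(x, y). *)
Lemma scalar_on_basis a c : U c ->
  (forall j, th_hb j -> eqv (gl_mx c *m ev j) 0 (a *: ev j) 0) ->
  (forall i x y t, th_hb i -> dl F x y^! -> gl_mx t = Tv (ev i) (x *: ev o) y ->
     eqv (gl_mx c *m (gl_mx t *m ev (th_opp i))) 0 (a *: (gl_mx t *m ev (th_opp i))) 0) ->
  scalar_on a (gl_mx c).
Proof.
move=> uc hb1 hb2.
pose K u y := eqv (gl_mx c *m u) y (a *: u) (y * (a * a^!)).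
have Kadd u y u' y' : K u y -> K u' y' -> K (u + u') (y + y' - lform u u').
  move=> k1 k2; have := eqvD k1 k2; rewrite /K mulmxDr scalerDr; congr eqv.
    by rewrite lformU U_form // -lformU.
  by rewrite !lfE; ring.
have Kev j x : th_hb j -> K (x *: ev j) 0.
  move=> hj; have := eqvZ x (hb1 j hj); rewrite /K !mul0r scalemxAr.
  by rewrite !scalerA mulrC.
move=> u y vy; apply: (@point_ind _ _ (full F) n K pred0) => //.
  by move=> j x hj _ _; apply: Kev.
move=> {u vy}x {}y d.
have n0 : (0 < n.*2.+1)%N by [].
pose i : idx := Ordinal n0.
have pi : th_pos i by rewrite /th_pos /=; lia.
have hi : th_hb i by rewrite th_hbE pi.
have hi' : th_hb (th_opp i) by rewrite th_hb_opp.
have ci : cc i = 1 by rewrite /gram pi.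
have ci' : cc (th_opp i) = lam by rewrite cc_opp // ci bar1 mulr1.
have i0 : form (ev i) (x *: ev o) = 0 by rewrite formE form_ev_e0 // mulr0.
have [t tE] := Tv_gl y (form_evev0 F hi) i0.
have te : gl_mx t *m ev (th_opp i) = x *: ev o + ev (th_opp i) + y *: ev i.
  rewrite tE TvE form_evopp ci scale1r mulr1 lformZl (lform0 (form_e0_ev F hi')).
  by rewrite mulr0 scale0r subr0; congr (_ + _); rewrite addrC.
have k0 : K (x *: ev o + ev (th_opp i) + y *: ev i) 0.
  by rewrite /K -te mul0r; apply: hb2 hi d tE.
have := Kadd _ _ _ _ (Kadd _ _ _ _ k0 (Kev i (- y) hi)) (Kev _ (- 1) hi').
congr K; first by apply/colP => k; rewrite !mxE; ring.
rewrite !lfE !(lform0 (form_e0_ev F hi)) (lform0 (form_e0_ev F hi')).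
rewrite !(lform0 (form_evev0 F _)) //.
rewrite !lformE form_evopp form_el evE th_oppK eqxx ci ci' /=.
by rewrite barN; ring : (lamV F).
Qed.

End Relative.

(** * Commutators with the elementary subgroup *)

Section Sandwich.
Variables (R : comNzRingType) (F : hermFormRing R) (n : nat).
Hypothesis hn : (3 <= n)%N.
Notation "x ^!" := (bar F x) (at level 1, format "x ^!").
Notation lam := (lam F).
Notation vec := 'cV[R]_(n.*2.+1).
Notation idx := 'I_(n.*2.+1).
Notation o := (th_zero n).
Notation form := (hform F).
Notation lform := (hform_op F).
Notation qpol := (hyp_form F).
Notation cc := (gram F).
Notation ev := (@bvec R n).
Notation Tv := (@transv R F n).
Notation G := (GL R n.*2.+1).
Notation point := (qpoint (full F)).
Notation EU := (EUgroup F n).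
Notation U := (Ugroup F n).
Implicit Types (u v w f p q : vec) (i j k l m : idx) (a x y z : R) (g s t c : G).

(** The coefficient with which the matrix that adds e_i to e_j subtracts e_-j from e_-i. *)
Definition shift_coef i j : R := locked_with form_key (cc (th_opp j) * cc i * lam^!).

Lemma shift_coefU i j : shift_coef i j = cc (th_opp j) * cc i * lam^!.
Proof. by rewrite /shift_coef unlock. Qed.

Lemma shift_ex i j x : far i j -> exists t : G,
  [/\ EU t, gl_mx t = Tv (ev (th_opp j)) ((x * (cc (th_opp j))^!) *: ev i) 0 &
    forall v, gl_mx t *m v = v + (x * v j 0) *: ev i
                     - (x^! * shift_coef i j * v (th_opp i) 0) *: ev (th_opp j)].
Proof.
move=> f; have [hi hj] := (far_hbl f, far_hbr f).
have hj' : th_hb (th_opp j) by rewrite th_hb_opp.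
have f' : far (th_opp j) i by rewrite far_oppl far_sym.
pose y := x * (cc (th_opp j))^!.
have [t tE] : exists t : G, gl_mx t = Tv (ev (th_opp j)) (y *: ev i) 0.
  by apply: Tv_gl; [apply: form_evev0|rewrite formE form_far // mulr0].
exists t; split=> //.
  apply: (EU_ev hj' _ _ tE); first exact: point_ev.
  by rewrite !mxE th_oppK; have [_ e _ _] := far_neq f; rewrite e mulr0.
move=> v; rewrite tE TvE form_el th_oppK lformZl lformE form_el mul0r scale0r addr0.
rewrite /y shift_coefU !barE scalerA; congr (_ + _ *: _ - _ *: _); last by ring.
by ring : (ccV F hj').
Qed.

Lemma qpol_r0 v x : qpol v (x *: ev o) = 0.
Proof.
apply: big1 => i pi; rewrite !mxE eqxx andbT th_opp_eqC th_opp_zero.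
have hi : th_hb i by rewrite th_hbE pi.
by rewrite (negbTE hi) /= !mulr0.
Qed.

Section Congruence.
Variables (I : set R) (Om : set (heis F)).
Hypothesis IOm : is_odd_form_ideal F I Om.
Notation eqv := (@eqv R F n I Om IOm).
Notation EUr := (EUrel F n I Om).
Notation Ur := (Urel F n I Om).
Notation CU := (CUrel F n I Om).

(** A point with all hyperbolic coordinates but one in I is congruent to its part on that
coordinate and on e_0; the second component records q(v). *)
Lemma eqv_hb v j a : point v 0 -> th_hb j -> I (v j 0 - a) ->
  (forall k, th_hb k -> k != j -> I (v k 0)) ->
  eqv v 0 (a *: ev j + v o 0 *: ev o) (qpol v v)^!.
Proof.
move=> sv hj ia ik.
have q0 : qpol (a *: ev j + v o 0 *: ev o) (a *: ev j + v o 0 *: ev o) = 0.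
  by rewrite qpolDl !qpolDr qpol_ev // !qpol_e0 qpol_r0 !addr0.
have z0 : (a *: ev j + v o 0 *: ev o) o 0 = v o 0.
  by rewrite !mxE !eqxx eq_sym (negbTE hj) mulr0 add0r mulr1.
apply/eqvP; split=> //.
- split=> //=; rewrite q0 z0 barK add0r.
  by case: sv => _; rewrite barE addr0.
- move=> k hk; rewrite !mxE (negbTE hk) !eqxx !andbT mulr0 addr0.
  case: (eqVneq k j) => [->|ne]; first by rewrite mulr1.
  by rewrite mulr0 subr0; apply: ik.
- rewrite z0 q0; apply: (om_eq (om_min IOm (I0 IOm))); first by rewrite subrr.
  by rewrite !barE; ring.
Qed.

Lemma eqv_min u y v y' z : I z -> eqv u y v y' -> eqv u y v (y' + (z - z^! * lam^!)).
Proof.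
move=> iz e; apply: (point_eq (point_min (x := (0, z)) _ e)) => //.
  by rewrite /= /dA /= sub0r; apply: (IN IOm).
by apply: pair_ext; rewrite /= ?barE; ring.
Qed.

Section Commute.
Variable c : G.
Hypothesis uc : U c.
Hypothesis comc : forall t, EU t -> Ur (commutator c t).
Notation M := (gl_mx c).

Lemma comm_point t u y : EU t -> point u y ->
  eqv (M *m (gl_mx t *m u)) y (gl_mx t *m (M *m u)) y.
Proof.
move=> et vy; have vtc : point (gl_mx t *m (M *m u)) y.
  by apply: U_point; [apply: EU_U|apply: U_point].
have := Urel_point IOm (comc et) vtc; rewrite !mulmxA -!gl_mxM /commutator.
by rewrite !mulgVK.
Qed.

(** Compare c t e_j and t c e_j for a shift t, with t e_j = e_j + e_i. *)
Lemma comm_entry i j k : far i j -> th_hb k ->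
  I ((M *m ev i) k 0 - (k == i)%:R * (M *m ev j) j 0
     + (k == th_opp j)%:R * (shift_coef i j * (M *m ev j) (th_opp i) 0)).
Proof.
move=> f hk; have [t [et _ tE]] := shift_ex 1 f.
have [hi hj] := (far_hbl f, far_hbr f).
have /eqvP[_ _ hI _] := comm_point et (point_evi F hj).
have := hI k hk; rewrite !tE mulmxBr mulmxDr -!scalemxAr !evE eqxx.
have [_ _ e _] := far_neq f; rewrite th_opp_eqC e /= mulr0 scale0r subr0 mulr1 scale1r.
by congr I; rewrite !mxE !eqxx !andbT !barE; ring.
Qed.

Lemma comm_offdiag i k : th_hb i -> th_hb k -> k != i -> I ((M *m ev i) k 0).
Proof.
move=> hi hk ne.
have key j : far i j -> (k == th_opp j) = false -> I ((M *m ev i) k 0).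
  move=> f e; have := comm_entry f hk; rewrite e (negbTE ne) /=.
  by congr I; ring.
case: (hb_cases hk hi) => [e|e|f]; first by rewrite e eqxx in ne.
- have [j [f _]] := far_ex hn hi hi; apply: (key j); first by rewrite far_sym.
  by rewrite e eq_th_opp; have [_ e' _ _] := far_neq f.
- by apply: (key k); [rewrite far_sym|apply: th_hb_neq].
Qed.

Lemma comm_diag i j : far i j -> I ((M *m ev i) i 0 - (M *m ev j) j 0).
Proof.
move=> f; have := comm_entry f (far_hbl f).
have [_ _ e _] := far_neq f; rewrite e eqxx /=.
by congr I; ring.
Qed.

Lemma comm_scal : exists a, forall i, th_hb i -> I ((M *m ev i) i 0 - a).
Proof.
have n0 : (0 < n.*2.+1)%N by [].
pose i0 : idx := Ordinal n0.
have h0 : th_hb i0 by rewrite th_hbE /th_pos /=; apply/orP; left; lia.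
exists ((M *m ev i0) i0 0) => i hi.
have [j [f1 f2]] := far_ex hn hi h0.
rewrite far_sym in f1.
by have := ID IOm (comm_diag f1) (comm_diag f2); congr I; ring.
Qed.

(** An isometry that commutes with EU modulo the congruence subgroup acts as a scalar: its
columns are determined by comm_entry up to the odd coordinate, and this one is
recovered from c (t e_j - e_j) for a shift t, which is congruent to a e_i. *)
Lemma comm_scalar_on : exists a, scalar_on IOm a M.
Proof.
have [a ia] := comm_scal; exists a.
have hb1 i : th_hb i -> eqv (M *m ev i) 0 (a *: ev i) 0.
  move=> hi; have [j [f _]] := far_ex hn hi hi; rewrite far_sym in f.
  have hj := far_hbr f; have [t [et _ tE]] := shift_ex 1 f.
  pose v := M *m ev j.
  have sv : point v 0 by apply: U_point => //; apply: point_evi.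
  have ev0 := eqv_hb sv hj (ia j hj) (fun k hk ne => comm_offdiag hj hk ne).
  have [v' v'E] : exists v', v' = a *: ev j + v o 0 *: ev o by eexists.
  rewrite -v'E in ev0.
  have e1 := EU_respects et ev0.
  have [_ _ e3 e4] := far_neq f.
  have tv' : gl_mx t *m v' = v' + a *: ev i.
    rewrite tE mul1r v'E !mxE !eqxx !andbT (negbTE hj) th_opp_eqC e3 th_opp_eqC th_opp_zero.
    have hi' := hi; rewrite /th_hb in hi'; rewrite (negbTE hi') /=.
    by rewrite !mulr0 !addr0 mulr1 !mulr0 scale0r subr0.
  have tj : gl_mx t *m ev j = ev j + ev i.
    rewrite tE !evE eqxx th_opp_eqC e3 /= !mulr1 scale1r mulr0 scale0r subr0.
    by [].
  have e2 := comm_point et (point_evi F hj); rewrite tj mulmxDr -/v in e2.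
  have e5 := eqv_trans e2 e1; rewrite tv' in e5.
  have e6 := eqvD e5 (eqvZ (- 1) ev0).
  have zj : lform v v = 0 by apply: lform0; rewrite U_form // form_evev0.
  have zij : lform (M *m ev i) v = 0 by apply: lform0; rewrite U_form // form_far.
  have ziv' : lform (ev i) v' = 0.
    by apply: lform0; rewrite v'E formE !formZr form_far // form_ev_e0 // !mulr0 addr0.
  have tr := point_tr (eqv_point ev0).2.
  have lvv' : lform v' v' = - (qpol v v * lam^!) - (qpol v v)^!.
    have e : form v' v' = - qpol v v - (qpol v v)^! * lam.
      by rewrite -[RHS]add0r -tr barK; ring.
    by rewrite lformE e; ring : (lamV F).
  have iq : I (qpol v v).
    apply: (big_ind I); [exact: (I0 IOm)|exact: (ID IOm)|] => k pk.
    have hk : th_hb k by rewrite th_hbE pk.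
    have hk' : th_hb (th_opp k) by rewrite th_hb_opp.
    case: (eqVneq k j) => [ekj|ne].
      by apply: (IMl IOm); apply: comm_offdiag => //; rewrite ekj eq_sym th_hb_neq.
    by apply: (IMr IOm); apply: (Ibar IOm); apply: comm_offdiag.
  have := eqv_min (IN IOm (Ibar IOm iq)) e6; congr eqv.
  - by rewrite scaleN1r addrC addKr.
  - by rewrite !lfE zj zij !barE; ring.
  - by rewrite scaleN1r addrC addKr.
  - by rewrite !lfE ziv' lvv' !barE; ring.
apply: scalar_on_basis => // i x y t hi d tE.
have hi' : th_hb (th_opp i) by rewrite th_hb_opp.
have et : EU t.
  apply: (EU_ev hi _ _ tE); first exact: point_e0.
  by rewrite !mxE th_opp_eqC th_opp_zero (negbTE hi) mulr0.
apply: (eqv_trans (comm_point et (point_evi F hi'))).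
by have := EU_respects et (hb1 _ hi'); rewrite -scalemxAr.
Qed.

End Commute.

Lemma Urel_inv g : Ur g -> Ur g^-1%g.
Proof.
move=> rg; have ug : U g by case: rg.
apply: (point_Urel (IOm := IOm)); first exact: UV.
move=> u y vy; apply: eqv_sym.
have := Urel_point IOm rg (U_point (UV ug) vy).
by rewrite mulmxA gl_mulV mul1mx.
Qed.

Lemma Urel_normalizes g : Ur g -> normalizes EUr g.
Proof.
move=> rg x rx; have := EUrM (Urel_comm hn IOm rg (EUr_EU IOm rx)) rx.
by rewrite /commutator mulgVK.
Qed.

(** Three subgroups, modulo EU((R,Delta),(I,Omega)), with [c, ti] in U((R,Delta),(I,Omega));
the commutators of the latter group with EU are relative elementary by Urel_comm. That
c normalizes the relative elementary group is where the scalar action enters. *)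
Lemma CU_comm_comm c t1 t2 : CU c -> EU t1 -> EU t2 ->
  EUr (commutator c (commutator t1 t2)).
Proof.
move=> [[uc ncU] comc] e1 e2; have sN := EUr_subgroup n I Om.
have [a sa] := comm_scalar_on uc comc; have cD := scalar_on_respects sa.
have nzE t : EU t -> normalizes EUr t by move=> et x; apply: EUr_normal.
have r1 := comc _ e1; have r2 := comc _ e2.
apply: (comm_comm sN (r1 := commutator c t1) (r2 := commutator c t2)).
- by rewrite /commutator mulgVK.
- by rewrite /commutator mulgVK.
- exact: Urel_normalizes.
- exact: Urel_normalizes.
- exact: nzE.
- exact: nzE.
- by apply: nzE; apply: EUV.
- by apply: nzE; apply: EUV.
- by apply: Urel_normalizes; apply: Urel_inv.
- by apply: Urel_normalizes; apply: Urel_inv.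
- exact: (Urel_comm hn IOm).
- exact: (Urel_comm hn IOm).
- exact: (Urel_comm hn IOm).
- exact: (Urel_comm hn IOm).
- have [x rx xe] : conj_set c Ur (commutator c t1) by rewrite ncU.
  rewrite -xe; have := respects_normalizes hn uc cD (Urel_comm hn IOm rx e2).
  by congr EUrel; rewrite /commutator !(invgM, invgK, mulgA, mulgVK, mulgK).
Qed.

(** EU is perfect: T_ij(x) is the commutator of a shift with some T_il(x), and T_i is a
product of commutators by e0_decomp. So CU_comm_comm covers generators of EU. *)
Lemma CU_comm c t : CU c -> EU t -> EUr (commutator c t).
Proof.
move=> cU et; have sN := EUr_subgroup n I Om.
pose K : set G := fun t => EU t /\ EUr (commutator c t).
suff [] : K t by [].
have KM t1 t2 : K t1 -> K t2 -> K (t1 * t2)%g.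
  move=> [h1 h2] [h1' h2']; split; first exact: EUM.
  by apply: (comm_mulr sN) => // x; apply: EUr_normal.
have KV t1 : K t1 -> K t1^-1%g.
  move=> [h1 h2]; split; first exact: EUV.
  by apply: (comm_invr sN) => // x; apply: EUr_normal; apply: EUV.
have Kc t1 t2 : EU t1 -> EU t2 -> K (commutator t1 t2).
  by move=> h1 h2; split; [do ![apply: EUM => //]; apply: EUV|apply: CU_comm_comm].
have Kfar i j x g : far i j -> gl_mx g = Tv (ev i) (x *: ev j) 0 -> K g.
  move=> f gE; have [hi hj] := (far_hbl f, far_hbr f).
  have [l [fli flj]] := far_ex hn hi hj; have hl := far_hbl fli.
  have fil : far i l by rewrite far_sym.
  have fjl : far j l by rewrite far_sym.
  have [t1 [et1 _ tE]] := shift_ex 1 fjl.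
  have il : form (ev i) (x *: ev l) = 0 by rewrite formE form_far // mulr0.
  have ij : form (ev i) (x *: ev j) = 0 by rewrite formE form_far // mulr0.
  have [t2 t2E] := Tv_gl 0 (form_evev0 F hi) il.
  have [_ e1 e2 e3] := far_neq fil; have [_ _ e5 e6] := far_neq f.
  have [e7 e8 e9 e10] := far_neq fjl.
  have et2 : EU t2.
    apply: (EU_ev hi _ _ t2E); first exact: point_ev.
    by rewrite !mxE eq_sym e3 mulr0.
  have ti : gl_mx t1 *m ev i = ev i.
    rewrite tE !evE e1 [th_opp j == i]th_opp_eqC e6 /=.
    by rewrite !mulr0 !scale0r subr0 addr0.
  have tl : gl_mx t1 *m (x *: ev l) = x *: ev j + x *: ev l.
    rewrite tE !mxE !eqxx !andbT [th_opp j == l]eq_sym e10 /=.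
    by rewrite !mulr0 scale0r subr0 mulr1 mul1r addrC.
  have e : (t1 * t2 * t1^-1 = g * t2)%g.
    apply: gl_mx_inj; rewrite (gl_conj_Tv (EU_U et1) t2E) ti tl gl_mxM gE t2E.
    rewrite Tv_add ?form_evev0 //; congr (Tv _ _ _).
    by rewrite !lfE (lform0 (form_far F fjl)); ring.
  by have := Kc _ _ et1 et2; rewrite /commutator e mulgK.
move: t et; apply: gen_min.
  split; [|exact: KM|exact: KV].
  by split; [apply: EU1|rewrite /commutator mulg1 invg1 mulg1 mulgV; apply: EUr1].
move=> t /(elementaryP (top_ideal F))[[i [j [x [f _ gE]]]]|[i [x [y [hi d tE]]]]].
  exact: Kfar f gE.
have [j [f _]] := far_ex hn hi hi; have hj := far_hbl f.
have [t1 [t2 [t1E t2E te]]] := e0_decomp F x y f.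
have j0 : form (ev j) (x *: ev o) = 0 by rewrite formE form_ev_e0 // mulr0.
have [tj tjE] := Tv_gl y (form_evev0 F hj) j0.
have vx : point (x *: ev o) y by apply: point_e0.
have tjEU : EU tj.
  apply: (EU_ev hj vx _ tjE).
  by rewrite !mxE th_opp_eqC th_opp_zero (negbTE hj) mulr0.
have f' : far (th_opp j) i by rewrite far_oppl.
have f'' : far i j by rewrite far_sym.
have k1 := Kfar _ _ _ _ f' t1E; have k2 := KV _ (Kfar _ _ _ _ f'' t2E).
have := KM _ _ (Kc _ _ k1.1 tjEU) (KM _ _ (Kc _ _ tjEU k2.1) k2).
rewrite (te _ _ vx tjE tE); congr K.
by rewrite /commutator !(invgM, invgK, mulgA, mulgVK, mulgK).
Qed.

Lemma sandwich_normalized (H : set G) : is_subgroup H ->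
  (forall g, EUr g -> H g) -> (forall g, H g -> CU g) -> normalized_by EU H.
Proof.
move=> [H1 HM HV] rH HC; apply: normalizedP; first exact: EU_subgroup.
move=> e x Ee Hx; have := HM _ _ (rH _ (EUrV (CU_comm (HC _ Hx) Ee))) Hx.
by congr H; rewrite /commutator !(invgM, invgK, mulgA, mulgVK, mulgK).
Qed.

End Congruence.
End Sandwich.

(** * The level of a normalized subgroup *)

Section Level.
Variables (R : comNzRingType) (F : hermFormRing R) (n : nat).
Hypothesis hn : (3 <= n)%N.
Notation "x ^!" := (bar F x) (at level 1, format "x ^!").
Notation lam := (lam F).
Notation mu := (mu F).
Notation vec := 'cV[R]_(n.*2.+1).
Notation mat := 'M[R]_(n.*2.+1).
Notation idx := 'I_(n.*2.+1).
Notation o := (th_zero n).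
Notation form := (hform F).
Notation lform := (hform_op F).
Notation qpol := (hyp_form F).
Notation cc := (gram F).
Notation ev := (@bvec R n).
Notation Tv := (@transv R F n).
Notation G := (GL R n.*2.+1).
Notation point := (qpoint (full F)).
Notation EU := (EUgroup F n).
Notation U := (Ugroup F n).
Implicit Types (u v w f p q : vec) (i j k l m : idx) (a x y z r : R) (g s t c : G).
Variable H : set G.
Hypothesis sH : is_subgroup H.
Hypothesis nH : normalized_by EU H.

Lemma HM s t : H s -> H t -> H (s * t)%g.
Proof. by case: sH => _ h _; apply: h. Qed.
Lemma HV s : H s -> H s^-1%g.
Proof. by case: sH => _ _ h; apply: h. Qed.
Lemma H1 : H 1%g. Proof. by case: sH. Qed.
Lemma HJ e s : EU e -> H s -> H (e * s * e^-1)%g.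
Proof. by move=> Ee; apply: normalized_conj nH Ee. Qed.
Lemma HJV e s : EU e -> H s -> H (e^-1 * s * e)%g.
Proof. by move=> Ee Hs; have := HJ (EUV Ee) Hs; rewrite invgK. Qed.
Lemma Hcomm e s : EU e -> H s -> H (e * s * e^-1 * s^-1)%g.
Proof. by move=> Ee Hs; apply: HM; [apply: HJ|apply: HV]. Qed.
Lemma HMr s t : H t -> H (s * t)%g -> H s.
Proof. by move=> Hs Hst; have := HM Hst (HV Hs); rewrite mulgK. Qed.

Definition Hmx (M : mat) := exists2 g, H g & gl_mx g = M.

Lemma Hmx_gl g : Hmx (gl_mx g) -> H g.
Proof. by case=> g' hg /gl_mx_inj<-. Qed.
Lemma HmxM M N : Hmx M -> Hmx N -> Hmx (M *m N).
Proof. by move=> [g hg <-] [g' hg' <-]; exists (g * g')%g; first exact: HM. Qed.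

Lemma point_far i j x : far i j -> point (x *: ev j) 0.
Proof. by move=> f; apply: point_ev => //; apply: far_hbr f. Qed.
Lemma orth_far i j x : far i j -> form (ev i) (x *: ev j) = 0.
Proof. by move=> f; rewrite formE form_far // mulr0. Qed.
Lemma orth_e0 i x : th_hb i -> form (ev i) (x *: ev o) = 0.
Proof. by move=> f; rewrite formE form_ev_e0 // mulr0. Qed.

Lemma far_gl i j x : far i j -> exists2 g, EU g & gl_mx g = Tv (ev i) (x *: ev j) 0.
Proof.
move=> f; have hi := far_hbl f.
have [g gE] := Tv_gl 0 (form_evev0 F hi) (orth_far x f).
exists g => //; apply: (EU_ev hi (point_far x f) _ gE).
by rewrite !mxE; have [_ _ _ e] := far_neq f; rewrite eq_sym e mulr0.
Qed.

Lemma e0_gl i x y : th_hb i -> dl F x y^! ->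
  exists2 g, EU g & gl_mx g = Tv (ev i) (x *: ev o) y.
Proof.
move=> hi d; have [g gE] := Tv_gl y (form_evev0 F hi) (orth_e0 x hi).
exists g => //; apply: (EU_ev hi _ _ gE); first exact: point_e0.
by rewrite !mxE th_opp_eqC th_opp_zero (negbTE hi) mulr0.
Qed.

Lemma ev_far0 i j : far i j -> ev i j 0 = 0 :> R.
Proof. by case/far_neq=> _ e _ _; rewrite evE e. Qed.
Lemma ev_far0' i j : far i j -> ev i (th_opp j) 0 = 0 :> R.
Proof. by move=> f; apply: ev_far0; rewrite far_oppr. Qed.
Lemma ev_e0_hb i : th_hb i -> ev o i 0 = 0 :> R.
Proof. by move=> hi; rewrite evE (negbTE hi). Qed.
Lemma ev_id i : ev i i 0 = 1 :> R. Proof. by rewrite evE eqxx. Qed.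

(** Shifts are the conjugators of the extraction: t g t^-1 differs from g by a
transvection in which e_j is replaced by a multiple of e_i. *)
Lemma shift_gl i j r : far i j -> exists t, [/\ EU t,
   gl_mx t *m ev j = ev j + r *: ev i,
   gl_mx t *m ev i = ev i /\
   (forall k, far k i -> (k == j) = false -> gl_mx t *m ev k = ev k),
   gl_mx t *m ev o = ev o &
   gl_mx t = Tv (ev (th_opp j)) ((r * (cc (th_opp j))^!) *: ev i) 0 ].
Proof.
move=> f; have [et [t0 tm tE]] := shift_ex F r f; have [hi hj] := (far_hbl f, far_hbr f).
exists et; split=> //.
- rewrite tE ev_id mulr1 (ev_far0' (j := i)) 1?far_sym //.
  by rewrite mulr0 scale0r subr0.
- have fix_ k : (k == j) = false -> (k == th_opp i) = false -> gl_mx et *m ev k = ev k.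
    move=> kj ki; rewrite tE !evE [j == k]eq_sym kj [_ == k]eq_sym ki /=.
    by rewrite !mulr0 !scale0r addr0 subr0.
  split=> [|k fk kj]; apply: fix_ => //; last by case: (far_neq fk).
    by case: (far_neq f).
  exact: th_hb_neq.
- by rewrite tE !ev_e0_hb ?th_hb_opp // !mulr0 !scale0r addr0 subr0.
Qed.

(** Conjugate by a shift that adds r e_m to e_j. *)
Lemma level_far_far i j m x r : far i j -> far m i -> far m j ->
  Hmx (Tv (ev i) (x *: ev j) 0) -> Hmx (Tv (ev i) ((r * x) *: ev m) 0).
Proof.
move=> f fmi fmj [g hg gE]; have [t [et tj [_ tk] _ _]] := shift_gl r fmj.
have [hi hj] := (far_hbl f, far_hbr f).
have [ij _ _ _] := far_neq f.
have ti : gl_mx t *m ev i = ev i by apply: tk; rewrite // far_sym.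
have fim : far i m by rewrite far_sym.
have [g' _ g'E] := far_gl (r * x) fim.
suff e : (t * g * t^-1 = g' * g)%g.
  exists g' => //; have := Hcomm et hg; by rewrite e mulgK.
apply: gl_mx_inj; rewrite (gl_conj_Tv (EU_U et) gE) ti -scalemxAr tj gl_mxM gE g'E.
rewrite Tv_add ?form_evev0 ?orth_far //; congr (Tv _ _ _).
  by rewrite scalerDr scalerA addrC mulrC.
by rewrite !lfE (lform0 (form_far F fmj)); ring.
Qed.

Lemma level_far i j m x r : far i j -> far i m ->
  Hmx (Tv (ev i) (x *: ev j) 0) -> Hmx (Tv (ev i) ((r * x) *: ev m) 0).
Proof.
move=> f fim hx; have [hi hj] := (far_hbl f, far_hbr f); have hm := far_hbr fim.
have fmi : far m i by rewrite far_sym.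
case: (hb_cases hm hj) => [e|e|fmj]; last exact: (level_far_far _ f fmi fmj hx).
- have [l [fli flj]] := far_ex hn hi hj.
  have := level_far_far 1 f fli flj hx; rewrite mul1r => h1; rewrite e in fmi *.
  by apply: (level_far_far r _ fmi) h1; rewrite far_sym // far_sym.
- have [l [fli flj]] := far_ex hn hi hj.
  have := level_far_far 1 f fli flj hx; rewrite mul1r => h1.
  by apply: (level_far_far r _ fmi) h1; rewrite ?e ?far_oppl far_sym.
Qed.

Lemma level_swap i j x : Hmx (Tv (ev i) (x *: ev j) 0) ->
  Hmx (Tv (ev j) ((- lam^! * x^!) *: ev i) 0).
Proof. by rewrite Tv_swap Tv_scale !mul0r scalerA mulrC. Qed.

(** The ideal part of the level. By level_mem one pair of indices is enough. *)
Definition levelI : set R := fun x => forall i j, far i j -> Hmx (Tv (ev i) (x *: ev j) 0).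

(** Move the second index, exchange both by Tv_swap, move again, exchange back. The scalars
picked up cancel. *)
Lemma level_mem i j x : far i j -> Hmx (Tv (ev i) (x *: ev j) 0) -> levelI x.
Proof.
move=> f hx k l fkl; have hi := far_hbl f; have hk := far_hbl fkl.
have [m [fmi fmk]] := far_ex hn hi hk.
have fim : far i m by rewrite far_sym.
have fkm : far k m by rewrite far_sym.
have := level_swap (level_far 1 f fim hx); rewrite mul1r => h1.
have := level_swap (level_far 1 fmi fmk h1); rewrite mul1r !barE => h2.
have := level_far 1 fkm fkl h2; congr (Hmx (Tv _ (_ *: _) _)).
by ring : (lamV F).
Qed.

Lemma far_exists : exists i j, far i j.
Proof.
have n0 : (0 < n.*2.+1)%N by [].
pose i0 : idx := Ordinal n0.
have h0 : th_hb i0 by rewrite th_hbE /th_pos /=; apply/orP; left; lia.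
by have [j [f _]] := far_ex hn h0 h0; exists j, i0.
Qed.

Lemma levelI_ideal : is_ideal levelI.
Proof.
have IM r x : levelI x -> levelI (r * x).
  move=> ix; have [i [j f]] := far_exists.
  by apply: (level_mem f); exact: (level_far _ f f (ix _ _ f)).
split=> //.
- move=> i j f; rewrite scale0r Tv0; by exists 1%g; [apply: H1|].
- move=> x y ix iy i j f; have := HmxM (ix _ _ f) (iy _ _ f).
  rewrite Tv_add ?form_evev0 ?(far_hbl f) ?orth_far // scalerDl; congr Hmx.
  congr (Tv _ _ _).
  by rewrite !lfE (lform0 (form_evev0 F (far_hbr f))); ring.
- by move=> r x ix; rewrite mulrC; apply: IM.
Qed.

Lemma levelI_bar x : levelI x -> levelI x^!.
Proof.
move=> ix; have [i [j f]] := far_exists; have fji : far j i by rewrite far_sym.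
have := level_far (- lam) fji fji (level_swap (ix _ _ f)).
have -> : - lam * (- lam^! * x^!) = x^! by ring : (lamV F).
exact: level_mem.
Qed.

Lemma levelIM r x : levelI x -> levelI (r * x).
Proof. by case: levelI_ideal => _ _ h _; apply: h. Qed.
Lemma levelID x y : levelI x -> levelI y -> levelI (x + y).
Proof. by case: levelI_ideal => _ h _ _; apply: h. Qed.
Lemma levelIN x : levelI x -> levelI (- x).
Proof. by move=> ix; rewrite -mulN1r; apply: levelIM. Qed.
Lemma levelIB x y : levelI x -> levelI y -> levelI (x - y).
Proof. by move=> ix iy; apply: levelID => //; apply: levelIN. Qed.
Lemma levelI0 : levelI 0. Proof. by case: levelI_ideal. Qed.

Lemma level_gl i j x g : far i j -> levelI x -> gl_mx g = Tv (ev i) (x *: ev j) 0 -> H g.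
Proof. by move=> f ix gE; apply: Hmx_gl; rewrite gE; apply: ix. Qed.

(** Tv_split for r e_i + e_j. By Tv_scale the first factor is T_i at the action of conj(r)
on (x, y), and the last one is a matrix T_ij in the ideal spanned by y. *)
Lemma extra_shift_split i j x y r t tj : far i j -> dl F x y^! ->
  gl_mx t *m ev j = ev j + r *: ev i -> gl_mx t *m ev o = ev o -> EU t ->
  gl_mx tj = Tv (ev j) (x *: ev o) y ->
  exists2 g, gl_mx g = Tv (r *: ev i) (x *: ev o) y &
  exists2 z, gl_mx z = Tv (ev i) ((r^! * y) *: ev j) 0 & (t * tj * t^-1 = g * tj * z)%g.
Proof.
move=> f d tE to et tjE; have [hi hj] := (far_hbl f, far_hbr f).
have fji : far j i by rewrite far_sym.
have qq : form (r *: ev i) (r *: ev i) = 0 by rewrite !formE form_evev0 // !mulr0.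
have q0 : form (r *: ev i) (x *: ev o) = 0 by rewrite !formE form_ev_e0 // !mulr0.
have [g gE] := Tv_gl y qq q0; exists g => //.
have [z _ zE] := far_gl (r^! * y) f; exists z => //.
apply: gl_mx_inj; rewrite (gl_conj_Tv (EU_U et) tjE) tE -scalemxAr to.
rewrite (Tv_split (form_evev0 F hj) qq (orth_far r fji)) ?orth_e0 //.
  rewrite !gl_mxM gE tjE zE; congr (_ *m _).
  by rewrite Tv_scale scalerA !mul0r.
by apply: (point_tr (S := full F)); apply: point_e0.
Qed.

Lemma level_extra i j x y r : far i j -> dl F x y^! -> levelI (r * y) ->
  Hmx (Tv (ev j) (x *: ev o) y) -> Hmx (Tv (ev i) ((x * r) *: ev o) (y * (r * r^!))).
Proof.
move=> f d iy [tj htj tjE].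
have [t [et tE _ to _]] := shift_gl r^! f.
have [g gE [z zE e]] := extra_shift_split f d tE to et tjE.
rewrite barK in zE; have hz := level_gl f iy zE.
have etj : EU tj by have [g1 e1 g1E] := e0_gl (far_hbr f) d; rewrite (gl_mx_inj (etrans tjE (esym g1E))).
have hg : H g.
  have h1 := Hcomm et htj; rewrite e in h1.
  apply: (HMr (HJ etj hz)); by rewrite !mulgA.
exists g => //; rewrite gE Tv_scale barK scalerA; congr (Tv _ (_ *: _) _); ring.
Qed.

(** The shift itself is in H because r is in the ideal. *)
Lemma level_extra_ideal i x y r : th_hb i -> dl F x y^! -> levelI r ->
  Hmx (Tv (ev i) ((x * r) *: ev o) (y * (r * r^!))).
Proof.
move=> hi d ir; have [j [fji _]] := far_ex hn hi hi; have hj := far_hbl fji.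
have f : far i j by rewrite far_sym.
have [t [et tE _ to tT]] := shift_gl r^! f.
have [tj etj tjE] := e0_gl hj d.
have [g gE [z zE e]] := extra_shift_split f d tE to et tjE.
rewrite barK in zE.
have hz : H z by apply: (level_gl f _ zE); rewrite mulrC; apply: levelIM.
have ht : H t.
  apply: (level_gl _ _ tT); first by rewrite far_oppl.
  by rewrite mulrC; apply: levelIM; apply: levelI_bar.
have hg : H g.
  have h1 : H (t * tj * t^-1 * tj^-1)%g.
    by have := HM ht (HJ etj (HV ht)); rewrite !mulgA.
  by rewrite e in h1; apply: (HMr (HJ etj hz)); rewrite !mulgA.
exists g => //; rewrite gE Tv_scale barK scalerA; congr (Tv _ (_ *: _) _); ring.
Qed.

(** The form part of the level. It must be contained in Omega_max, hence the second and third
conditions; all indices are required since T_i and T_j are conjugate only modulo T_ij(y). *)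
Definition levelOm : set (heis F) := fun d =>
  [/\ dl F d.1 d.2, levelI d.2, forall x' y', dl F x' y' -> levelI (x'^! * mu * d.1) &
      forall i, th_hb i -> Hmx (Tv (ev i) (d.1 *: ev o) d.2^!)].

(** T(e_i; 0, z - conj(z) lam^-1) is the commutator of T(e_i; z e_j, 0) with the shift that adds
e_i to e_j. *)
Lemma level_self i z : th_hb i -> levelI z -> Hmx (Tv (ev i) 0 (z - z^! * lam^!)).
Proof.
move=> hi iz; rewrite -Tv_self.
have [j [fji _]] := far_ex hn hi hi; have hj := far_hbl fji.
have f : far i j by rewrite far_sym.
have [t [et tE [ti _] _ _]] := shift_gl 1 f.
have [g hg gE] := iz _ _ f.
have ii : form (ev i) (z *: ev i) = 0 by rewrite formE form_evev0 // mulr0.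
have [g' g'E] := Tv_gl 0 (form_evev0 F hi) ii.
suff e : (t * g * t^-1 = g' * g)%g.
  by exists g' => //; have := Hcomm et hg; rewrite e mulgK.
apply: gl_mx_inj; rewrite (gl_conj_Tv (EU_U et) gE) ti -scalemxAr tE gl_mxM gE g'E.
rewrite Tv_add ?ii ?form_evev0 ?orth_far //; congr (Tv _ _ _).
  by rewrite scale1r scalerDr addrC.
by rewrite !lfE (lform0 (form_far F f)); ring.
Qed.

Lemma levelOm_submodule : is_heis_submodule levelOm.
Proof.
split; first split.
- split=> /=; [by have := dl_min F 0; rewrite bar0 mul0r subr0|exact: levelI0| |].
    by move=> x' y' _; rewrite mulr0; apply: levelI0.
  by move=> i _; rewrite scale0r bar0 Tv0; exists 1%g; [apply: H1|].
- move=> [x y] [x' y'] [/= d1 i1 t1 h1] [/= d2 i2 t2 h2]; split=> /=.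
  + exact: dlD.
  + apply: levelIB; first exact: levelID.
    exact: t2 d1.
  + move=> p s d; rewrite mulrDr; apply: levelID; [exact: t1 d|exact: t2 d].
  + move=> i hi; have := HmxM (h2 i hi) (h1 i hi).
    rewrite Tv_add ?form_evev0 ?orth_e0 //; congr (Hmx (Tv _ _ _)).
      by rewrite -scalerDl addrC.
    rewrite lformU !formE form_el evE th_opp_zero eqxx cc_zero /= !barE.
    by ring : (lamV F).
- move=> [x y] [/= d1 i1 t1 h1]; split=> /=.
  + exact: dlN.
  + apply: levelIB; first exact: levelIN.
    exact: t1 d1.
  + by move=> p s d; rewrite mulrN; apply: levelIN; apply: t1 d.
  + move=> i hi; have [g hg gE] := h1 i hi.
    exists g^-1%g; first exact: HV.
    have e := Tv_inv y^! (form_evev0 F hi) (orth_e0 x hi).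
    rewrite -[LHS]mulmx1 -[in LHS]e mulmxA -gE gl_Vmul mul1mx -scaleNr; congr (Tv _ _ _).
    rewrite lformU !formE form_el evE th_opp_zero eqxx cc_zero /= !barE.
    by ring : (lamV F).
- move=> [x y] r [/= d1 i1 t1 h1]; split=> /=.
  + exact: dlZ.
  + by rewrite mulrC; apply: levelIM; apply: levelIM.
  + by move=> p s d; rewrite mulrA mulrC; apply: levelIM; apply: t1 d.
  + move=> i hi; have [j [fji _]] := far_ex hn hi hi; have hj := far_hbl fji.
    have f : far i j by rewrite far_sym.
    have d1' : dl F x y^!^! by rewrite barK.
    have := level_extra f d1' (levelIM r (levelI_bar i1)) (h1 j hj).
    by congr (Hmx (Tv _ _ _)); rewrite !barE; ring.
Qed.

Lemma level_ideal : is_odd_form_ideal F levelI levelOm.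
Proof.
have sO := levelOm_submodule.
have [[_ OM _] _] := sO.
split=> //; [exact: levelI_ideal|exact: levelI_bar| |].
- move=> _ [_ [z iz <-] [b gb <-]]; apply: OM.
    split=> /=; first exact: dl_min.
    + by apply: levelIB => //; rewrite mulrC; apply: levelIM; apply: levelI_bar.
    + by move=> x' y' _; rewrite mulr0; apply: levelI0.
    + move=> i hi; rewrite scale0r.
      have := level_self hi (levelI_bar iz); congr (Hmx (Tv _ _ _)).
      by rewrite !barE; ring.
  apply: gb; split; first by case: sO.
  move=> _ [[x y] d [r ir <-]]; split=> /=.
  + exact: (dlZ r d).
  + by apply: levelIM.
  + by move=> x' y' d'; rewrite mulrA; apply: levelIM.
  + move=> i hi; have d' : dl F x y^!^! by rewrite barK.
    have := level_extra_ideal hi d' ir.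
    by congr (Hmx (Tv _ _ _)); rewrite !barE; ring.
- by move=> [x y] [/= d1 i1 t1 h1]; split=> //= p [s d]; apply: t1 d.
Qed.

Lemma EUrel_sub g : EUrel F n levelI levelOm g -> H g.
Proof.
apply: gen_min => // _ [e Ee [x ix <-]]; apply: HJ => //.
move: x ix; apply: gen_min => // x /(elementaryP level_ideal).
case=> [[i [j [y [f iy gE]]]]|[i [y [z [hi [/= _ _ _ h] gE]]]]].
  exact: level_gl f iy gE.
by apply: Hmx_gl; rewrite gE; have := h i hi; rewrite barK.
Qed.

(** * Products of entries of a column of an element of H *)

Hypothesis HU : forall g, H g -> U g.
Notation I := levelI.

(** A and g0 are transvections along the same vector e_i, so they commute up to
T(e_i; 0, z). Taking the commutator of A B with g0 therefore removes A at the cost of that factor Z. *)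
Lemma kill_step i v y g0 w A B : th_hb i -> form (ev i) v = 0 -> form (ev i) w = 0 ->
  point v y -> EU A -> EU g0 ->
  gl_mx A = Tv (ev i) v y -> gl_mx g0 = Tv (ev i) w 0 -> H (A * B)%g ->
  exists z, exists2 Z : G, gl_mx Z = Tv (ev i) 0 z & H (Z * (g0 * B * g0^-1 * B^-1))%g.
Proof.
move=> hi iv iw vy eA e0 AE gE hAB; have ii := form_evev0 F hi.
have hc : H (A^-1 * (g0 * (A * B) * g0^-1 * (A * B)^-1) * A)%g.
  by apply: HJV => //; apply: (Hcomm).
pose z := lform v w - lform w v.
have i0 : form (ev i) 0 = 0 by rewrite form0r.
have [Z ZE] := Tv_gl z ii i0.
exists z, Z => //.
have e : (g0 * A = A * Z * g0)%g.
  apply: gl_mx_inj; rewrite !gl_mxM AE gE ZE !Tv_add ?formE ?iv ?iw ?i0 ?addr0 //.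
  congr (Tv _ _ _); first by rewrite addrC.
  by rewrite !lfE /z; ring.
have e' : (A^-1 * (g0 * (A * B) * g0^-1 * (A * B)^-1) * A =
   A^-1 * (g0 * A) * (B * g0^-1 * B^-1))%g.
  by rewrite !(invgM, invgK, mulgA, mulgVK).
by rewrite e' e !(mulgA, mulVg, mul1g) in hc; rewrite !mulgA.
Qed.

(** Z is fixed by conjugation with t, and central among the transvections along e_i; hence
the commutator of Z Q with t is that of Q. *)
Lemma kill_long i z Z t Q X v y : th_hb i -> gl_mx Z = Tv (ev i) 0 z -> EU t ->
  gl_mx t *m ev i = ev i -> H (Z * Q)%g -> (t * Q * t^-1 = X * Q)%g ->
  gl_mx X = Tv (ev i) v y -> form (ev i) v = 0 -> H X.
Proof.
move=> hi ZE et ti hZQ e XE iv; have ii := form_evev0 F hi.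
have i0 : form (ev i) 0 = 0 by rewrite form0r.
have eZ : (t * Z * t^-1 = Z)%g.
  by apply: gl_mx_inj; rewrite (gl_conj_Tv (EU_U et) ZE) ti mulmx0 ZE.
have eX : (Z * X = X * Z)%g.
  apply: gl_mx_inj; rewrite !gl_mxM ZE XE !Tv_add //.
  by congr (Tv _ _ _); [rewrite addrC|rewrite !lfE; ring].
have := Hcomm et hZQ.
have -> : (t * (Z * Q) * t^-1 = (t * Z * t^-1) * (t * Q * t^-1))%g.
  by rewrite !(mulgA, mulgVK).
by rewrite eZ e mulgA eX !(invgM, mulgA, mulgK).
Qed.

Section Column.
Variables (s : G) (i j k : idx).
Hypothesis Hs : H s.
Hypotheses (fji : far j i) (fki : far k i) (fkj : far k j).
Notation u := (gl_mx s *m ev i).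
Notation al m := (form u (ev m)).
Notation i' := (th_opp i).
Let f1 : vec := al j *: ev i' - al i' *: ev j.
Let f2 : vec := al k *: ev i' - al i' *: ev k.

Let hi : th_hb i. Proof. exact: far_hbr fji. Qed.
Let hi' : th_hb i'. Proof. by rewrite th_hb_opp. Qed.
Let hj : th_hb j. Proof. exact: far_hbl fji. Qed.
Let hk : th_hb k. Proof. exact: far_hbl fki. Qed.
Let fij : far i j. Proof. by rewrite far_sym. Qed.
Let fik : far i k. Proof. by rewrite far_sym. Qed.
Let fjk : far j k. Proof. by rewrite far_sym. Qed.
Let fi'j : far i' j. Proof. by rewrite far_oppl far_sym. Qed.
Let fi'k : far i' k. Proof. by rewrite far_oppl far_sym. Qed.
Let fji' : far j i'. Proof. by rewrite far_oppr. Qed.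
Let fki' : far k i'. Proof. by rewrite far_oppr. Qed.
Let us : U s. Proof. exact: HU. Qed.

Lemma point_pair a b l m : far l m -> point (a *: ev l - b *: ev m) 0.
Proof.
move=> f; have [hl hm] := (far_hbl f, far_hbr f).
apply: (point_eq (pointD (point_ev (S := full F) (x := a) hl _) (pointN (point_ev (x := b) hm _)))) => //.
by rewrite !lfE (lform0 (form_far F f)) //; ring.
Qed.

(** Entries enter H through products. Let u = s e_i and let t be a transvection along f1
with parameter f2, two vectors on the coordinates -i, j, k orthogonal to u. Then
xi = s^-1 t s fixes e_i and is congruent to t modulo H. From g = T(e_i; e_j, 0) one gets an
element A B of H with A along e_i and B along e_j, where B has known parameters; kill_step and
kill_long remove A and leave a matrix T(e_i; c e_j, 0) with c a unit times
conj(b(u,e_j)) b(u,e_-i). *)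
Lemma product_step : I ((al j)^! * al i').
Proof.
have c1 : form u f1 = 0 by rewrite /f1 !formE; ring.
have c2 : form u f2 = 0 by rewrite /f2 !formE; ring.
have v1 : point f1 0 by apply: point_pair.
have v2 : point f2 0 by apply: point_pair.
have i1 : form (ev i') f1 = 0.
  by rewrite /f1 !formE form_evev0 // form_far // !mulr0 subr0.
have i2 : form (ev i') f2 = 0.
  by rewrite /f2 !formE form_evev0 // form_far // !mulr0 subr0.
have j1 : form (ev j) f1 = 0.
  by rewrite /f1 !formE form_evev0 // form_far // !mulr0 subr0.
have j2 : form (ev j) f2 = 0 by rewrite /f2 !formE !form_far // !mulr0 subr0.
have k1 : form (ev k) f1 = 0 by rewrite /f1 !formE !form_far // !mulr0 subr0.
have f11 := point_sing v1; have f22 := point_sing v2.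
have f1k : f1 k 0 = 0.
  by rewrite !mxE; have [-> _ _ _] := far_neq fki'; have [-> _ _ _] := far_neq fkj; rewrite !mulr0 subr0.
have f1k' : f1 (th_opp k) 0 = 0.
  by rewrite !mxE !th_opp_eqC; have [_ _ -> _] := far_neq fki'; have [_ _ -> _] := far_neq fkj; rewrite !mulr0 subr0.
have e1 : f1 = al j *: ev i' - al i' *: ev j by [].
have e2 : f2 = al k *: ev i' - al i' *: ev k by [].
clearbody f1 f2.
have f12 : form f1 f2 = 0 by rewrite e1 !formE i2 j2 !mulr0 subr0.
(* t fixes u because f1 and f2 are orthogonal to u *)
have [t tE] := Tv_gl 0 f11 f12.
have et : EU t.
  apply: EU_mx tE.
  exact: (P_avoid (EUmx_elem_closed F n) v1 hk f1k f1k' v2 f12).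
pose xi := (s^-1 * t * s)%g.
have xii : gl_mx xi *m ev i = ev i.
  rewrite !gl_mxM -!mulmxA tE TvE (form0_sym c1) (lform0 (form0_sym c2)).
  by rewrite mulr0 !scale0r !addr0 subr0 mulmxA gl_Vmul mul1mx.
have uxi : U xi by apply: UM => //; apply: UM; [apply: UV|apply: EU_U].
have [g eg gE] := far_gl 1 fij; rewrite scale1r in gE.
have hE1 : H (xi^-1 * g * xi * t^-1 * g^-1 * t)%g.
  have h1 : H (xi * t^-1)%g.
    by have := HM (HV Hs) (HJ et Hs); rewrite !mulgA.
  have := HJV et (HM (HV h1) (HJ eg h1)); congr H.
  by rewrite !(invgM, invgK, mulgA, mulgVK, mulVg, mul1g).
have xiVi : gl_mx xi^-1%g *m ev i = ev i.
  by rewrite -{1}xii mulmxA gl_Vmul mul1mx.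
have uxiV := UV uxi.
pose q := gl_mx xi^-1%g *m ev j.
have vq : point q 0 by apply: U_point => //; apply: point_evi.
have iq : form (ev i) q = 0 by rewrite -xiVi U_form // form_far.
have ii := form_evev0 F hi; have ij := form_far F fij; have ik := form_far F fik.
have E1 : gl_mx (xi^-1 * g * xi)%g = Tv (ev i) q 0.
  by have := gl_conj_Tv uxiV gE; rewrite invgK xiVi.
have ijN : form (ev i) (- ev j) = 0 by rewrite formE ij oppr0.
have gVE : gl_mx g^-1%g = Tv (ev i) (- ev j) 0.
  have e := Tv_inv 0 ii ij; rewrite -gE (lform0 (form_evev0 F hj)) in e.
  by rewrite -[LHS]mulmx1 -e mulmxA gl_Vmul mul1mx; congr Tv; ring.
have vqj : point (q - ev j) (- lform q (- ev j)).
  by apply: (point_eq (pointD vq (pointN (point_evi F hj)))) => //; ring.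
have iqj : form (ev i) (q - ev j) = 0 by rewrite formE iq ijN addr0.
have [A AE] := Tv_gl (- lform q (- ev j)) ii iqj.
have AE' : A = (xi^-1 * g * xi * g^-1)%g.
  apply: gl_mx_inj; rewrite gl_mxM E1 gVE Tv_add // AE.
  by congr (Tv _ _ _); ring.
have eA : EU A.
  apply: (EU_ev hi vqj _ AE).
  have : form (ev i) (q - ev j) = 0 := iqj.
  rewrite form_el => e0; have := ccV F hi.
  by rewrite mulrC => c0; rewrite -[LHS]mul1r -c0 -mulrA e0 mulr0.
have cci := ccV F hi.
pose a1 := cc i * al j; pose a2 := cc i * al k.
have if1 : form (ev i) f1 = a1 by rewrite e1 !formE form_evopp ij /a1; ring.
have if2 : form (ev i) f2 = a2 by rewrite e2 !formE form_evopp ik /a2; ring.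
have gf1 : gl_mx g *m f1 = f1 + a1 *: ev j.
  have lj1 := lform0 j1; by rewrite gE TvE mul0r scale0r addr0 lj1 scale0r subr0 if1.
have gf2 : gl_mx g *m f2 = f2 + a2 *: ev j.
  have lj2 := lform0 j2; by rewrite gE TvE mul0r scale0r addr0 lj2 scale0r subr0 if2.
(* g t^-1 g^-1 t is a transvection along e_j with this parameter, since g moves f1 and f2 by multiples of e_j *)
pose v3 : vec := (lam^! * a2^!) *: f1 - a1^! *: f2.
pose y3 := - a1^! * a2 + lam^! * a2^! * a1.
have jj := form_evev0 F hj.
have jv3 : form (ev j) v3 = 0 by rewrite /v3 !formE j1 j2 !mulr0 subr0.
have [B BE] := Tv_gl y3 jj jv3.
have vv3 : form v3 v3 = 0.
  by rewrite /v3 !formE f11 f12 (form0_sym f12) f22; ring.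
have BE' : B = (g * t^-1 * g^-1 * t)%g.
  have tVE : gl_mx t^-1%g = Tv f1 (- f2) 0.
    have e := Tv_inv 0 f11 f12; rewrite -tE (lform0 f22) in e.
    by rewrite -[LHS]mulmx1 -e mulmxA gl_Vmul mul1mx; congr Tv; ring.
  apply: gl_mx_inj; rewrite gl_mxM (gl_conj_Tv (EU_U eg) tVE) mulmxN gf1 gf2 tE BE.
  apply: mx_ext => w; rewrite -mulmxA !TvE /v3 !(formE, lfE).
  rewrite ?f11 ?f12 ?(lform0 f12) ?(lform0 f22) ?(lform0 f11) ?(lform0 (form0_sym f12)).
  rewrite ?j1 ?j2 ?(lform0 j1) ?(lform0 j2) !lformE /y3 /a1 /a2 !barE.
  by apply/colP => b; rewrite !mxE; ring : (lamV F).
have hAB : H (A * B)%g.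
  rewrite AE' BE'; move: hE1; congr H.
  by rewrite !(mulgA, mulgVK).
(* v3 = tau e_-i + s0 e_k + d e_j, and s0 is the product sought, up to a unit *)
have [s0 s0E] : exists s0 : R, s0 = a1^! * al i' by eexists.
have [tau tauE] : exists tau, tau = lam^! * a2^! * al j - a1^! * al k by eexists.
have [d dE] : exists d, d = - (lam^! * a2^! * al i') by eexists.
have v3E : v3 = tau *: ev i' + s0 *: ev k + d *: ev j.
  rewrite /v3 e1 e2 s0E tauE dE; apply/colP => b; rewrite !mxE; ring.
have jk := form_far F fjk; have kj := form_far F fkj.
have ji' := form_far F fji'; have ki' := form_far F fki'.
have i'j := form_far F fi'j; have i'k := form_far F fi'k.
have kk := form_evev0 F hk.
have ji := form_far F fji.
have iv3 : form (ev i) v3 = cc i * tau.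
  by rewrite v3E !formE form_evopp ij ik; ring.
have kv3 : form (ev k) v3 = 0 by rewrite v3E !formE ki' kk kj; ring.
have lkv3 := lform0 kv3.
clearbody v3.
have hy3 : y3 = - (a1^! * a2) - (- (a1^! * a2))^! * lam^!.
  by rewrite /y3 !barE; ring.
(* the component at -i is the only one seen by T(e_i; e_k, 0) *)
have itau : I tau.
  have [g' eg' g'E] := far_gl 1 fik; rewrite scale1r in g'E.
  have [z [Z ZE hZ]] := kill_step hi iqj ik vqj eA eg' AE g'E hAB.
  have jck : form (ev j) ((cc i * tau) *: ev k) = 0 by rewrite formE jk mulr0.
  have [W WE] := Tv_gl 0 jj jck.
  have e : (g' * B * g'^-1 = W * B)%g.
    apply: gl_mx_inj; rewrite (gl_conj_Tv (EU_U eg') BE) gl_mxM WE BE Tv_add //.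
    rewrite g'E !TvE mul0r !scale0r !addr0 ij (lform0 kj) lkv3 !scale0r !subr0 ?addr0 iv3.
    by rewrite mul0r scale0r addr0; congr (Tv _ _ _); [rewrite addrC|rewrite lformZl lkv3; ring].
  rewrite e mulgK in hZ.
  have [t3 [et3 t3j [t3i t3f] _ _]] := shift_gl 1 fij.
  have t3k : gl_mx t3 *m ev k = ev k.
    by apply: t3f => //; have [e' _ _ _] := far_neq fkj.
  have ick : form (ev i) ((cc i * tau) *: ev k) = 0 by rewrite formE ik mulr0.
  have [X XE] := Tv_gl 0 ii ick.
  have e3 : (t3 * W * t3^-1 = X * W)%g.
    apply: gl_mx_inj; rewrite (gl_conj_Tv (EU_U et3) WE) t3j -scalemxAr t3k scale1r.
    rewrite (Tv_split jj ii ji) //; last first.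
      by rewrite !formE kk !barE; ring.
    by rewrite gl_mxM XE WE scale0r Tv0 mulmx1.
  have hX := kill_long hi ZE et3 t3i hZ e3 XE ick.
  have hI : I (cc i * tau) by apply: (level_mem fik); exists X.
  have := levelIM (cc i)^! hI; congr I; ring : cci.
(* now drop the components at -i and j of v3, and use T(e_i; e_-j, 0), which moves e_j *)
have fji'2 : far j i' by [].
have [T hT TE] := itau _ _ fji'2.
pose v4 : vec := s0 *: ev k + d *: ev j.
pose y5 := y3 + (d - d^! * lam^!).
have jsk : form (ev j) (s0 *: ev k) = 0 by rewrite formE jk mulr0.
have [B1 B1E] := Tv_gl y5 jj jsk.
have i'i' := form_evev0 F hi'.
have eB : (B = B1 * T)%g.
  apply: gl_mx_inj; rewrite gl_mxM B1E TE BE.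
  have -> : Tv (ev j) (s0 *: ev k) y5 = Tv (ev j) (s0 *: ev k) y3 *m Tv (ev j) (d *: ev j) 0.
    rewrite Tv_self Tv_add ?form0r // addr0; congr (Tv _ _ _).
    by rewrite /y5 !lfE; ring.
  rewrite !Tv_add ?formE ?jk ?jj ?ji' ?mulr0 ?addr0 //; congr (Tv _ _ _).
    by rewrite v3E; apply/colP => b; rewrite !mxE; ring.
  by rewrite !lfE (lform0 kj) (lform0 ki') (lform0 ji'); ring.
have hAB1 : H (A * B1)%g.
  by apply: (HMr hT); move: hAB; rewrite eB mulgA.
have vsk : point (s0 *: ev k) y5.
  have v0 : point (s0 *: ev k) 0 by apply: point_ev.
  apply: (point_eq (point_min (S := full F) (x := d) Logic.I
    (point_min (S := full F) (x := - (a1^! * a2)) Logic.I v0))) => //.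
  by rewrite /y5 hy3; ring.
clearbody y5.
have fij' : far i (th_opp j) by rewrite far_oppr.
have hj' : th_hb (th_opp j) by rewrite th_hb_opp.
have [g2 eg2 g2E] := far_gl 1 fij'; rewrite scale1r in g2E.
have ij' := form_far F fij'.
have [z [Z ZE hZ]] := kill_step hi iqj ij' vqj eA eg2 AE g2E hAB1.
pose eps := cc (th_opp j) * lam^!.
have g2j : gl_mx g2 *m ev j = ev j + (- eps) *: ev i.
  rewrite g2E TvE ij mul0r !scale0r !addr0 lformE form_el evE th_oppK eqxx mulr1.
  by rewrite scaleNr.
have j'k : form (ev (th_opp j)) (ev k) = 0 by apply: form_far; rewrite far_oppl.
have g2k : gl_mx g2 *m ev k = ev k.
  by rewrite g2E TvE ik (lform0 j'k) mul0r !scale0r !addr0 subr0.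
pose e' := - eps.
have ei : form (e' *: ev i) (e' *: ev i) = 0 by rewrite !formE ii !mulr0.
have eik : form (e' *: ev i) (s0 *: ev k) = 0 by rewrite !formE ik !mulr0.
have eij : form (e' *: ev i) (y5 *: ev j) = 0 by rewrite !formE ij !mulr0.
have eiQ : form (e' *: ev i) (s0 *: ev k + y5 *: ev j) = 0 by rewrite formE eik eij addr0.
have [Q QE] := Tv_gl y5 ei eiQ.
have [X1 X1E] := Tv_gl y5 ei eik.
have [Y1 Y1E] := Tv_gl 0 ei eij.
have kj0 : form (s0 *: ev k) (ev j) = 0 by rewrite formE kj mulr0.
have ki0 : form (s0 *: ev k) (ev i) = 0 by rewrite formE (form_far F fki) mulr0.
have eQ : (g2 * B1 * g2^-1 * B1^-1 = Q)%g.
  have e1' : (g2 * B1 * g2^-1 = X1 * B1 * Y1)%g.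
    apply: gl_mx_inj; rewrite (gl_conj_Tv (EU_U eg2) B1E) g2j -scalemxAr g2k.
    have jei : form (ev j) (e' *: ev i) = 0 by rewrite formE ji mulr0.
    rewrite (Tv_split jj ei jei jsk eik (point_tr vsk)).
    by rewrite !gl_mxM X1E B1E Y1E.
  have uB1 : U B1 by apply: (Tv_inU (point_evi F hj) vsk jsk B1E).
  have e2' : (B1 * Y1 * B1^-1 = Y1)%g.
    apply: gl_mx_inj; rewrite (gl_conj_Tv uB1 Y1E) -!scalemxAr B1E !TvE jj ji.
    rewrite (lform0 kj0) (lform0 ki0) !mulr0 !scale0r !addr0 !subr0 Y1E.
    by [].
  have -> : (g2 * B1 * g2^-1 * B1^-1 = X1 * (B1 * Y1 * B1^-1))%g.
    by rewrite e1' !mulgA.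
  rewrite e2'; apply: gl_mx_inj; rewrite gl_mxM X1E Y1E QE Tv_add //.
  by congr (Tv _ _ _); rewrite !lfE (lform0 kj); ring.
rewrite eQ in hZ.
have [t5 [et5 t5k [t5j t5f] _ _]] := shift_gl 1 fjk.
have t5i : gl_mx t5 *m ev i = ev i.
  by apply: t5f => //; have [e0 _ _ _] := far_neq fik.
have ix3 : form (ev i) ((e'^! * s0) *: ev j) = 0 by rewrite formE ij mulr0.
have [X3 X3E] := Tv_gl 0 ii ix3.
have e5 : (t5 * Q * t5^-1 = X3 * Q)%g.
  apply: gl_mx_inj; rewrite (gl_conj_Tv (EU_U et5) QE) mulmxDr -!scalemxAr t5i t5j t5k.
  rewrite gl_mxM X3E QE !Tv_scale Tv_add ?formE ?ij ?ik ?mulr0 ?addr0 ?mulr0 //.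
  congr (Tv _ _ _); first by apply/colP => b; rewrite !mxE; ring.
  by rewrite !lfE (lform0 jk) (lform0 jj); ring.
have hX3 := kill_long hi ZE et5 t5i hZ e5 X3E ix3.
have hI : I (e'^! * s0) by apply: (level_mem fij); exists X3.
have := levelIM (- eps * cc i) hI; congr I.
rewrite s0E /a1 /e' /eps !barE.
by ring : (lamV F) cci (ccV F hj').
Qed.
End Column.

(** * Entries of the elements of H *)

Let IM r x : I x -> I (r * x). Proof. exact: levelIM. Qed.
Let ID x y : I x -> I y -> I (x + y). Proof. exact: levelID. Qed.
Let IB x y : I x -> I y -> I (x - y). Proof. exact: (levelIB). Qed.
Let IN x : I x -> I (- x). Proof. exact: (levelIN). Qed.
Let Ibar x : I x -> I x^!. Proof. exact: (levelI_bar). Qed.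
Let I0 : I 0. Proof. exact: (levelI0). Qed.

(** The i-th columns of elements of H are stable under the elementary matrices that fix e_i,
because H is normalized by EU; so a relation between entries that holds for all of them
may be polarized. *)
Definition orb i u := exists2 s, H s & u = gl_mx s *m ev i.

Lemma orb_EU i u g : orb i u -> EU g -> gl_mx g *m ev i = ev i -> orb i (gl_mx g *m u).
Proof.
move=> [s hs ->] eg gi; exists (g * s * g^-1)%g; first exact: (HJ).
have gVi : gl_mx g^-1%g *m ev i = ev i by rewrite -{1}gi mulmxA gl_Vmul mul1mx.
by rewrite !gl_mxM -!mulmxA gVi.
Qed.

Lemma orb_far_diag i u (a : idx) : orb i u -> far a i -> I (u a 0 * (u i 0)^!).
Proof.
move=> [s hs ->] fa; have [ha hi] := (far_hbl fa, far_hbr fa).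
have [k [fki fka]] := far_ex hn hi ha.
have f1 : far (th_opp a) i by rewrite far_oppl.
have f2 : far k (th_opp a) by rewrite far_oppr.
have := product_step hs f1 fki f2.
rewrite !form_er !th_oppK => h.
have := IM (cc a * (cc i)^!) h; congr I; rewrite !barE.
by ring : (ccV F ha) (ccV F hi).
Qed.

(** A shift that adds e_m to e_-i fixes e_i. *)
Lemma shiftN i m u : orb i u -> far m i -> exists u', [/\ orb i u',
   u' m 0 = u m 0 + u (th_opp i) 0,
   u' i 0 = u i 0 - shift_coef F m (th_opp i) * u (th_opp m) 0 &
   forall k, (k == m) = false -> (k == i) = false -> u' k 0 = u k 0].
Proof.
move=> ou f; have f' : far m (th_opp i) by rewrite far_oppr.
have [t [et _ tE]] := shift_ex F 1 f'.
have [e1 e2 e3 e4] := far_neq f; rewrite th_oppK in tE.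
have hi := far_hbr f.
exists (gl_mx t *m u); split.
- apply: orb_EU => //; rewrite tE !evE.
  by rewrite [th_opp i == i]eq_sym th_hb_neq // th_opp_eqC e3 /= !mulr0 !scale0r subr0 addr0.
- by rewrite tE !mxE !eqxx !andbT e1 /= !bar1; ring.
- by rewrite tE !mxE !eqxx !andbT e2 /= !bar1; ring.
- by move=> k k1 k2; rewrite tE !mxE !eqxx !andbT k1 k2 /=; ring.
Qed.

Lemma shift_coef_unit i j : far i j -> shift_coef F i j * (shift_coef F i j)^! = 1.
Proof.
move=> f; have hj' : th_hb (th_opp j) by rewrite th_hb_opp (far_hbr f).
rewrite shift_coefU !barE; ring : (ccV F hj') (ccV F (far_hbl f)) (lamV F).
Qed.

(** Compare orb_far_diag for u and for a shifted column in which u_i is replaced by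
u_i minus a multiple of u_b. *)
Lemma orb_far_far i u (a b : idx) : orb i u -> far a i -> far b i -> (a == th_opp b) = false ->
  I (u a 0 * (u b 0)^!).
Proof.
move=> ou fa fb ab; have fb' : far (th_opp b) i by rewrite far_oppl.
have [u' [ou' _ ui uk]] := shiftN ou fb'.
have [e1 _ _ _] := far_neq fa.
have := orb_far_diag ou' fa; rewrite ui uk // th_oppK => h.
have fbi' : far (th_opp b) (th_opp i) by rewrite far_oppr.
have := IM (shift_coef F (th_opp b) (th_opp i)) (IB (orb_far_diag ou fa) h); congr I.
by rewrite !barE; ring : (shift_coef_unit fbi').
Qed.

Lemma orb_opp_far i u (b : idx) : orb i u -> far b i -> I (u (th_opp i) 0 * (u b 0)^!).
Proof.
move=> ou fb; have [hb hi] := (far_hbl fb, far_hbr fb).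
have [m [fmi fmb]] := far_ex hn hi hb.
have [u' [ou' um _ uk]] := shiftN ou fmi.
have [e1 e2 e3 e4] := far_neq fmb; have [b1 _ _ _] := far_neq fb.
have := orb_far_far ou' fmi fb e3; rewrite um uk // => h.
by have := IB h (orb_far_far ou fmi fb e3); congr I; ring.
Qed.

Lemma orb_opp_opp i u : orb i u -> th_hb i -> I (u (th_opp i) 0 * (u (th_opp i) 0)^!).
Proof.
move=> ou hi; have [m [fmi _]] := far_ex hn hi hi.
have [u' [ou' um _ _]] := shiftN ou fmi.
have mm : (m == th_opp m) = false by apply: th_hb_neq; apply: far_hbl fmi.
have := orb_far_far ou' fmi fmi mm; rewrite um => h.
have h4 := orb_opp_far ou fmi.
have := IB (IB (IB h (orb_far_far ou fmi fmi mm)) h4) (Ibar h4); congr I.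
by rewrite !barE; ring.
Qed.

(** orb_far_diag for the shifted column has four terms; two are known. *)
Lemma orb_opp_diag i u m : orb i u -> far m i ->
  I (u (th_opp i) 0 * (u i 0)^! - (shift_coef F m (th_opp i))^! * (u m 0 * (u (th_opp m) 0)^!)).
Proof.
move=> ou fmi; have [u' [ou' um ui _]] := shiftN ou fmi.
have fm' : far (th_opp m) i by rewrite far_oppl.
have := orb_far_diag ou' fmi; rewrite um ui => h.
have h1 := orb_far_diag ou fmi; have h4 := IM (shift_coef F m (th_opp i))^! (orb_opp_far ou fm').
by have := ID (IB h h1) h4; congr I; rewrite !barE; ring.
Qed.

(** Apply T_k(x, y), which fixes e_i and adds a multiple of conj(x) mu u_0 to u_k. *)
Lemma orb_zero i u (a : idx) x y : orb i u -> th_hb i -> (far a i \/ a = th_opp i) -> dl F x y ->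
  I (u a 0 * ((u o 0)^! * mu * x)).
Proof.
move=> ou hi ai d.
have ha : th_hb a by case: ai => [/far_hbl//|->]; rewrite th_hb_opp.
have [k [fki fka]] := far_ex hn hi ha; have hk := far_hbl fki.
have d' : dl F x y^!^! by rewrite barK.
have [g eg gE] := e0_gl hk d'.
have gi : gl_mx g *m ev i = ev i.
  rewrite gE TvE (form_far F fki) lformZl (lform0 (form_e0_ev F hi)).
  by rewrite !mulr0 !scale0r !addr0 subr0.
have ou' := orb_EU ou eg gi.
have fk' : far (th_opp k) i by rewrite far_oppl.
have [e1 e2 e3 e4] := far_neq fka.
have prod u' (b : idx) : orb i u' -> far b i -> (a == th_opp b) = false -> I (u' a 0 * (u' b 0)^!).
  by move=> o' fb ab; case: ai => [fa|->]; [exact: (orb_far_far o' fa fb ab)|exact: (orb_opp_far o' fb)].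
have ak : (a == th_opp (th_opp k)) = false by rewrite th_oppK.
have h1 := prod _ _ ou' fki e4; have h2 := prod _ _ ou fki e4.
have h3 := IM (y * (cc k)^!) (prod _ _ ou fk' ak).
rewrite gE !Tv_e0_coord // e2 eqxx /= in h1.
have := ID (IB h2 h1) h3; congr I; rewrite !barE.
by ring : (lamV F).
Qed.

(** b(u, s e_-i) is a unit, which writes any x as a combination of the products x conj(u_k)
and of an odd term. *)
Lemma unimod i u : orb i u -> th_hb i -> exists w y, dl F (w o 0) y /\
  forall x, x = x * ((u o 0)^! * mu * w o 0)
     + \sum_(k | th_hb k) (cc k * w (th_opp k) 0) * (x * (u k 0)^!).
Proof.
move=> [s hs ->] hi; have us := HU hs.
have hi' : th_hb (th_opp i) by rewrite th_hb_opp.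
pose w := (cc i)^! *: (gl_mx s *m ev (th_opp i)).
have vw : point w 0.
  apply: (point_eq (pointZ (S := full F) (a := (cc i)^!) Logic.I (U_point us (point_evi F hi')))) => //.
  by rewrite mul0r.
exists w; eexists; split; first by case: vw => _ d; apply: d.
move=> x.
have : form (gl_mx s *m ev i) w = 1.
  by rewrite /w formE U_form // form_evopp mulrC ccV.
rewrite form_split => e; rewrite -[LHS]mulr1 -[in LHS]e mulrDr; congr (_ + _).
by rewrite big_distrr /=; apply: eq_bigr => k _; ring.
Qed.

Lemma I_sum (Q : pred idx) (E : idx -> R) : (forall k, Q k -> I (E k)) ->
  I (\sum_(k | Q k) E k).
Proof. by move=> h; apply: (big_ind I). Qed.

(** Expand u_a by unimodularity. All terms are in I except the one at -a, so that
u_a = u_a conj(u_-a) r modulo I, and u_a conj(u_-a) is, modulo I, a multiple of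
u_-i conj(u_i). Multiplying the first congruence by a further conj(u_-a) gives a term in I. *)
Lemma orb_far i u (a : idx) : orb i u -> far a i -> I (u a 0).
Proof.
move=> ou fa; have [ha hi] := (far_hbl fa, far_hbr fa).
have ha' : th_hb (th_opp a) by rewrite th_hb_opp.
have hi' : th_hb (th_opp i) by rewrite th_hb_opp.
have [w [y [d ex]]] := unimod ou hi.
have z0 := orb_zero ou hi (or_introl fa) d.
have fa' : far (th_opp a) i by rewrite far_oppl.
have fia : far i a by rewrite far_sym.
pose r := cc (th_opp a) * w a 0.
have h1 : I (u a 0 - r * (u a 0 * (u (th_opp a) 0)^!)).
  rewrite {1}(ex (u a 0)) (bigD1 (th_opp a)) //= th_oppK.
  set s1 := \sum_(_ | _) _.
  suff : I s1 by move=> h; have := ID z0 h; congr I; rewrite /r; ring.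
  apply: I_sum => k /andP[hk ka]; apply: IM.
  case: (hb_cases hk hi) => [->|->|fk]; first exact: orb_far_diag.
  - have fia' : far i a by [].
    have := Ibar (orb_opp_far ou fa); congr I.
    by rewrite !barE mulrC.
  - have ak : (a == th_opp k) = false.
      by apply/negbTE/negP => /eqP e; rewrite e th_oppK eqxx in ka.
    exact: (orb_far_far ou fa fk ak).
have h2 := orb_opp_diag ou fa; have h4 := orb_opp_far ou fa'.
have fai' : far a (th_opp i) by rewrite far_oppr.
have := shift_coef_unit fai'; set e := shift_coef _ _ _ in h2 *; move=> e1.
pose A := u a 0; pose B := (u (th_opp a) 0)^!.
(* with A = u_a and B = conj(u_-a) *)
have h5 : I (A * B * r - r * (A * B) * r * B).
  have := IM (r * B) h1; congr I; rewrite /A /B; ring.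
have h6 : I (A * B * r * r * B).
  have h7 := IM (e * r * r * B) h2.
  have h8 := IM (e * r * r * (u i 0)^!) h4.
  have := IB h8 h7; congr I; rewrite /A /B; ring : e1.
have := ID h1 (ID h5 h6); congr I; rewrite /A /B; ring.
Qed.

(** Expand u_-i by unimodularity; the term u_-i conj(u_i) is in I by orb_opp_diag and orb_far. *)
Lemma orb_opp i u : orb i u -> th_hb i -> I (u (th_opp i) 0).
Proof.
move=> ou hi; have hi' : th_hb (th_opp i) by rewrite th_hb_opp.
have [w [y [d ex]]] := unimod ou hi.
have z0 := orb_zero ou hi (or_intror (erefl (th_opp i))) d.
rewrite (ex (u (th_opp i) 0)); apply: ID => //; apply: I_sum => k hk; apply: IM.
case: (hb_cases hk hi) => [->|->|fk]; [|exact: orb_opp_opp|exact: orb_opp_far].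
have [m [fmi _]] := far_ex hn hi hi.
have h := orb_opp_diag ou fmi.
have h7 := IM ((shift_coef F m (th_opp i))^! * (u (th_opp m) 0)^!) (orb_far ou fmi).
by have := ID h h7; congr I; ring.
Qed.

Lemma offdiag s i k : H s -> th_hb i -> th_hb k -> k != i -> I ((gl_mx s *m ev i) k 0).
Proof.
move=> hs hi hk ki; have ou : orb i (gl_mx s *m ev i) by exists s.
case: (hb_cases hk hi) => [e|->|f]; [by rewrite e eqxx in ki|exact: (orb_opp ou hi)|exact: (orb_far ou f)].
Qed.

(** Compare the off-diagonal entries of s and of its conjugate by a shift. *)
Lemma diag_far s i j : H s -> far i j ->
  I ((gl_mx s *m ev i) i 0 - (gl_mx s *m ev j) j 0).
Proof.
move=> hs f; have [hi hj] := (far_hbl f, far_hbr f).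
have [t [et _ tE]] := shift_ex F 1 f.
have [e1 e2 e3 e4] := far_neq f.
have tj : gl_mx t *m ev j = ev j + ev i.
  by rewrite tE !evE eqxx th_opp_eqC e3 /= !mulr1 scale1r mulr0 scale0r subr0.
have ti : gl_mx t *m ev i = ev i.
  rewrite tE !evE e2 eq_sym (th_hb_neq hi) /=.
  by rewrite !mulr0 !scale0r addr0 subr0.
pose s' := (t * s * t^-1)%g; have hs' : H s' by apply: (HJ).
have s't v : gl_mx s' *m (gl_mx t *m v) = gl_mx t *m (gl_mx s *m v).
  by rewrite !mulmxA -!gl_mxM /s' mulgVK.
have ci v : (gl_mx t *m v) i 0 = v i 0 + v j 0.
  by rewrite tE !mxE !eqxx !andbT e3 /=; ring.
have Ej : (gl_mx s' *m ev j) i 0 + (gl_mx s' *m ev i) i 0 =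
    (gl_mx s *m ev j) i 0 + (gl_mx s *m ev j) j 0.
  by rewrite -ci -s't tj mulmxDr [RHS]mxE.
have Ei : (gl_mx s' *m ev i) i 0 = (gl_mx s *m ev i) i 0 + (gl_mx s *m ev i) j 0.
  by rewrite -ci -s't ti.
have nij : i != j by rewrite e1.
have nji : j != i by rewrite e2.
have o1 := offdiag hs' hj hi nij; have o2 := offdiag hs hj hi nij.
have o3 := offdiag hs hi hj nji.
have := IB (IB o2 o1) o3; congr I.
have -> : (gl_mx s *m ev j) i 0 = (gl_mx s' *m ev j) i 0 + (gl_mx s' *m ev i) i 0
   - (gl_mx s *m ev j) j 0 by rewrite Ej; ring.
by rewrite Ei; ring.
Qed.

Lemma diag s i j : H s -> th_hb i -> th_hb j ->
  I ((gl_mx s *m ev i) i 0 - (gl_mx s *m ev j) j 0).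
Proof.
move=> hs hi hj; have [k [fki fkj]] := far_ex hn hi hj.
have fik : far i k by rewrite far_sym.
by have := ID (diag_far hs fik) (diag_far hs fkj); congr I; ring.
Qed.

(** The k-th coordinate of T_k(x, y) u is in I by orb_far. *)
Lemma zero_row s i x y : H s -> th_hb i -> dl F x y ->
  I (x^! * mu * (gl_mx s *m ev i) o 0).
Proof.
move=> hs hi d; have [k [fki _]] := far_ex hn hi hi; have hk := far_hbl fki.
have d' : dl F x y^!^! by rewrite barK.
have [g eg gE] := e0_gl hk d'.
have gi : gl_mx g *m ev i = ev i.
  rewrite gE TvE (form_far F fki) lformZl (lform0 (form_e0_ev F hi)).
  by rewrite !mulr0 !scale0r !addr0 subr0.
have ou : orb i (gl_mx s *m ev i) by exists s.
have h1 := orb_far (orb_EU ou eg gi) fki; have h2 := orb_far ou fki.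
have fk' : far (th_opp k) i by rewrite far_oppl.
have h3 := IM (y^! * cc k) (orb_far ou fk').
rewrite gE Tv_e0_coord // eqxx /= in h1.
have := IM lam (ID (IB h2 h1) h3); congr I.
by ring : (lamV F).
Qed.

(** Modulo I only the term with s_ii remains in b(s e_i, s e_-i) = b(e_i, e_-i). *)
Lemma diag_norm s i : H s -> th_hb i ->
  I ((gl_mx s *m ev i) i 0 * ((gl_mx s *m ev i) i 0)^! - 1).
Proof.
move=> hs hi; have hi' : th_hb (th_opp i) by rewrite th_hb_opp.
pose u := gl_mx s *m ev i; pose w := gl_mx s *m ev (th_opp i).
have uw : form u w = cc i by rewrite U_form ?form_evopp //; apply: HU.
rewrite form_split (bigD1 i) //= in uw.
have vw : point w 0 by apply: U_point; [apply: HU|apply: point_evi].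
have z := Ibar (zero_row hs hi (vw.2 : dl F _ _)).
have hd := IM ((u i 0)^! * cc i) (diag hs hi' hi).
have hz : I ((u o 0)^! * mu * w o 0).
  have := IM lam z; congr I; rewrite !barE -/u; ring : (lamV F).
have hsum : I (\sum_(k | th_hb k && (k != i)) (u k 0)^! * cc k * w (th_opp k) 0).
  apply: I_sum => k /andP[hk ki]; rewrite -mulrA mulrC; apply: IM; apply: Ibar.
  exact: offdiag.
set sm := \sum_(_ | _) _ in uw hsum.
have := IM (- (cc i)^!) (ID (ID hz hsum) hd); congr I.
have e : sm = cc i - (u o 0)^! * mu * w o 0 - (u i 0)^! * cc i * w (th_opp i) 0.
  by rewrite -[X in X - _ - _]uw; ring.
by rewrite e -/u -/w; ring : (ccV F hi).
Qed.

(** * Columns of the elements of H modulo the level *)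

Notation Om := levelOm.
Let IOm : is_odd_form_ideal F I Om := level_ideal.
Notation om := (om Om).
Notation eqv := (@eqv R F n I Om IOm).
Notation Ur := (Urel F n I Om).
Notation CU := (CUrel F n I Om).
Notation D2 := (double IOm).
Notation point2 := (qpoint D2).
Notation ev2 := (@bvec (R * R)%type n).

(** The use of pairs: two congruent transvections, one of which is elementary over R * R,
differ by an element of EU((R,Delta),(I,Omega)), hence of H. *)
Lemma pairEU_Tv u u' v v' y y' g g' (U2 V2 : 'cV[R * R]_(n.*2.+1)) :
  U2 = pv u u' -> V2 = pv v v' -> gl_mx g = Tv u v y -> gl_mx g' = Tv u' v' y' ->
  pairEU I Om (transv (pherm F) U2 V2 ((y, y') : R * R)) -> EU g' /\ H (g * g'^-1)%g.
Proof.
move=> -> -> gE gE' [c [d [ed rd e1 e2]]].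
have -> : g = c by apply: gl_mx_inj; rewrite -e1 fst_Tv !map_fst_pv gE.
have -> : g' = d by apply: gl_mx_inj; rewrite -e2 snd_Tv !map_snd_pv gE'.
by split=> //; apply: (EUrel_sub).
Qed.

Lemma I_qpol s i : H s -> th_hb i -> I (qpol (gl_mx s *m ev i) (gl_mx s *m ev i)).
Proof.
move=> hs hi; apply: (big_ind I) => // b pb.
have hb : th_hb b by rewrite th_hbE pb.
have hb' : th_hb (th_opp b) by rewrite th_hb_opp.
case: (eqVneq b i) => [ebi|ne].
  by apply: IM; apply: (offdiag) => //; rewrite ebi eq_sym th_hb_neq.
by rewrite mulrC; apply: IM; apply: Ibar; apply: (offdiag).
Qed.

Section Column.
Variables (s : G) (i k l : idx).
Hypothesis Hs : H s.
Hypotheses (fki : far k i) (fli : far l i) (flk : far l k).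
Notation u := (gl_mx s *m ev i).
Notation i' := (th_opp i).

Let hi : th_hb i. Proof. exact: far_hbr fki. Qed.
Let hi' : th_hb i'. Proof. by rewrite th_hb_opp. Qed.
Let hk : th_hb k. Proof. exact: far_hbl fki. Qed.
Let hl : th_hb l. Proof. exact: far_hbl fli. Qed.
Let us : U s. Proof. exact: HU. Qed.
Let fik : far i k. Proof. by rewrite far_sym. Qed.
Let fil : far i l. Proof. by rewrite far_sym. Qed.
Let fkl : far k l. Proof. by rewrite far_sym. Qed.

(** The transvection t along f with parameter u, where f lives on -i and k and is orthogonal
to u, is elementary; A = s^-1 t s is a transvection along e_i, and A t^-1 is in H. Modulo H, the
off-diagonal entries of u may be dropped: t becomes T(c e_k; u_i e_i + u_0 e_0, y) and A becomes
T(e_i; v_k e_k + v_0 e_0, y1). Their quotient, compared with its conjugate by a shift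
of e_k, isolates T(c e_l; u_i e_i + u_0 e_0, y) up to a matrix T_il; a last shift splits
off the part on e_i. *)
Lemma column_step :
  Hmx (Tv (ev l) ((- u i 0 * (cc i)^! * u o 0) *: ev o)
     ((qpol u u)^! * ((- (u i 0)^! * cc i) * (- (u i 0)^! * cc i)^!))).
Proof.
have ii := form_evev0 F hi; have kk := form_evev0 F hk; have ll := form_evev0 F hl.
have ik := form_far F fik; have ki := form_far F fki.
have il := form_far F fil; have li := form_far F fli.
have kl := form_far F fkl; have lk := form_far F flk.
have ke0 := form_ev_e0 F hk; have le0 := form_ev_e0 F hl; have ie0 := form_ev_e0 F hi.
have e0k := form_e0_ev F hk; have e0l := form_e0_ev F hl; have e0i := form_e0_ev F hi.
have fki' : far k i' by rewrite far_oppr.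
have fi'k : far i' k by rewrite far_oppl far_sym.
have fli' : far l i' by rewrite far_oppr.
have [c cE] : exists c0 : R, c0 = - (u i 0)^! * cc i by eexists.
have [y2 y2E] : exists y2 : R, y2 = (qpol u u)^! by eexists.
have [u0 u0E] : exists u0 : vec, u0 = u i 0 *: ev i + u o 0 *: ev o by eexists.
pose al := form u (ev k).
have alE : al = (u (th_opp k) 0)^! * cc (th_opp k) by rewrite /al form_er.
have Ial : I al.
  rewrite alE mulrC; apply: IM; apply: Ibar; apply: (offdiag) => //.
    by rewrite th_hb_opp.
  by rewrite th_opp_eqC; case/and4P: fki.
have ci' : form u (ev i') = - c by rewrite form_er th_oppK cE; ring.
have [f fE] : exists f : vec, f = al *: ev i' + c *: ev k by eexists.
have fu : form u f = 0 by rewrite fE !formE ci' -/al; ring.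
have su : point u 0 by apply: U_point => //; apply: point_evi.
(* modulo (I, Omega), u is its part u0 on e_i and e_0, and f is c e_k *)
have ex0 : eqv u 0 u0 y2.
  rewrite u0E y2E; apply: eqv_hb => //; first by rewrite subrr.
  by move=> b hb bi; apply: (offdiag).
have [f2 f2E] : exists f2 : 'cV[R * R]_(n.*2.+1),
   f2 = ((al, 0) : R * R) *: ev2 i' + ((c, c) : R * R) *: ev2 k by eexists.
have f2p : f2 = pv f (c *: ev k).
  rewrite f2E fE -!pv_ev -!pvZ -pvD scale0r add0r //.
have a1 : fA D2 ((al, 0) : R * R) by rewrite /= /dA subr0.
have a2 : fA D2 ((c, c) : R * R) by rewrite /= /dA subrr.
have vf2 : point2 f2 0.
  rewrite f2E; apply: (point_eq (pointD (point_ev (n := n) hi' a1) (point_ev (n := n) hk a2))) => //.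
  by rewrite !lfE (lform0 (form_far (pherm F) fi'k)); ring.
have [[l1 l2 l3 l4] [l5 l6 l7 l8]] := (far_neq flk, far_neq fli').
have f2l : f2 l 0 = 0 by rewrite f2E !mxE !eqxx !andbT l1 l5 /= !mulr0 addr0.
have f2l' : f2 (th_opp l) 0 = 0.
  by rewrite f2E !mxE !eqxx !andbT [th_opp l == i']th_opp_eqC th_opp_eqC l3 l7 /= !mulr0 addr0.
have ck0 : form (c *: ev k) u0 = 0 by rewrite u0E !formE ki ke0; ring.
have form2 : hform (pherm F) f2 (pv u u0) = 0.
  by rewrite f2p form_pv (form0_sym fu) ck0.
have PT := P_avoid (pairEU_elem_closed n IOm) vf2 hl f2l f2l' ex0 form2.
have vf : point f 0.
  have v1 : point (al *: ev i') 0 by apply: point_ev.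
  have v2 : point (c *: ev k) 0 by apply: point_ev.
  rewrite fE; apply: (point_eq (pointD v1 v2)) => //.
  by rewrite !lfE (lform0 (form_far F fi'k)); ring.
have ff := point_sing vf.
have [t tE] := Tv_gl 0 ff (form0_sym fu).
have ckk : form (c *: ev k) (c *: ev k) = 0 by rewrite !formE kk; ring.
have [t0 t0E] := Tv_gl y2 ckk ck0.
have [et0 ht0] := pairEU_Tv f2p (erefl _) tE t0E PT.
have et : EU t.
  apply: EU_mx tE; apply: (P_avoid (EUmx_elem_closed F n) vf hl _ _ su (form0_sym fu)).
    by rewrite fE !mxE !eqxx !andbT l1 l5 /= !mulr0 addr0.
  by rewrite fE !mxE !eqxx !andbT [th_opp l == i']th_opp_eqC th_opp_eqC l3 l7 /= !mulr0 addr0.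
have usV := UV us.
pose q := gl_mx s^-1%g *m f.
(* A is the transvection along s^-1 u = e_i *)
have suV : gl_mx s^-1%g *m u = ev i by rewrite mulmxA gl_Vmul mul1mx.
have [v vE] : exists v : vec, v = (- lam^!) *: q by eexists.
pose A := (s^-1 * t * s)%g.
have AE : gl_mx A = Tv (ev i) v 0.
  by have := gl_conj_Tv usV tE; rewrite invgK suV -/q => ->; rewrite Tv_swap vE.
have hAt : H (A * t0^-1)%g.
  have h1 : H (A * t^-1)%g.
    by have := HM (HV Hs) (HJ et Hs); rewrite /A !mulgA.
  by have := HM h1 ht0; rewrite !(mulgA, mulgVK).
have vq : point q 0 by apply: U_point.
have vv : point v 0.
  by rewrite vE; apply: (point_eq (pointZ (S := full F) (a := - lam^!) Logic.I vq)); rewrite ?mul0r.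
have iv : form (ev i) v = 0 by rewrite vE formE -suV U_form // fu mulr0.
have vi : v i' 0 = 0.
  have e := iv; rewrite form_el in e; have cci := ccV F hi.
  by rewrite -[LHS]mul1r -cci [cc i * _]mulrC -mulrA e mulr0.
have [v0 v0E] : exists v0 : vec, v0 = v k 0 *: ev k + v o 0 *: ev o by eexists.
pose y1 := (qpol v v)^!.
have hsV := HV Hs.
have exv : eqv v 0 v0 y1.
  rewrite v0E; apply: eqv_hb => //; first by rewrite subrr.
  move=> b hb bk; rewrite vE mxE; apply: IM; rewrite /q fE mulmxDr -!scalemxAr !mxE.
  apply: ID; first by rewrite mulrC; apply: IM.
  by apply: IM; have := offdiag hsV hk hb bk; rewrite mxE.
clearbody y1.
have iv0 : form (ev i) v0 = 0 by rewrite v0E !formE ik ie0; ring.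
have [A0 A0E] := Tv_gl y1 ii iv0.
have [eA0 hA0] : EU A0 /\ H (A * A0^-1)%g.
  apply: (pairEU_Tv (esym (pv_ev R i)) (erefl _) AE A0E).
  apply: (P_ev (pairEU_elem_closed n IOm) hi exv).
  rewrite mxE vi v0E !mxE !eqxx !andbT /=.
  have [m1 m2 m3 m4] := far_neq fki'; rewrite m2 th_opp_eqC th_opp_zero.
  have := hi; rewrite /th_hb => /negbTE->; rewrite /= !mulr0 addr0.
  by [].
have hT : H (t0 * A0^-1)%g.
  have := HM (HV hAt) hA0; congr H.
  by rewrite !(invgM, invgK, mulgA, mulgVK).
(* adding e_l to e_k multiplies t0 by X, a transvection along e_l, and A0 by W, a matrix T_il *)
have [t4 [et4 t4k [t4l t4f] t4o _]] := shift_gl 1 flk.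
have t4i : gl_mx t4 *m ev i = ev i by apply: t4f => //; have [e _ _ _] := far_neq fik.
rewrite scale1r in t4k.
have cll : form (c *: ev l) (c *: ev l) = 0 by rewrite !formE ll; ring.
have cl0 : form (c *: ev l) u0 = 0 by rewrite u0E !formE li le0; ring.
have ckl : form (c *: ev k) (c *: ev l) = 0 by rewrite !formE kl; ring.
have clk : form (c *: ev l) (y2 *: (c *: ev k)) = 0 by rewrite !formE lk; ring.
have [X XE] := Tv_gl y2 cll cl0.
have [Z ZE] := Tv_gl 0 cll clk.
have vu0 := (eqv_point ex0).2.
have t4u : gl_mx t4 *m u0 = u0 by rewrite u0E mulmxDr -!scalemxAr t4i t4o.
have e1 : (t4 * t0 * t4^-1 = X * t0 * Z)%g.
  apply: gl_mx_inj; rewrite (gl_conj_Tv (EU_U et4) t0E) -scalemxAr t4k t4u scalerDr.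
  by rewrite (Tv_split ckk cll ckl ck0 cl0 (point_tr vu0)) !gl_mxM XE t0E ZE.
have Iy2 : I y2 by rewrite y2E; apply: Ibar; apply: I_qpol.
have hZ : H Z.
  rewrite Tv_scale !scalerA !mul0r in ZE; apply: (level_gl flk _ ZE).
  by have := IM (c^! * c) Iy2; congr I; ring.
have [b bE] : exists b : R, b = v k 0 by eexists.
have ibl : form (ev i) (b *: ev l) = 0 by rewrite formE il mulr0.
have [W WE] := Tv_gl 0 ii ibl.
have lv0 : form (ev l) v0 = 0 by rewrite v0E !formE lk le0; ring.
have e2 : (t4 * A0 * t4^-1 = W * A0)%g.
  apply: gl_mx_inj; rewrite (gl_conj_Tv (EU_U et4) A0E) t4i gl_mxM WE A0E Tv_add //.
  congr (Tv _ _ _); last by rewrite !lfE (lform0 lv0); ring.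
  rewrite v0E mulmxDr -!scalemxAr t4k t4o -bE.
  by apply/colP => d; rewrite !mxE; ring.
have e3 : (W * A0 = A0 * W)%g.
  apply: gl_mx_inj; rewrite !gl_mxM WE A0E !Tv_add //.
  congr (Tv _ _ _); first by rewrite addrC.
  by rewrite !lfE (lform0 lv0) (lform0 (form0_sym lv0)); ring.
have e4 : (t0 * W * t0^-1 = W)%g.
  apply: gl_mx_inj; rewrite (gl_conj_Tv (EU_U et0) WE) t0E -scalemxAr !TvE WE.
  have z1 : form (c *: ev k) (ev i) = 0 by rewrite formE ki mulr0.
  have z2 : form (c *: ev k) (ev l) = 0 by rewrite formE kl mulr0.
  have z4 : form u0 (ev l) = 0 by rewrite u0E !formE il e0l; ring.
  have z3 : form u0 (ev i) = 0 by rewrite u0E !formE ii e0i; ring.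
  by rewrite z1 z2 (lform0 z3) (lform0 z4) !mulr0 !scale0r !addr0 !subr0.
have hXW : H (X * W^-1)%g.
  have h1 := Hcomm et4 hT.
  have e5 : (t4 * (t0 * A0^-1) * t4^-1 * (t0 * A0^-1)^-1 =
     X * (t0 * Z * t0^-1) * (t0 * W * t0^-1)^-1)%g.
    have -> : (t4 * (t0 * A0^-1) * t4^-1 = (t4 * t0 * t4^-1) * (t4 * A0 * t4^-1)^-1)%g.
      by rewrite !(invgM, invgK, mulgA, mulgVK).
    rewrite e1 e2 e3.
    by rewrite !(invgM, invgK, mulgA, mulgVK).
  rewrite e5 e4 in h1.
  have h2 : H (t0 * Z * t0^-1)%g by apply: (HJ).
  have [tw eW tWE] := far_gl b fil.
  have eqW : W = tw by apply: gl_mx_inj; rewrite WE tWE.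
  have eW' : EU W by rewrite eqW.
  have := HM h1 (HJ eW' (HV h2)).
  by rewrite !(invgM, invgK, mulgA, mulgVK, mulgK).
have lu (x : R) : form (ev l) (x *: ev o) = 0 by rewrite formE le0 mulr0.
have li' (x : R) : form (ev l) (x *: ev i) = 0 by rewrite formE li mulr0.
have lk' (x : R) : form (ev l) (x *: ev k) = 0 by rewrite formE lk mulr0.
have [X0 X0E] := Tv_gl (y2 * (c * c^!)) ll (lu (c^! * u o 0)).
have [b' b'E] : exists b0 : R, b0 = c^! * u i 0 + b^! * lam^! by eexists.
have [W' W'E] := Tv_gl 0 ll (li' b').
have [V VE] := Tv_gl 0 ll (li' (b^! * lam^!)).
have WV : W^-1%g = V.
  rewrite -[V](mulKg W); suff -> : (W * V = 1)%g by rewrite mulg1.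
  apply: gl_mx_inj; rewrite gl_mxM WE.
  have -> : gl_mx V = Tv (ev i) (- (b *: ev l)) 0.
    rewrite VE -scaleNr [RHS]Tv_swap Tv_scale !mul0r !scalerA barN.
    by congr (Tv _ (_ *: _) _); ring.
  rewrite Tv_add // ?formE ?il ?mulr0 ?oppr0 //.
  rewrite -[RHS](Tv0 F (ev i)) subrr; congr (Tv _ _ _).
  by rewrite !lfE (lform0 ll); ring.
have e6 : (X * W^-1 = X0 * W')%g.
  rewrite WV; apply: gl_mx_inj; rewrite !gl_mxM XE VE X0E W'E Tv_scale.
  have lcu : form (ev l) (c^! *: u0) = 0 by rewrite u0E !formE li le0; ring.
  rewrite !Tv_add //; congr (Tv _ _ _).
    by rewrite u0E b'E; apply/colP => d; rewrite !mxE; ring.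
  have z3 : form u0 (ev i) = 0 by rewrite u0E !formE ii e0i; ring.
  by rewrite !lfE (lform0 z3) (lform0 e0i); ring.
(* W' involves e_i and X0 does not *)
have [t5 [et5 t5i [t5k t5f] t5o _]] := shift_gl 1 fki.
rewrite scale1r in t5i.
have t5l : gl_mx t5 *m ev l = ev l by apply: t5f => //; have [] := far_neq fli.
have [L LE] := Tv_gl 0 ll (lk' b').
have hXW' : H (X0 * W')%g by rewrite -e6.
have hL : H L.
  have := Hcomm et5 hXW'; congr H.
  have c1 : (t5 * X0 * t5^-1 = X0)%g.
    by apply: gl_mx_inj; rewrite (gl_conj_Tv (EU_U et5) X0E) t5l -scalemxAr t5o X0E.
  have c2 : (t5 * W' * t5^-1 = L * W')%g.
    apply: gl_mx_inj; rewrite (gl_conj_Tv (EU_U et5) W'E) t5l -scalemxAr t5i.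
    rewrite gl_mxM LE W'E Tv_add // scalerDr addrC; congr (Tv _ _ _).
    by rewrite !lfE (lform0 ki); ring.
  have c3 : (X0 * L = L * X0)%g.
    apply: gl_mx_inj; rewrite !gl_mxM LE X0E !Tv_add // addrC; congr (Tv _ _ _).
    by rewrite !lfE (lform0 e0k) (lform0 ke0); ring.
  have -> : (t5 * (X0 * W') * t5^-1 = (t5 * X0 * t5^-1) * (t5 * W' * t5^-1))%g.
    by rewrite !mulgA mulgVK.
  by rewrite c1 c2 mulgA c3 !(invgM, invgK, mulgA, mulgVK, mulgK).
have Ib' : I b' by apply: (level_mem flk); rewrite -LE; exists L.
have hW' : H W' by apply: (level_gl fli Ib' W'E).
have cbar : c^! = - u i 0 * (cc i)^!.
  by rewrite cE !barE; ring : (ccV F hi) (lamV F).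
have hX0 := HMr hW' hXW'.
exists X0 => //.
by rewrite X0E -cE -y2E -cbar.
Qed.
End Column.
(** column_step yields the odd coordinate multiplied by u_i and a unit; the right action of
conj(u_i) turns u_i into u_i conj(u_i). *)
Lemma column_norm s i : H s -> th_hb i ->
  om ((gl_mx s *m ev i) o 0 * ((gl_mx s *m ev i) i 0 * ((gl_mx s *m ev i) i 0)^!))
     (qpol (gl_mx s *m ev i) (gl_mx s *m ev i) *
        ((gl_mx s *m ev i) i 0 * ((gl_mx s *m ev i) i 0)^!) ^+ 2).
Proof.
move=> hs hi; have us := HU hs.
have vu : point (gl_mx s *m ev i) 0 by apply: U_point => //; apply: point_evi.
have Iq := I_qpol hs hi.
have step k l := @column_step s i k l hs.
have zr x y := @zero_row s i x y hs hi.
move: vu Iq step zr; set u := _ *m _ => -[_ du] Iq step zr.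
have {}du : dl F (u o 0) (qpol u u) by apply: (dl_eq du); rewrite ?barE ?addr0.
pose c := - (u i 0)^! * cc i.
pose x := - u i 0 * (cc i)^! * u o 0.
pose y := (qpol u u)^! * (c * c^!).
have dx : dl F x y^!.
  apply: (dl_eq (dlZ (- u i 0 * (cc i)^!) du)); first by rewrite mulrC.
  by rewrite /y /c !barE; ring : (lamV F) (ccV F hi).
have Iy : I y by rewrite /y mulrC; apply: IM; apply: Ibar.
have omx : om x y^!.
  split=> //=; first exact: Ibar.
    by move=> x' y' d; have := IM (- u i 0 * (cc i)^!) (zr _ _ d); congr I; rewrite /x; ring.
  move=> l hl; rewrite barK.
  have [l' [fi fl]] := far_ex hn hi hl.
  have [k [fki fkl]] := far_ex hn hi (far_hbl fi).
  have flk : far l' k by rewrite far_sym.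
  have h := step k l' fki fi flk.
  have fl' : far l l' by rewrite far_sym.
  have := level_extra fl' (r := 1) dx _ h.
  by rewrite !mulr1 bar1 !mulr1 => hh; apply: hh; apply: IM.
apply: (om_eq (omZ IOm (- cc i * (u i 0)^!) omx)).
  by rewrite /x; ring : (ccV F hi).
by rewrite /y /c !barE expr2; ring : (ccV F hi) (lamV F).
Qed.

(** u_i conj(u_i) is 1 modulo I, and Delta o I is in Omega. The discrepancy in the second
component is of the form z - conj(z) lam with z in I, by the vanishing of tr. *)
Lemma column s i : H s -> th_hb i ->
  om ((gl_mx s *m ev i) o 0) (qpol (gl_mx s *m ev i) (gl_mx s *m ev i)).
Proof.
move=> hs hi; have us := HU hs.
have vu : point (gl_mx s *m ev i) 0 by apply: U_point => //; apply: point_evi.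
have Iq := I_qpol hs hi.
have dn := diag_norm hs hi.
have cn := column_norm hs hi.
move: vu Iq dn cn; set u := _ *m _ => -[_ du] Iq.
have {}du : dl F (u o 0) (qpol u u) by apply: (dl_eq du); rewrite ?barE ?addr0.
have [N NE] : exists N : R, N = u i 0 * (u i 0)^! by eexists.
have NB : N^! = N by rewrite NE !barE; ring : (lamV F).
rewrite -NE => dn cn; have tr := dl_tr du.
have I1N : I (1 - N) by rewrite -opprB; apply: IN.
have o2 := omD IOm cn (om_act IOm du I1N).
apply: (om_eq (om_min_add IOm o2 (IM (N - N ^+ 2) Iq))); first by ring.
have e : (u o 0)^! * mu * u o 0 = - qpol u u - (qpol u u)^! * lam.
  by rewrite -[RHS]add0r -tr; ring.
by rewrite !barE NB expr2; ring : e.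
Qed.
Lemma eqv_scalar_ev s i j : H s -> th_hb i -> th_hb j ->
  eqv (gl_mx s *m ev j) 0 ((gl_mx s *m ev i) i 0 *: ev j) 0.
Proof.
move=> hs hi hj; have o1 := column hs hj.
have vu : point (gl_mx s *m ev j) 0 by apply: U_point; [apply: HU|apply: point_evi].
apply/eqvP; split=> //; first exact: point_ev.
- move=> k hk; rewrite [X in _ - X]mxE evE.
  case: (eqVneq k j) => [->|ne]; first by rewrite mulr1; apply: (diag).
  by rewrite mulr0 subr0; apply: (offdiag).
have z : ((gl_mx s *m ev i) i 0 *: ev j) o 0 = 0.
  by rewrite mxE evE eq_sym (negbTE hj) mulr0.
by apply: (om_eq o1); rewrite z ?subr0 // qpol_ev //; ring.
Qed.

(** The condition of scalar_on_basis at t e_-i is the one at e_-i for the conjugate of s by t^-1,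
which is also in H and has the same scalar modulo I. *)
Lemma scalar_on_H s i : H s -> th_hb i -> scalar_on IOm ((gl_mx s *m ev i) i 0) (gl_mx s).
Proof.
move=> hs hi; apply: (scalar_on_basis hn); [exact: HU|by move=> j; apply: eqv_scalar_ev|].
move=> k x y t hk d tE.
have [g eg gE] := e0_gl hk d.
have et : EU t by rewrite (gl_mx_inj (etrans tE (esym gE))).
have [j [fjk _]] := far_ex hn hk hk; have hj := far_hbl fjk.
have hs' := HJV et hs.
have hk' : th_hb (th_opp k) by rewrite th_hb_opp.
have tj : gl_mx t *m ev j = ev j.
  have fkj : far k j by rewrite far_sym.
  rewrite tE TvE (form_far F fkj) lformZl (lform0 (form_e0_ev F hj)).
  by rewrite !mulr0 !scale0r !addr0 subr0.
have tVj : gl_mx t^-1%g *m ev j = ev j by rewrite -{1}tj mulmxA gl_Vmul mul1mx.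
have sj : gl_mx (t^-1 * s * t)%g *m ev j = gl_mx t^-1%g *m (gl_mx s *m ev j).
  by rewrite !gl_mxM -!mulmxA tj.
have /eqvP[_ _ hI _] := EU_respects (IOm := IOm) (EUV et) (eqv_scalar_ev hs hi hj).
have {hI} := hI j hj; rewrite -sj -scalemxAr tVj [X in _ - X]mxE evE eqxx mulr1 => ia.
have e1 := eqv_unit IOm ia (point_evi F hk'); rewrite !mul0r in e1.
have e2 := EU_respects (IOm := IOm) et (eqv_trans (eqv_scalar_ev hs' hj hk') e1).
have e3 : gl_mx t *m (gl_mx (t^-1 * s * t)%g *m ev (th_opp k)) =
    gl_mx s *m (gl_mx t *m ev (th_opp k)).
  by rewrite [LHS]mulmxA [RHS]mulmxA -!gl_mxM !mulgA mulgV mul1g.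
by rewrite e3 -scalemxAr in e2.
Qed.

Lemma conj_Urel s g : H s -> Ur g -> Ur (s * g * s^-1)%g.
Proof.
move=> hs rg; have [us ug] := (HU hs, let: And3 a _ _ := rg in a).
have [i hi] : exists i : idx, th_hb i.
  by exists (Ordinal (isT : 0 < n.*2.+1)%N); rewrite th_hbE /th_pos /=; apply/orP; left; lia.
apply: (point_Urel (IOm := IOm)); first by apply: UM; [apply: UM|apply: UV].
move=> u y vu; have vw := U_point (UV us) vu.
have := scalar_on_respects (scalar_on_H hs hi) (Urel_point IOm rg vw).
by rewrite !gl_mxM !mulmxA gl_mulV mul1mx.
Qed.

(** The scalars a of s and b of s^-1 satisfy a b = 1 modulo I; so [s, t] acts on points
as a b, that is trivially. *)
Lemma in_CUrel s : H s -> CU s.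
Proof.
move=> hs; have us := HU hs; have hsV := HV hs.
have [i hi] : exists i : idx, th_hb i.
  by exists (Ordinal (isT : 0 < n.*2.+1)%N); rewrite th_hbE /th_pos /=; apply/orP; left; lia.
have sa := scalar_on_H hs hi; have sb := scalar_on_H hsV hi.
move: sa sb; set a := (X in scalar_on _ X); set b := (X in _ -> scalar_on _ X _ -> _) => sa sb.
have ab : I (a * b - 1).
  have := eqv_trans (scalar_on_respects sa (sb _ _ (point_evi F hi)))
     (sa _ _ (eqv_point (sb _ _ (point_evi F hi))).2).
  rewrite mulmxA gl_mulV mul1mx !mul0r => /eqvP[_ _ hI _].
  have := IN (hI i hi); congr I; rewrite !mxE eqxx /= ; ring.
split.
  split=> //; apply/seteqP; split=> g.
    by case=> x rx <-; apply: conj_Urel.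
  move=> rg; exists (s^-1 * g * s)%g.
    by have := conj_Urel hsV rg; rewrite invgK.
  by rewrite !mulgA mulgV mul1g mulgK.
move=> t et; have ut := EU_U et.
apply: (point_Urel (IOm := IOm)).
  exact: (UM (UM (UM us ut) (UV us)) (UV ut)).
move=> u y vu; have vw := U_point (UV ut) vu.
have e1 := EU_respects (IOm := IOm) et (sb _ _ vw).
rewrite -scalemxAr mulmxA [gl_mx t *m (_ *m _)]mulmxA gl_mulV mul1mx in e1.
have e2 := scalar_on_respects sa e1; have e3 := sa _ _ (eqv_point e1).2.
have e4 := eqv_unit1 IOm ab vu.
rewrite !scalerA in e3.
have e5 : y * (b * b^!) * (a * a^!) = y * (a * b * (a * b)^!) by rewrite !barE; ring.
rewrite e5 in e3.
have := eqv_trans e2 (eqv_trans e3 e4).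
by rewrite /commutator !gl_mxM !mulmxA.
Qed.
End Level.

Local Open Scope classical_set_scope.

Theorem corollary57 (R : comNzRingType) (F : hermFormRing R) (n : nat)
    (hn : (3 <= n)%N) (H : set (GL R n.*2.+1))
    (subH : is_subgroup H) (HU : H `<=` Ugroup F n) :
  normalized_by (EUgroup F n) H <->
  exists (I : set R) (Om : set (heis F)),
    [/\ is_odd_form_ideal F I Om, EUrel F n I Om `<=` H & H `<=` CUrel F n I Om].
Proof.
split=> [nH|[I [Om [IOm lo hi]]]].
- exists (@levelI R F n H), (@levelOm R F n H); split.
  + exact: level_ideal.
  + exact: EUrel_sub.
  + exact: in_CUrel.
- exact: (sandwich_normalized hn IOm subH lo hi).
Qed.
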